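(* Let $m\in\mathbb{R}$ and $\sigma\in M^m_{\rho,\Lambda}(\mathbb{T}\times\mathbb{Z})$. Then $\sigma$ is $M$-elliptic (of order $m$) if and only if there exists a symbol $\tau\in M^{-m}_{\rho,\Lambda}(\mathbb{T}\times\mathbb{Z})$ such that $$T_\tau T_\sigma=I+R\quad\text{and}\quad T_\sigma T_\tau=I+S,$$ where $R$ and $S$ are pseudo-differential operators with symbols in $\bigcap_{m'\in\mathbb{R}}M^{m'}_{\rho,\Lambda}(\mathbb{T}\times\mathbb{Z})$ and $I$ is the identity operator.
   Context: $\mathbb{N}_0=\{0,1,2,\dots\}$, and $\mathbb{T}=\mathbb{R}/2\pi\mathbb{Z}$ is the one-dimensional torus. For a function $a$ of $k\in\mathbb{Z}$, $\Delta_k a(k)=a(k+1)-a(k)$ and $\Delta_k^\alpha$ is its $\alpha$-th iterate. Weight function: $\Lambda:\mathbb{Z}\to(0,\infty)$ is a fixed function for which there are positive constants $\mu_0\le\mu_1$, $C_0,C_1$ with $C_0(1+|k|)^{\mu_0}\le\Lambda(k)\le C_1(1+|k|)^{\mu_1}$ for all $k\in\mathbb{Z}$. Moreover there is a real constant $\mu\ge\mu_1$ such that for all $\alpha\in\mathbb{N}_0$ and $\gamma\in\{0,1\}$ there is $C_{\alpha,\gamma}>0$ with $|k^\gamma\Delta_k^{\alpha+\gamma}\Lambda(k)|\le C_{\alpha,\gamma}\Lambda(k)^{1-\alpha/\mu}$ for all $k\in\mathbb{Z}$. Fix $\rho\in(0,1/\mu]$. Symbol classes: for $m\in\mathbb{R}$,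 $S^m_{\rho,\Lambda}(\mathbb{T}\times\mathbb{Z})$ is the set of functions $\sigma:\mathbb{T}\times\mathbb{Z}\to\mathbb{C}$, smooth in $x$ for every $k\in\mathbb{Z}$, such that for all $\alpha,\beta\in\mathbb{N}_0$ there is $C_{\alpha,\beta}>0$ with $|\Delta_k^\alpha\partial_x^\beta\sigma(x,k)|\le C_{\alpha,\beta}\Lambda(k)^{m-\rho\alpha}$ for all $(x,k)\in\mathbb{T}\times\mathbb{Z}$. $M^m_{\rho,\Lambda}(\mathbb{T}\times\mathbb{Z})$ is the set of functions $\sigma:\mathbb{T}\times\mathbb{Z}\to\mathbb{C}$, smooth in $x$ for every $k$, such that $k^\gamma\Delta_k^\gamma\sigma(x,k)\in S^m_{\rho,\Lambda}(\mathbb{T}\times\mathbb{Z})$ for each $\gamma\in\{0,1\}$. The pseudo-differential operator with symbol $\sigma$ is $$T_\sigma f(x)=(2\pi)^{-1}\sum_{k\in\mathbb{Z}}\int_{\mathbb{T}}e^{i(x-y)k}\sigma(x,k)f(y)\,dy,\quad x\in\mathbb{T},\ f\in C^\infty(\mathbb{T}).$$ A symbol $\sigma\in M^m_{\rho,\Lambda}(\mathbb{T}\times\mathbb{Z})$ is $M$-elliptic (of order $m$) if there exist positive constants $C$ and $R_0$ such that $|\sigma(x,k)|\ge C\Lambda(k)^m$ for all $x\in\mathbb{T}$ and all $k\in\mathbb{Z}$ with $|k|\ge R_0$. *)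

(* Defs.v *)
From Stdlib Require Export Reals ZArith.
From Coquelicot Require Export Coquelicot.
Open Scope R_scope.

Definition Delta {G : AbelianGroup} (a : Z -> G) (k : Z) : G :=
  minus (a (k + 1)%Z) (a k).

Definition Delta_iter {G : AbelianGroup} (n : nat) (a : Z -> G) : Z -> G :=
  Nat.iter n Delta a.

Definition weight_function (Lam : Z -> R) (mu : R) : Prop :=
  (forall k : Z, 0 < Lam k) /\
  exists mu0 mu1 : R,
    0 < mu0 /\ mu0 <= mu1 /\ mu1 <= mu /\
    (exists C0 C1 : R, 0 < C0 /\ 0 < C1 /\
       forall k : Z,
         C0 * Rpower (1 + Rabs (IZR k)) mu0 <= Lam k /\
         Lam k <= C1 * Rpower (1 + Rabs (IZR k)) mu1) /\
    (forall alpha gamma : nat, (gamma <= 1)%nat ->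
       exists C : R, 0 < C /\
       forall k : Z,
         Rabs (IZR k ^ gamma * Delta_iter (alpha + gamma) Lam k)
           <= C * Rpower (Lam k) (1 - INR alpha / mu)).

(* Derivatives, integrals and series of complex-valued functions are taken
   on real and imaginary parts. *)

Definition C_ex_derive_n (f : R -> C) (n : nat) (x : R) : Prop :=
  ex_derive_n (fun t => Re (f t)) n x /\ ex_derive_n (fun t => Im (f t)) n x.

Definition C_Derive_n (f : R -> C) (n : nat) (x : R) : C :=
  (Derive_n (fun t => Re (f t)) n x, Derive_n (fun t => Im (f t)) n x).

Definition C_RInt (f : R -> C) (a b : R) : C :=
  (RInt (fun t => Re (f t)) a b, RInt (fun t => Im (f t)) a b).

Definition C_Series (a : nat -> C) : C :=
  (Series (fun n => Re (a n)), Series (fun n => Im (a n))).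

(* Sum over k in Z, as the sum over k >= 0 plus the sum over k < 0. *)
Definition Z_Series (a : Z -> C) : C :=
  (C_Series (fun n => a (Z.of_nat n)) +
   C_Series (fun n => a (- Z.of_nat (S n))%Z))%C.

Definition expi (t : R) : C := (cos t, sin t).

(* Functions on the torus R/2piZ are represented by 2pi-periodic functions
   on R; the integral over the torus is then the integral over [0, 2pi]. *)
Definition smooth_torus (f : R -> C) : Prop :=
  (forall x : R, f (x + 2 * PI) = f x) /\
  (forall (n : nat) (x : R), C_ex_derive_n f n x).

Definition symbol_S (Lam : Z -> R) (rho m : R) (sigma : R -> Z -> C) : Prop :=
  (forall k : Z, smooth_torus (fun x => sigma x k)) /\
  (forall alpha beta : nat,
     exists C : R, 0 < C /\
     forall (x : R) (k : Z),
       Cmod (Delta_iter alpha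
               (fun j => C_Derive_n (fun y => sigma y j) beta x) k)
         <= C * Rpower (Lam k) (m - rho * INR alpha)).

Definition symbol_M (Lam : Z -> R) (rho m : R) (sigma : R -> Z -> C) : Prop :=
  (forall k : Z, smooth_torus (fun x => sigma x k)) /\
  (forall gamma : nat, (gamma <= 1)%nat ->
     symbol_S Lam rho m
       (fun x k => (RtoC (IZR k) ^ gamma * Delta_iter gamma (sigma x) k)%C)).

Definition symbol_M_infty (Lam : Z -> R) (rho : R) (sigma : R -> Z -> C)
  : Prop := forall m' : R, symbol_M Lam rho m' sigma.

(* The series converges absolutely when sigma is a symbol of some order and
   f is smooth on the torus; elsewhere the value is not meaningful. *)
Definition pdo (sigma : R -> Z -> C) (f : R -> C) (x : R) : C :=
  (RtoC (/ (2 * PI)) *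
   Z_Series (fun k =>
     C_RInt (fun y => (expi ((x - y) * IZR k) * sigma x k * f y)%C)
       0 (2 * PI)))%C.

Definition M_elliptic (Lam : Z -> R) (m : R) (sigma : R -> Z -> C) : Prop :=
  exists C R0 : R, 0 < C /\ 0 < R0 /\
    forall (x : R) (k : Z), R0 <= Rabs (IZR k) ->
      C * Rpower (Lam k) m <= Cmod (sigma x k).

(* Main.v *)
From Stdlib Require Import Reals ZArith Lra Lia Psatz FunctionalExtensionality IndefiniteDescription.
From Coquelicot Require Import Coquelicot.
Require Import Defs.
Open Scope R_scope.

(** Both directions rest on one computation.  An operator is determined by its
    action on the exponentials e_k(x) = e^{ikx}, and T_a T_b has the symbol
      comp a b (x,k) = sum_l e^{ilx} a(x,k+l) b^(l,k),
    where b^(l,k) is the l-th Fourier coefficient of b(.,k) ([op_comp]).  By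
    Fourier inversion ([fourier_inversion]) the product a b is the same sum with
    a(x,k) in place of a(x,k+l), so the remainder [rem a b] = comp a b - a b
    involves only differences of a; each costs a factor Lam^(-rho), while the
    growth of Lam(k+l) in l is absorbed by the rapid decay of b^(l,k)
    ([tame_peetre], [rem_bound]).  Hence [rem] sends M^m1 x M^m2 to
    M^(m1+m2-rho) ([rem_M]).

    Derivatives and differences of comp a b are controlled without expanding it in
    powers of Delta.  The derivative d_x acts on comp and on rem as a derivation and
    Delta_k as a derivation up to a shift, so finite sums of such terms form a
    family which is stable under both operations and in which every member has
    the right size; [S_coind] says that such a family consists of symbols.  The
    same principle shows that symbols form an algebra containing the inverses of
    its elliptic elements ([S_mult], [S_inverse]).

    Ellipticity implies a parametrix.  Changing sigma for finitely many k is a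
    smoothing perturbation, so sigma is replaced by a nonvanishing q with inverse
    p in M^(-m).  Starting from t_0 = p, the correction
    t_(n+1) = t_n - (comp t_n q - 1) p improves the defect by rho at each step,
    and similarly on the other side ([approx_spec]).  The t_n are glued into
    one symbol by letting n depend on k and grow slowly with |k|: sharp cutoffs
    are harmless in a discrete variable, because a symbol of order m - N that is
    only controlled in x already satisfies the estimates of order m for the first
    N / rho differences ([asymptotic_sum], [M_approx]).  The left and right
    parametrices differ by a smoothing symbol because comp is associative
    ([parametrix]).

    Conversely T_sigma T_tau = I + S reads comp sigma tau = 1 + s when tested on
    exponentials, so sigma tau = 1 + O(Lam^(-rho)), which bounds |sigma| below by
    1 / (2 |tau|) for large |k| ([elliptic_of_right_inverse]). *)

(** * Complex numbers *)

Lemma Cmod_le_abs (z : C) : Cmod z <= Rabs (Re z) + Rabs (Im z).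
Proof.
  apply Rsqr_incr_0_var; [|pose proof (Rabs_pos (Re z)); pose proof (Rabs_pos (Im z)); lra].
  rewrite !Rsqr_pow2, Cmod2_alt, <- (pow2_abs (Re z)), <- (pow2_abs (Im z)).
  pose proof (Rabs_pos (Re z)); pose proof (Rabs_pos (Im z)); nra.
Qed.

Lemma abs_Im_le_Cmod (z : C) : Rabs (Im z) <= Cmod z.
Proof.
  apply Rsqr_incr_0_var; [|apply Cmod_ge_0].
  rewrite !Rsqr_pow2, Cmod2_alt, <- (pow2_abs (Im z)).
  nra.
Qed.

Lemma C_eq (a b : C) : Re a = Re b -> Im a = Im b -> a = b.
Proof. destruct a, b; simpl; intros -> ->; reflexivity. Qed.

Lemma Cmod_RtoC_mult (r : R) (z : C) : Cmod (RtoC r * z)%C = Rabs r * Cmod z.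
Proof. rewrite Cmod_mult, Cmod_R; reflexivity. Qed.

Lemma Cmod_minus_le (a b : C) : Cmod (a - b)%C <= Cmod a + Cmod b.
Proof.
  unfold Cminus; eapply Rle_trans; [apply Cmod_triangle|].
  rewrite Cmod_opp; lra.
Qed.

Lemma expi_plus (s t : R) : expi (s + t) = (expi s * expi t)%C.
Proof. unfold expi, Cmult; simpl; rewrite cos_plus, sin_plus; f_equal; ring. Qed.

Lemma expi_0 : expi 0 = RtoC 1.
Proof. unfold expi; rewrite cos_0, sin_0; reflexivity. Qed.

Lemma Cmod_expi (t : R) : Cmod (expi t) = 1.
Proof.
  unfold Cmod, expi; simpl fst; simpl snd.
  replace (cos t ^ 2 + sin t ^ 2) with 1; [apply sqrt_1|].
  pose proof (sin2_cos2 t); unfold Rsqr in *; nra.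
Qed.

Lemma expi_neg (t : R) : (expi t * expi (- t))%C = RtoC 1.
Proof. rewrite <- expi_plus, Rplus_opp_r; apply expi_0. Qed.

Lemma expi_period_nat (t : R) (n : nat) : expi (t + 2 * INR n * PI) = expi t.
Proof. unfold expi; rewrite cos_period, sin_period; reflexivity. Qed.

Lemma expi_period (t : R) (n : Z) : expi (t + IZR n * (2 * PI)) = expi t.
Proof.
  destruct (Z_le_gt_dec 0 n) as [H|H].
  - rewrite <- (expi_period_nat t (Z.to_nat n)); f_equal.
    rewrite INR_IZR_INZ, Z2Nat.id by lia; ring.
  - rewrite <- (expi_period_nat (t + IZR n * (2 * PI)) (Z.to_nat (- n))); f_equal.
    rewrite INR_IZR_INZ, Z2Nat.id, opp_IZR by lia; ring.
Qed.

(** * Complex-valued functions of a real variable *)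

Definition Cder (f : R -> C) (x : R) (l : C) : Prop :=
  is_derive (fun t => Re (f t)) x (Re l) /\
  is_derive (fun t => Im (f t)) x (Im l).

Lemma Cder_ext (f g : R -> C) x l l' :
  (forall t, f t = g t) -> l = l' -> Cder f x l -> Cder g x l'.
Proof.
  intros E <- [H1 H2]; split;
    [apply is_derive_ext with (2 := H1)|apply is_derive_ext with (2 := H2)];
    intros t; now rewrite E.
Qed.

Lemma Cder_const (c : C) x : Cder (fun _ => c) x (RtoC 0).
Proof. split; apply @is_derive_const. Qed.

Lemma Cder_plus (f g : R -> C) x l l' :
  Cder f x l -> Cder g x l' -> Cder (fun t => f t + g t)%C x (l + l')%C.
Proof. intros [H1 H2] [H3 H4]; split; apply @is_derive_plus; assumption. Qed.

Lemma Cder_minus (f g : R -> C) x l l' :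
  Cder f x l -> Cder g x l' -> Cder (fun t => f t - g t)%C x (l - l')%C.
Proof. intros [H1 H2] [H3 H4]; split; apply @is_derive_minus; assumption. Qed.

Lemma is_derive_Rmult (f g : R -> R) x l l' :
  is_derive f x l -> is_derive g x l' ->
  is_derive (fun t => f t * g t) x (l * g x + f x * l').
Proof. intros H1 H2; apply (is_derive_mult f g x l l' H1 H2); intros; apply Rmult_comm. Qed.

Lemma Cder_mult (f g : R -> C) x l l' :
  Cder f x l -> Cder g x l' ->
  Cder (fun t => f t * g t)%C x (l * g x + f x * l')%C.
Proof.
  intros [H1 H2] [H3 H4]; split; simpl.
  - evar_last.
    + apply @is_derive_minus; apply is_derive_Rmult; eassumption.
    + unfold minus, plus, opp, Re, Im; simpl; ring.
  - evar_last.
    + apply @is_derive_plus; apply is_derive_Rmult; eassumption.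
    + unfold minus, plus, opp, Re, Im; simpl; ring.
Qed.

Lemma Cder_scal (c : C) (f : R -> C) x l :
  Cder f x l -> Cder (fun t => c * f t)%C x (c * l)%C.
Proof.
  intros H; eapply Cder_ext; [intros; reflexivity| |apply (Cder_mult _ _ _ _ _ (Cder_const c x) H)].
  ring.
Qed.

Lemma Cder_expi (c x : R) :
  Cder (fun t => expi (c * t)) x (Ci * RtoC c * expi (c * x))%C.
Proof. split; simpl; auto_derive; trivial; ring. Qed.

Lemma Cder_inv (f : R -> C) x l :
  f x <> RtoC 0 -> Cder f x l -> Cder (fun t => / f t)%C x (- l * (/ f x * / f x))%C.
Proof.
  intros Hf [H1 H2].
  assert (Hn : Re (f x) * Re (f x) + Im (f x) * Im (f x) <> 0).
  { intros E; apply Hf; destruct (f x) as [a b]; simpl in *.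
    apply injective_projections; simpl; nra. }
  assert (N := is_derive_plus _ _ _ _ _ (is_derive_Rmult _ _ _ _ _ H1 H1)
                                        (is_derive_Rmult _ _ _ _ _ H2 H2)).
  split.
  - apply is_derive_ext with
      (fun t => Re (f t) / (Re (f t) * Re (f t) + Im (f t) * Im (f t))).
    { intros t; simpl; unfold Re, Im; now rewrite !Rmult_1_r. }
    evar_last; [apply is_derive_div; [exact H1|exact N|exact Hn]|].
    unfold plus; simpl; unfold Re, Im in *; field; simpl; nra.
  - apply is_derive_ext with
      (fun t => - Im (f t) / (Re (f t) * Re (f t) + Im (f t) * Im (f t))).
    { intros t; simpl; unfold Re, Im; now rewrite !Rmult_1_r. }
    evar_last; [apply is_derive_div; [apply @is_derive_opp; exact H2|exact N|exact Hn]|].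
    unfold plus, opp; simpl; unfold Re, Im in *; field; simpl; nra.
Qed.

Lemma Cder_lipschitz (f f' : R -> C) (M : R) :
  (forall x, Cder f x (f' x)) -> (forall x, Cmod (f' x) <= M) ->
  forall x y, Cmod (f y - f x)%C <= 2 * M * Rabs (y - x).
Proof.
  intros D B x y.
  eapply Rle_trans; [apply Cmod_le_abs|].
  destruct (MVT_gen (fun t => Re (f t)) x y (fun t => Re (f' t))) as (c & _ & E1).
  { intros t _; exact (proj1 (D t)). }
  { intros t _; apply continuity_pt_filterlim, @ex_derive_continuous.
    exists (Re (f' t)); exact (proj1 (D t)). }
  destruct (MVT_gen (fun t => Im (f t)) x y (fun t => Im (f' t))) as (d & _ & E2).
  { intros t _; exact (proj2 (D t)). }
  { intros t _; apply continuity_pt_filterlim, @ex_derive_continuous.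
    exists (Im (f' t)); exact (proj2 (D t)). }
  replace (Re (f y - f x)%C) with (Re (f y) - Re (f x)) by (simpl; unfold Re; ring).
  replace (Im (f y - f x)%C) with (Im (f y) - Im (f x)) by (simpl; unfold Im; ring).
  rewrite E1, E2, !Rabs_mult.
  pose proof (Rabs_pos (y - x)).
  pose proof (Rle_trans _ _ _ (re_le_Cmod (f' c)) (B c)).
  pose proof (Rle_trans _ _ _ (abs_Im_le_Cmod (f' d)) (B d)).
  nra.
Qed.

(** The remainder is quadratic with a constant that depends only on a bound for
    [f''], which is what makes differentiation of series term by term immediate. *)
Lemma Cder_taylor (f f' f'' : R -> C) (M : R) :
  (forall x, Cder f x (f' x)) -> (forall x, Cder f' x (f'' x)) ->
  (forall x, Cmod (f'' x) <= M) ->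
  forall x y, Cmod (f y - f x - RtoC (y - x) * f' x)%C <= 4 * M * (y - x) ^ 2.
Proof.
  intros D1 D2 B x y.
  assert (HM : 0 <= M) by (eapply Rle_trans; [apply Cmod_ge_0|apply (B 0)]).
  eapply Rle_trans; [apply Cmod_le_abs|].
  destruct (MVT_gen (fun t => Re (f t)) x y (fun t => Re (f' t))) as (c & Hc & E1).
  { intros t _; exact (proj1 (D1 t)). }
  { intros t _; apply continuity_pt_filterlim, @ex_derive_continuous.
    exists (Re (f' t)); exact (proj1 (D1 t)). }
  destruct (MVT_gen (fun t => Im (f t)) x y (fun t => Im (f' t))) as (d & Hd & E2).
  { intros t _; exact (proj2 (D1 t)). }
  { intros t _; apply continuity_pt_filterlim, @ex_derive_continuous.
    exists (Im (f' t)); exact (proj2 (D1 t)). }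
  assert (near : forall c, Rmin x y <= c <= Rmax x y -> Rabs (c - x) <= Rabs (y - x)).
  { intros e; unfold Rmin, Rmax; destruct (Rle_dec x y); intros;
      unfold Rabs; destruct (Rcase_abs (e - x)), (Rcase_abs (y - x)); lra. }
  replace (Re (f y - f x - RtoC (y - x) * f' x)%C)
    with ((Re (f' c) - Re (f' x)) * (y - x))
    by (rewrite Rmult_minus_distr_r, <- E1; simpl; unfold Re; ring).
  replace (Im (f y - f x - RtoC (y - x) * f' x)%C)
    with ((Im (f' d) - Im (f' x)) * (y - x))
    by (rewrite Rmult_minus_distr_r, <- E2; simpl; unfold Im; ring).
  rewrite !Rabs_mult, <- (pow2_abs (y - x)).
  pose proof (Rabs_pos (y - x)).
  assert (K : forall c, Rmin x y <= c <= Rmax x y -> Cmod (f' c - f' x)%C <= 2 * M * Rabs (y - x)).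
  { intros e He; eapply Rle_trans; [apply (Cder_lipschitz _ _ M D2 B)|].
    specialize (near e He); nra. }
  assert (Kr := Rle_trans _ _ _ (re_le_Cmod _) (K c Hc)).
  assert (Ki := Rle_trans _ _ _ (abs_Im_le_Cmod _) (K d Hd)).
  replace (Re (f' c - f' x)%C) with (Re (f' c) - Re (f' x)) in Kr by (simpl; unfold Re; ring).
  replace (Im (f' d - f' x)%C) with (Im (f' d) - Im (f' x)) in Ki by (simpl; unfold Im; ring).
  nra.
Qed.

(** * Smooth functions on the torus *)

(** Smoothness as a greatest fixed point: a property of periodic functions that
    passes to some derivative yields derivatives of all orders. *)
Lemma smooth_coind (Y : (R -> C) -> Prop) :
  (forall f, Y f -> (forall x, f (x + 2 * PI) = f x) /\
     exists f', Y f' /\ forall x, Cder f x (f' x)) ->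
  forall f, Y f -> smooth_torus f.
Proof.
  intros HY f Hf; split; [apply (HY f Hf)|].
  (* The n-th derivative is again a member of Y. *)
  assert (H : forall n, exists g, Y g /\ forall x, C_ex_derive_n f n x /\ C_Derive_n f n x = g x).
  { induction n as [|n (g & Yg & Hg)].
    - exists f; split; [assumption|]; intros x; split; [split; exact I|].
      unfold C_Derive_n; simpl; symmetry; apply surjective_pairing.
    - destruct (HY g Yg) as (_ & g' & Yg' & Dg).
      exists g'; split; [assumption|]; intros x.
      assert (Hr : is_derive (Derive_n (fun t => Re (f t)) n) x (Re (g' x))).
      { apply is_derive_ext with (fun t => Re (g t)); [|exact (proj1 (Dg x))].
        intros t; rewrite <- (proj2 (Hg t)); reflexivity. }
      assert (Hi : is_derive (Derive_n (fun t => Im (f t)) n) x (Im (g' x))).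
      { apply is_derive_ext with (fun t => Im (g t)); [|exact (proj2 (Dg x))].
        intros t; rewrite <- (proj2 (Hg t)); reflexivity. }
      split; [split; simpl; eexists; eassumption|].
      unfold C_Derive_n; simpl.
      rewrite (is_derive_unique _ _ _ Hr), (is_derive_unique _ _ _ Hi).
      symmetry; apply surjective_pairing. }
  intros n x; destruct (H n) as (g & _ & Hg); apply Hg.
Qed.

Definition Cderive (f : R -> C) : R -> C := C_Derive_n f 1.

Lemma smooth_Cder f : smooth_torus f -> forall x, Cder f x (Cderive f x).
Proof.
  intros [_ H] x; split; simpl; apply Derive_correct; [exact (proj1 (H 1%nat x))|exact (proj2 (H 1%nat x))].
Qed.

Lemma Cder_Cderive f x l : Cder f x l -> Cderive f x = l.
Proof.
  intros [H1 H2]; apply C_eq; now apply is_derive_unique.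
Qed.

Lemma C_Derive_n_Cderive f n x : C_Derive_n (Cderive f) n x = C_Derive_n f (S n) x.
Proof.
  unfold C_Derive_n; f_equal; rewrite <- Nat.add_1_r, <- Derive_n_comp; reflexivity.
Qed.

Lemma smooth_Cderive f : smooth_torus f -> smooth_torus (Cderive f).
Proof.
  intros Hf; pose proof Hf as [P D]; split.
  - intros x; symmetry; apply Cder_Cderive.
    assert (H := smooth_Cder f Hf (x + 2 * PI)).
    assert (Hs : Cder (fun t => f (t + 2 * PI)) x (Cderive f (x + 2 * PI))).
    { split.
      - evar_last; [apply (is_derive_comp (fun t => Re (f t)) (fun t => t + 2 * PI)); [exact (proj1 H)|]|].
        + auto_derive; [trivial|reflexivity].
        + unfold scal; simpl; unfold mult; simpl; ring.
      - evar_last; [apply (is_derive_comp (fun t => Im (f t)) (fun t => t + 2 * PI)); [exact (proj2 H)|]|].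
        + auto_derive; [trivial|reflexivity].
        + unfold scal; simpl; unfold mult; simpl; ring. }
    eapply Cder_ext; [|reflexivity|apply Hs]; exact P.
  - intros n x; destruct (D (S n) x) as [H1 H2].
    assert (E : forall u : R -> R, ex_derive_n u (S n) x -> ex_derive_n (Derive u) n x).
    { intros u Hu; destruct n; [exact I|].
      simpl in *; apply ex_derive_ext with (2 := Hu).
      intros t; change (Derive (Derive_n u n) t) with (Derive_n u (S n) t).
      rewrite <- Nat.add_1_r, <- (Derive_n_comp u n 1); reflexivity. }
    split; [apply (E (fun t => Re (f t)))|apply (E (fun t => Im (f t)))]; assumption.
Qed.

Lemma periodic_Z (f : R -> C) : (forall x, f (x + 2 * PI) = f x) ->
  forall n x, f (x + IZR n * (2 * PI)) = f x.
Proof.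
  intros P.
  assert (N : forall n x, f (x + INR n * (2 * PI)) = f x).
  { induction n as [|n IH]; intros x.
    - simpl; f_equal; ring.
    - rewrite S_INR; replace (x + (INR n + 1) * (2 * PI)) with (x + INR n * (2 * PI) + 2 * PI) by ring.
      rewrite P; apply IH. }
  intros n x; destruct (Z_le_gt_dec 0 n) as [H|H].
  - rewrite <- (N (Z.to_nat n) x); f_equal.
    rewrite INR_IZR_INZ, Z2Nat.id by lia; reflexivity.
  - rewrite <- (N (Z.to_nat (- n)) (x + IZR n * (2 * PI))); f_equal.
    rewrite INR_IZR_INZ, Z2Nat.id, opp_IZR by lia; ring.
Qed.

Lemma reduce_period (x a : R) : exists n : Z, a <= x + IZR n * (2 * PI) < a + 2 * PI.
Proof.
  pose proof PI_RGT_0.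
  set (q := (x - a) / (2 * PI)).
  exists (- (up q - 1))%Z.
  destruct (archimed q) as [H1 H2].
  rewrite opp_IZR, minus_IZR.
  assert (E : x = a + q * (2 * PI)) by (unfold q; field; lra).
  rewrite E at 1 2.
  split; nra.
Qed.

Lemma continuous_bounded_on (u : R -> R) a b : a <= b -> (forall x, continuous u x) ->
  exists M, forall x, a <= x <= b -> Rabs (u x) <= M.
Proof.
  intros ab Hc.
  assert (K : forall x, a <= x <= b -> continuity_pt (fun x => Rabs (u x)) x).
  { intros x _; apply continuity_pt_filterlim.
    apply (continuous_comp u Rabs); [apply Hc|]; apply continuous_Rabs. }
  destruct (continuity_ab_maj _ a b ab K) as (m & Hm & _).
  exists (Rabs (u m)); exact Hm.
Qed.

Lemma Cder_continuous f x l : Cder f x l ->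
  continuous (fun t => Re (f t)) x /\ continuous (fun t => Im (f t)) x.
Proof.
  intros [H1 H2]; split; apply @ex_derive_continuous; eexists; eassumption.
Qed.

Lemma smooth_bounded f : smooth_torus f -> exists M, 0 < M /\ forall x, Cmod (f x) <= M.
Proof.
  intros Hf.
  assert (HP := PI_RGT_0).
  destruct (continuous_bounded_on (fun t => Re (f t)) 0 (2 * PI)) as [M1 H1]; [lra| |].
  { intros x; apply (Cder_continuous _ _ _ (smooth_Cder f Hf x)). }
  destruct (continuous_bounded_on (fun t => Im (f t)) 0 (2 * PI)) as [M2 H2]; [lra| |].
  { intros x; apply (Cder_continuous _ _ _ (smooth_Cder f Hf x)). }
  assert (P0 := H1 0 ltac:(lra)). assert (P1 := H2 0 ltac:(lra)).
  pose proof (Rabs_pos (Re (f 0))); pose proof (Rabs_pos (Im (f 0))).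
  exists (M1 + M2 + 1); split; [lra|].
  intros x; destruct (reduce_period x 0) as [n Hn].
  rewrite <- (periodic_Z f (proj1 Hf) n).
  eapply Rle_trans; [apply Cmod_le_abs|].
  specialize (H1 (x + IZR n * (2 * PI)) ltac:(lra)); specialize (H2 (x + IZR n * (2 * PI)) ltac:(lra)); lra.
Qed.

Inductive smooth_closure : (R -> C) -> Prop :=
| sc_base f : smooth_torus f -> smooth_closure f
| sc_plus f g : smooth_closure f -> smooth_closure g -> smooth_closure (fun x => f x + g x)%C
| sc_mult f g : smooth_closure f -> smooth_closure g -> smooth_closure (fun x => f x * g x)%C.

Lemma smooth_closure_smooth f : smooth_closure f -> smooth_torus f.
Proof.
  apply smooth_coind; clear f; intros f Hf; induction Hf as [f Hf|f g Hf [Pf (f' & Yf & Df)] Hg [Pg (g' & Yg & Dg)]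
    |f g Hf [Pf (f' & Yf & Df)] Hg [Pg (g' & Yg & Dg)]].
  - split; [apply Hf|]; exists (Cderive f); split; [apply sc_base, smooth_Cderive, Hf|].
    now apply smooth_Cder.
  - split; [intros x; now rewrite Pf, Pg|].
    exists (fun x => f' x + g' x)%C; split; [now apply sc_plus|].
    intros x; now apply Cder_plus.
  - split; [intros x; now rewrite Pf, Pg|].
    exists (fun x => f' x * g x + f x * g' x)%C; split.
    + apply (sc_plus (fun x => f' x * g x)%C (fun x => f x * g' x)%C); now apply sc_mult.
    + intros x; now apply Cder_mult.
Qed.

Lemma smooth_plus f g : smooth_torus f -> smooth_torus g -> smooth_torus (fun x => f x + g x)%C.
Proof. intros; apply smooth_closure_smooth, sc_plus; now apply sc_base. Qed.

Lemma smooth_mult f g : smooth_torus f -> smooth_torus g -> smooth_torus (fun x => f x * g x)%C.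
Proof. intros; apply smooth_closure_smooth, sc_mult; now apply sc_base. Qed.

Lemma smooth_const c : smooth_torus (fun _ => c).
Proof.
  apply (smooth_coind (fun f => exists c, f = fun _ => c)); [|now exists c].
  intros f (d & ->); split; [reflexivity|].
  exists (fun _ => RtoC 0); split; [now exists (RtoC 0)|].
  intros x; apply Cder_const.
Qed.

Lemma smooth_expi (k : Z) : smooth_torus (fun x => expi (IZR k * x)).
Proof.
  assert (P : forall x, expi (IZR k * (x + 2 * PI)) = expi (IZR k * x)).
  { intros x; rewrite <- (expi_period (IZR k * x) k); f_equal; ring. }
  apply (smooth_coind (fun f => exists c, f = fun x => c * expi (IZR k * x))%C).
  - intros f (d & ->); split; [intros x; now rewrite P|].
    exists (fun x => (d * (Ci * RtoC (IZR k))) * expi (IZR k * x))%C; split; [eexists; reflexivity|].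
    intros x; eapply Cder_ext; [reflexivity| |apply Cder_scal, Cder_expi]; ring.
  - exists (RtoC 1); apply functional_extensionality; intros x; ring.
Qed.

Lemma smooth_scal c f : smooth_torus f -> smooth_torus (fun x => c * f x)%C.
Proof. intros; apply smooth_mult; [apply smooth_const|assumption]. Qed.

(** * Absolutely convergent sums over the integers *)

Definition wt (k : Z) : R := 1 + Rabs (IZR k).

Lemma wt_ge_1 k : 1 <= wt k.
Proof. unfold wt; pose proof (Rabs_pos (IZR k)); lra. Qed.

Lemma wt_pow_pos k n : 0 < wt k ^ n.
Proof. apply pow_lt; pose proof (wt_ge_1 k); lra. Qed.

Lemma wt_opp k : wt (- k) = wt k.
Proof. unfold wt; now rewrite opp_IZR, Rabs_Ropp. Qed.

Lemma wt_plus k l : wt (k + l) <= wt k * wt l.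
Proof.
  unfold wt; rewrite plus_IZR.
  pose proof (Rabs_triang (IZR k) (IZR l)).
  pose proof (Rabs_pos (IZR k)); pose proof (Rabs_pos (IZR l)); nra.
Qed.

Lemma wt_le_shift k l : wt k <= wt (k + l) * wt l.
Proof. pose proof (wt_plus (k + l) (- l)) as H; rewrite wt_opp in H.
  now replace (k + l + - l)%Z with k in H by ring. Qed.

Lemma is_lim_seq_inv_shift : is_lim_seq (fun n => / (2 + INR n)) 0.
Proof.
  assert (H : is_lim_seq (fun n => 2 + INR n) p_infty).
  { apply (is_lim_seq_plus _ _ 2 p_infty); [apply is_lim_seq_const|apply is_lim_seq_INR|reflexivity]. }
  apply (is_lim_seq_inv _ _ H); discriminate.
Qed.

Lemma is_series_telescope : is_series (fun n => / (1 + INR n) - / (2 + INR n)) 1.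
Proof.
  change (is_lim_seq (sum_n (fun n => / (1 + INR n) - / (2 + INR n))) 1).
  apply is_lim_seq_ext with (fun n => 1 - / (2 + INR n)).
  - intros n; induction n as [|n IH].
    + rewrite sum_O; simpl; lra.
    + rewrite sum_Sn, <- IH, S_INR; unfold plus; simpl.
      pose proof (pos_INR n); field; lra.
  - assert (L := is_lim_seq_minus' _ _ 1 0 (is_lim_seq_const 1) is_lim_seq_inv_shift).
    rewrite Rminus_0_r in L; exact L.
Qed.

(** Comparison with the telescoping series of [1/(1+n) - 1/(2+n)]. *)
Lemma Series_quadratic (a : nat -> R) K : (forall n, Rabs (a n) <= K / (1 + INR n) ^ 2) ->
  ex_series a /\ Rabs (Series a) <= 2 * K.
Proof.
  intros H.
  assert (HK : 0 <= K).
  { specialize (H 0%nat); simpl in H; pose proof (Rabs_pos (a 0%nat)); field_simplify in H; lra. }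
  assert (B : forall n, Rabs (a n) <= 2 * K * (/ (1 + INR n) - / (2 + INR n))).
  { intros n; eapply Rle_trans; [apply H|].
    pose proof (pos_INR n).
    apply Rle_trans with (K * (2 * (/ (1 + INR n) - / (2 + INR n)))); [|lra].
    unfold Rdiv; apply Rmult_le_compat_l; [assumption|].
    apply Rmult_le_reg_r with ((1 + INR n) ^ 2 * (2 + INR n)); [apply Rmult_lt_0_compat; nra|].
    replace (/ (1 + INR n) ^ 2 * ((1 + INR n) ^ 2 * (2 + INR n))) with (2 + INR n) by (field; lra).
    replace (2 * (/ (1 + INR n) - / (2 + INR n)) * ((1 + INR n) ^ 2 * (2 + INR n)))
      with (2 * (1 + INR n)) by (field; lra). lra. }
  assert (T := is_series_scal_l (2 * K) _ _ is_series_telescope).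
  assert (E : ex_series (fun n => Rabs (a n))).
  { eapply (@ex_series_le R_AbsRing R_CompleteNormedModule); [|eexists; apply T].
    intros n; simpl; unfold norm; simpl; unfold abs; simpl; rewrite Rabs_Rabsolu; apply B. }
  split; [now apply ex_series_Rabs|].
  eapply Rle_trans; [now apply Series_Rabs|].
  apply is_series_unique in T; simpl in T; rewrite Rmult_1_r in T; rewrite <- T.
  apply Series_le; [intros n; split; [apply Rabs_pos|apply B]|].
  eexists; apply (is_series_scal_l (2 * K) _ _ is_series_telescope).
Qed.

Definition Cser (a : nat -> C) : Prop :=
  ex_series (fun n => Re (a n)) /\ ex_series (fun n => Im (a n)).

Lemma C_Series_quadratic (a : nat -> C) K :
  (forall n, Cmod (a n) <= K / (1 + INR n) ^ 2) ->
  Cser a /\ Cmod (C_Series a) <= 4 * K.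
Proof.
  intros H.
  destruct (Series_quadratic (fun n => Re (a n)) K) as [E1 B1].
  { intros n; eapply Rle_trans; [apply re_le_Cmod|apply H]. }
  destruct (Series_quadratic (fun n => Im (a n)) K) as [E2 B2].
  { intros n; eapply Rle_trans; [apply abs_Im_le_Cmod|apply H]. }
  split; [now split|].
  eapply Rle_trans; [apply Cmod_le_abs|]; simpl; lra.
Qed.

Lemma C_Series_ext (a b : nat -> C) : (forall n, a n = b n) -> C_Series a = C_Series b.
Proof. intros E; replace b with a; [reflexivity|now apply functional_extensionality]. Qed.

Lemma C_Series_plus a b : Cser a -> Cser b ->
  C_Series (fun n => a n + b n)%C = (C_Series a + C_Series b)%C.
Proof.
  intros [H1 H2] [H3 H4]; apply C_eq; simpl.
  - apply (Series_plus (fun n => Re (a n)) (fun n => Re (b n))); assumption.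
  - apply (Series_plus (fun n => Im (a n)) (fun n => Im (b n))); assumption.
Qed.

Lemma C_Series_scal c a : Cser a -> C_Series (fun n => c * a n)%C = (c * C_Series a)%C.
Proof.
  intros [H1 H2]; destruct c as [x y].
  assert (E : forall z u, ex_series u -> ex_series (fun n : nat => z * u n)).
  { intros z u Hu; now apply @ex_series_scal_l. }
  apply C_eq; simpl.
  - rewrite <- !Series_scal_l; apply Series_minus; now apply E.
  - rewrite <- !Series_scal_l, Rplus_comm.
    rewrite Rplus_comm; apply (Series_plus (fun n => x * Im (a n)) (fun n => y * Re (a n))); now apply E.
Qed.

Lemma C_Series_incr_1 a : Cser a -> C_Series a = (a 0%nat + C_Series (fun n => a (S n)))%C.
Proof.
  intros [H1 H2]; apply C_eq; simpl.
  - apply (Series_incr_1 (fun n => Re (a n)) H1).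
  - apply (Series_incr_1 (fun n => Im (a n)) H2).
Qed.

Lemma C_Series_0 : C_Series (fun _ => RtoC 0) = RtoC 0.
Proof.
  assert (Z : Series (fun _ => 0) = 0).
  { transitivity (Series (fun _ : nat => 0 * 0)).
    - apply Series_ext; intros; ring.
    - rewrite (Series_scal_l 0 (fun _ => 0)); ring. }
  apply C_eq; simpl; apply Z.
Qed.

(** Quadratic decay makes sums absolutely convergent and is preserved by shifts and
    linear combinations. *)
Definition zdom (a : Z -> C) : Prop := exists K, forall k, Cmod (a k) <= K / wt k ^ 2.

Lemma zdom_halves a K : (forall k, Cmod (a k) <= K / wt k ^ 2) ->
  (forall n, Cmod (a (Z.of_nat n)) <= K / (1 + INR n) ^ 2) /\
  (forall n, Cmod (a (- Z.of_nat (S n))%Z) <= K / (1 + INR n) ^ 2).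
Proof.
  intros H.
  assert (HK : 0 <= K).
  { specialize (H 0%Z); unfold wt in H; rewrite Rabs_R0 in H.
    pose proof (Cmod_ge_0 (a 0%Z)); field_simplify in H; lra. }
  assert (W : forall n, wt (Z.of_nat n) = 1 + INR n).
  { intros n; unfold wt; rewrite <- INR_IZR_INZ, Rabs_right; [reflexivity|apply Rle_ge, pos_INR]. }
  split; intros n.
  - rewrite <- W; apply H.
  - eapply Rle_trans; [apply H|]; rewrite wt_opp, W, S_INR.
    unfold Rdiv; apply Rmult_le_compat_l; [assumption|].
    pose proof (pos_INR n); apply Rinv_le_contravar; nra.
Qed.

Lemma zdom_Cser a : zdom a -> Cser (fun n => a (Z.of_nat n)) /\
  Cser (fun n => a (- Z.of_nat (S n))%Z).
Proof.
  intros [K H]; apply zdom_halves in H as [H1 H2].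
  split; eapply C_Series_quadratic; eassumption.
Qed.

Lemma Z_Series_bound a K : (forall k, Cmod (a k) <= K / wt k ^ 2) ->
  Cmod (Z_Series a) <= 8 * K.
Proof.
  intros H; apply zdom_halves in H as [H1 H2].
  eapply Rle_trans; [apply Cmod_triangle|].
  apply C_Series_quadratic in H1 as [_ H1]; apply C_Series_quadratic in H2 as [_ H2]; lra.
Qed.

Lemma Z_Series_ext a b : (forall k, a k = b k) -> Z_Series a = Z_Series b.
Proof. intros E; replace b with a; [reflexivity|now apply functional_extensionality]. Qed.

Lemma Z_Series_plus a b : zdom a -> zdom b ->
  Z_Series (fun k => a k + b k)%C = (Z_Series a + Z_Series b)%C.
Proof.
  intros Ha Hb; apply zdom_Cser in Ha as [H1 H2]; apply zdom_Cser in Hb as [H3 H4].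
  unfold Z_Series; rewrite !C_Series_plus by assumption; ring.
Qed.

Lemma Z_Series_scal c a : zdom a -> Z_Series (fun k => c * a k)%C = (c * Z_Series a)%C.
Proof.
  intros Ha; apply zdom_Cser in Ha as [H1 H2].
  unfold Z_Series; rewrite !C_Series_scal by assumption; ring.
Qed.

Lemma zdom_ext a b : (forall k, a k = b k) -> zdom a -> zdom b.
Proof. intros E [K H]; exists K; intros k; now rewrite <- E. Qed.

Lemma zdom_scal c a : zdom a -> zdom (fun k => c * a k)%C.
Proof.
  intros [K H]; exists (Cmod c * K); intros k; rewrite Cmod_mult.
  unfold Rdiv; rewrite Rmult_assoc; apply Rmult_le_compat_l; [apply Cmod_ge_0|apply H].
Qed.

Lemma zdom_plus a b : zdom a -> zdom b -> zdom (fun k => a k + b k)%C.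
Proof.
  intros [K H] [K' H']; exists (K + K'); intros k.
  eapply Rle_trans; [apply Cmod_triangle|].
  unfold Rdiv; rewrite Rmult_plus_distr_r; apply Rplus_le_compat; [apply H|apply H'].
Qed.

Lemma zdom_minus a b : zdom a -> zdom b -> zdom (fun k => a k - b k)%C.
Proof.
  intros Ha Hb; apply zdom_ext with (fun k => a k + - RtoC 1 * b k)%C.
  - intros k; ring.
  - apply zdom_plus; [assumption|now apply zdom_scal].
Qed.

Lemma Z_Series_minus a b : zdom a -> zdom b ->
  Z_Series (fun k => a k - b k)%C = (Z_Series a - Z_Series b)%C.
Proof.
  intros Ha Hb; rewrite (Z_Series_ext _ (fun k => a k + - RtoC 1 * b k)%C).
  - rewrite Z_Series_plus, Z_Series_scal by (trivial; now apply zdom_scal).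
    ring.
  - intros k; ring.
Qed.

Lemma zdom_shift a n : zdom a -> zdom (fun k => a (k + n)%Z).
Proof.
  intros [K H]; exists (K * wt n ^ 2); intros k; eapply Rle_trans; [apply H|].
  assert (HK : 0 <= K).
  { specialize (H 0%Z); unfold wt in H; rewrite Rabs_R0 in H.
    pose proof (Cmod_ge_0 (a 0%Z)); field_simplify in H; lra. }
  unfold Rdiv; rewrite Rmult_assoc; apply Rmult_le_compat_l; [assumption|].
  pose proof (wt_le_shift k n); pose proof (wt_ge_1 k); pose proof (wt_ge_1 (k + n)).
  pose proof (wt_ge_1 n).
  apply Rmult_le_reg_r with (wt k ^ 2 * wt (k + n) ^ 2);
    [apply Rmult_lt_0_compat; apply wt_pow_pos|].
  replace (/ wt (k + n) ^ 2 * (wt k ^ 2 * wt (k + n) ^ 2)) with (wt k ^ 2) by (field; lra).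
  replace (wt n ^ 2 * / wt k ^ 2 * (wt k ^ 2 * wt (k + n) ^ 2)) with ((wt (k + n) * wt n) ^ 2)
    by (field; lra).
  apply pow_incr; lra.
Qed.

(** The two halves of [Z_Series] exchange one term at each unit shift. *)
Lemma Z_Series_shift a n : zdom a -> Z_Series (fun k => a (k + n)%Z) = Z_Series a.
Proof.
  assert (One : forall a, zdom a -> Z_Series (fun k => a (k + 1)%Z) = Z_Series a).
  { intros b Hb; pose proof (zdom_Cser _ Hb) as [H1 _].
    pose proof (zdom_Cser _ (zdom_shift b 1 Hb)) as [_ H2].
    unfold Z_Series.
    rewrite (C_Series_incr_1 (fun n => b (Z.of_nat n))), (C_Series_incr_1 (fun n => b (- Z.of_nat (S n) + 1)%Z)) by assumption.
    rewrite (C_Series_ext (fun n => b (Z.of_nat n + 1)%Z) (fun n => b (Z.of_nat (S n))))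
      by (intros; f_equal; lia).
    rewrite (C_Series_ext (fun n => b (- Z.of_nat (S (S n)) + 1)%Z) (fun n => b (- Z.of_nat (S n))%Z))
      by (intros; f_equal; lia).
    simpl; ring. }
  assert (Nat : forall n a, zdom a -> Z_Series (fun k => a (k + Z.of_nat n)%Z) = Z_Series a).
  { clear - One; induction n as [|n IH]; intros a Ha.
    - apply Z_Series_ext; intros; f_equal; lia.
    - rewrite <- (IH a Ha), <- (One _ (zdom_shift a (Z.of_nat n) Ha)).
      apply Z_Series_ext; intros; f_equal; lia. }
  intros Ha; destruct (Z_le_gt_dec 0 n).
  - rewrite <- (Nat (Z.to_nat n) a Ha); apply Z_Series_ext; intros; f_equal; lia.
  - rewrite <- (Nat (Z.to_nat (- n)) _ (zdom_shift a n Ha)); apply Z_Series_ext; intros; f_equal; lia.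
Qed.

Definition single (k0 : Z) (c : C) (k : Z) : C := if Z.eq_dec k k0 then c else RtoC 0.

Lemma zdom_single k0 c : zdom (single k0 c).
Proof.
  exists (Cmod c * wt k0 ^ 2); intros k; unfold single; destruct Z.eq_dec as [->|].
  - right; field; pose proof (wt_ge_1 k0); lra.
  - rewrite Cmod_0; apply Rdiv_le_0_compat; [|apply wt_pow_pos].
    apply Rmult_le_pos; [apply Cmod_ge_0|left; apply wt_pow_pos].
Qed.

Lemma Z_Series_single k0 c : Z_Series (single k0 c) = c.
Proof.
  rewrite <- (Z_Series_shift _ k0 (zdom_single k0 c)).
  rewrite (Z_Series_ext _ (single 0 c)).
  - unfold Z_Series; rewrite C_Series_incr_1 by apply (zdom_Cser _ (zdom_single 0 c)).
    rewrite (C_Series_ext (fun n => single 0 c (Z.of_nat (S n))) (fun _ => RtoC 0)).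
    + rewrite (C_Series_ext (fun n => single 0 c (- Z.of_nat (S n))%Z) (fun _ => RtoC 0)).
      * rewrite C_Series_0; unfold single; simpl; ring.
      * intros n; unfold single; destruct Z.eq_dec; [lia|reflexivity].
    + intros n; unfold single; destruct Z.eq_dec; [lia|reflexivity].
  - intros k; unfold single; destruct (Z.eq_dec (k + k0) k0), (Z.eq_dec k 0); trivial; lia.
Qed.

(** Partial sums over [|k| <= N] are written as [Z_Series (cut N a)], so that the
    linearity of [Z_Series] applies to them. *)
Definition cut (N : nat) (a : Z -> C) (k : Z) : C :=
  if Z_le_dec (Z.abs k) (Z.of_nat N) then a k else RtoC 0.

Lemma cut_0 a k : cut 0 a k = single 0 (a 0%Z) k.
Proof.
  unfold cut, single; destruct Z_le_dec, Z.eq_dec; subst; trivial; lia.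
Qed.

Lemma cut_S N a k : cut (S N) a k =
  (cut N a k + (single (Z.of_nat (S N)) (a (Z.of_nat (S N))) k +
    single (- Z.of_nat (S N)) (a (- Z.of_nat (S N))%Z) k))%C.
Proof.
  unfold cut, single.
  destruct (Z_le_dec (Z.abs k) (Z.of_nat (S N))), (Z_le_dec (Z.abs k) (Z.of_nat N)),
    (Z.eq_dec k (Z.of_nat (S N))), (Z.eq_dec k (- Z.of_nat (S N))); try lia; subst; ring.
Qed.

Lemma zdom_cut N a : zdom (cut N a).
Proof.
  induction N as [|N IH].
  - apply zdom_ext with (2 := zdom_single 0 (a 0%Z)); intros k; symmetry; apply cut_0.
  - eapply zdom_ext; [intros k; symmetry; apply cut_S|].
    apply zdom_plus; [apply IH|apply zdom_plus; apply zdom_single].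
Qed.

Lemma Z_Series_cut_0 a : Z_Series (cut 0 a) = a 0%Z.
Proof. rewrite (Z_Series_ext _ _ (cut_0 a)); apply Z_Series_single. Qed.

Lemma Z_Series_cut_S N a : Z_Series (cut (S N) a) =
  (Z_Series (cut N a) + (a (Z.of_nat (S N)) + a (- Z.of_nat (S N))%Z))%C.
Proof.
  rewrite (Z_Series_ext _ _ (cut_S N a)).
  rewrite !Z_Series_plus, !Z_Series_single; trivial;
    try apply zdom_cut; try apply zdom_single.
  apply zdom_plus; apply zdom_single.
Qed.

Lemma cut_tail a K j N : (forall k, Cmod (a k) <= K / wt k ^ (2 + j)) ->
  forall k, Cmod (a k - cut N a k)%C <= K / (2 + INR N) ^ j / wt k ^ 2.
Proof.
  intros H k.
  assert (HK : 0 <= K).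
  { specialize (H 0%Z); unfold wt in H; rewrite Rabs_R0, Rplus_0_r, pow1 in H.
    pose proof (Cmod_ge_0 (a 0%Z)); field_simplify in H; lra. }
  pose proof (pos_INR N).
  unfold cut; destruct Z_le_dec as [L|L].
  - replace (a k - a k)%C with (RtoC 0) by ring; rewrite Cmod_0.
    apply Rdiv_le_0_compat; [|apply wt_pow_pos].
    apply Rdiv_le_0_compat; [assumption|apply pow_lt; lra].
  - replace (a k - 0)%C with (a k) by ring.
    eapply Rle_trans; [apply H|]; rewrite pow_add; unfold Rdiv.
    rewrite Rinv_mult, (Rmult_comm (/ wt k ^ 2)), <- Rmult_assoc.
    apply Rmult_le_compat_r; [left; apply Rinv_0_lt_compat, wt_pow_pos|].
    apply Rmult_le_compat_l; [assumption|].
    apply Rinv_le_contravar; [apply pow_lt; lra|].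
    apply pow_incr; split; [lra|].
    unfold wt; rewrite <- abs_IZR.
    assert (IZR (Z.of_nat N + 1) <= IZR (Z.abs k)) as Q by (apply IZR_le; lia).
    rewrite plus_IZR, <- INR_IZR_INZ in Q; lra.
Qed.

Lemma zdom_fast a K j : (forall k, Cmod (a k) <= K / wt k ^ (2 + j)) ->
  forall k, Cmod (a k) <= K / wt k ^ 2.
Proof.
  intros H k; eapply Rle_trans; [apply H|].
  assert (HK : 0 <= K).
  { specialize (H 0%Z); unfold wt in H; rewrite Rabs_R0, Rplus_0_r, pow1 in H.
    pose proof (Cmod_ge_0 (a 0%Z)); field_simplify in H; lra. }
  apply Rmult_le_compat_l; [assumption|].
  apply Rinv_le_contravar; [apply wt_pow_pos|].
  apply Rle_pow; [apply wt_ge_1|lia].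
Qed.

Lemma Z_Series_tail a K j N : (forall k, Cmod (a k) <= K / wt k ^ (2 + j)) ->
  Cmod (Z_Series a - Z_Series (cut N a))%C <= 8 * (K / (2 + INR N) ^ j).
Proof.
  intros H; rewrite <- Z_Series_minus; [|exists K; now apply (zdom_fast a K j)|apply zdom_cut].
  apply Z_Series_bound; now apply cut_tail.
Qed.

Lemma eq_of_small (z w : C) K : (forall n : nat, Cmod (z - w)%C <= K / (2 + INR n)) -> z = w.
Proof.
  intros H.
  assert (Cmod (z - w)%C <= 0).
  { apply (is_lim_seq_le (fun _ => Cmod (z - w)%C) (fun n => K * / (2 + INR n)) (Cmod (z - w)%C) 0).
    - exact H.
    - apply is_lim_seq_const.
    - assert (L := is_lim_seq_scal_l _ K _ is_lim_seq_inv_shift).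
      simpl in L; rewrite Rmult_0_r in L; exact L. }
  assert (E : (z - w)%C = RtoC 0).
  { apply Cmod_eq_0; pose proof (Cmod_ge_0 (z - w)%C); lra. }
  replace z with ((z - w) + w)%C by ring; rewrite E; ring.
Qed.

(** The spare decay in [k] makes the cutoff error vanish uniformly. *)
Lemma Z_Series_swap (a : Z -> Z -> C) K :
  (forall k l, Cmod (a k l) <= K / (wt k ^ 3 * wt l ^ 2)) ->
  Z_Series (fun k => Z_Series (fun l => a k l)) =
  Z_Series (fun l => Z_Series (fun k => a k l)).
Proof.
  intros H.
  assert (HK : 0 <= K).
  { specialize (H 0%Z 0%Z); unfold wt in H; rewrite Rabs_R0, Rplus_0_r, !pow1 in H.
    pose proof (Cmod_ge_0 (a 0%Z 0%Z)); field_simplify in H; lra. }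
  assert (Hl : forall k l, Cmod (a k l) <= K / wt k ^ 3 / wt l ^ 2).
  { intros k l; eapply Rle_trans; [apply H|]; right; field; split; apply Rgt_not_eq;
      pose proof (wt_ge_1 k); pose proof (wt_ge_1 l); lra. }
  assert (Hk : forall l k, Cmod (a k l) <= K / wt l ^ 2 / wt k ^ (2 + 1)).
  { intros k l; eapply Rle_trans; [apply H|]; right; simpl; field; split; apply Rgt_not_eq;
      pose proof (wt_ge_1 k); pose proof (wt_ge_1 l); lra. }
  assert (Dl : forall k, zdom (fun l => a k l)) by (intros k; eexists; apply Hl).
  assert (Dk : forall l, zdom (fun k => a k l)).
  { intros l; eexists; apply (zdom_fast _ _ 1), Hk. }
  assert (Hkk : forall k, Cmod (Z_Series (fun l => a k l)) <= 8 * K / wt k ^ (2 + 1)).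
  { intros k; eapply Rle_trans; [apply Z_Series_bound, Hl|]; right; simpl; field.
    pose proof (wt_ge_1 k); lra. }
  assert (Hll : forall l, Cmod (Z_Series (fun k => a k l)) <= 8 * K / wt l ^ 2).
  { intros l; eapply Rle_trans; [apply Z_Series_bound, (zdom_fast _ _ 1), Hk|]; right; field.
    pose proof (wt_ge_1 l); lra. }
  assert (Hlc : forall N l, Cmod (Z_Series (fun k => a k l) - Z_Series (cut N (fun k => a k l)))%C
     <= 8 * K / (2 + INR N) / wt l ^ 2).
  { intros N l; eapply Rle_trans; [apply (Z_Series_tail _ (K / wt l ^ 2) 1), Hk|]; right; simpl; field.
    pose proof (pos_INR N); pose proof (wt_ge_1 l); lra. }
  assert (Dlc : forall N, zdom (fun l => Z_Series (cut N (fun k => a k l)))).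
  { intros N; eapply zdom_ext; [|apply zdom_minus; [eexists; apply Hll|eexists; apply (Hlc N)]].
    intros l; simpl; ring. }
  assert (F : forall N, Z_Series (cut N (fun k => Z_Series (fun l => a k l))) =
     Z_Series (fun l => Z_Series (cut N (fun k => a k l)))).
  { induction N as [|N IH].
    - rewrite Z_Series_cut_0; apply Z_Series_ext; intros l; now rewrite Z_Series_cut_0.
    - rewrite Z_Series_cut_S, IH.
      rewrite (Z_Series_ext _ _ (fun l => Z_Series_cut_S N (fun k => a k l))).
      rewrite !Z_Series_plus; trivial; apply zdom_plus; trivial. }
  (* Each of the two cutoff errors is at most 8 * 8 * K / (2 + N). *)
  apply eq_of_small with (128 * K); intros N.
  replace (Z_Series (fun k => Z_Series (fun l => a k l)) - Z_Series (fun l => Z_Series (fun k => a k l)))%C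
    with ((Z_Series (fun k => Z_Series (fun l => a k l)) - Z_Series (cut N (fun k => Z_Series (fun l => a k l))))
     - (Z_Series (fun l => Z_Series (fun k => a k l)) - Z_Series (fun l => Z_Series (cut N (fun k => a k l)))))%C
    by (rewrite F; ring).
  eapply Rle_trans; [apply Cmod_minus_le|].
  apply Rle_trans with (8 * (8 * K / (2 + INR N) ^ 1) + 8 * (8 * K / (2 + INR N))).
  - apply Rplus_le_compat.
    + apply (Z_Series_tail _ (8 * K) 1), Hkk.
    + rewrite <- Z_Series_minus; [|eexists; apply Hll|apply Dlc].
      apply Z_Series_bound, Hlc.
  - right; field; pose proof (pos_INR N); lra.
Qed.

(** Uniformly bounded second derivatives control the Taylor remainder of every
    term at once, and hence the difference quotients of the sum. *)
Lemma Cder_Z_Series (g g' g'' : Z -> R -> C) K :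
  (forall k x, Cder (g k) x (g' k x)) -> (forall k x, Cder (g' k) x (g'' k x)) ->
  (forall x, zdom (fun k => g k x)) -> (forall x, zdom (fun k => g' k x)) ->
  (forall k x, Cmod (g'' k x) <= K / wt k ^ 2) ->
  forall x, Cder (fun t => Z_Series (fun k => g k t)) x (Z_Series (fun k => g' k x)).
Proof.
  intros D1 D2 S0 S1 B x.
  set (G := fun t => Z_Series (fun k => g k t)).
  set (L := Z_Series (fun k => g' k x)).
  assert (T : forall y, Cmod (G y - G x - RtoC (y - x) * L)%C <= 32 * K * (y - x) ^ 2).
  { intros y; unfold G, L.
    rewrite <- Z_Series_scal, <- !Z_Series_minus; trivial; try now apply zdom_scal.
    2: now apply zdom_minus.
    eapply Rle_trans; [apply Z_Series_bound with (K := 4 * K * (y - x) ^ 2)|right; ring].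
    intros k; eapply Rle_trans; [apply (Cder_taylor _ _ _ (K / wt k ^ 2) (D1 k) (D2 k) (B k))|].
    right; field; pose proof (wt_ge_1 k); lra. }
  assert (R : forall (u : C -> R), (forall z, Rabs (u z) <= Cmod z) ->
     (forall y, u (G y - G x - RtoC (y - x) * L)%C = u (G y) - u (G x) - (y - x) * u L) ->
     is_derive (fun t => u (G t)) x (u L)).
  { intros u U1 U2; apply is_derive_Reals; intros eps Heps.
    assert (HK : 0 <= K).
    { specialize (B 0%Z 0); unfold wt in B; rewrite Rabs_R0 in B.
      pose proof (Cmod_ge_0 (g'' 0%Z 0)); field_simplify in B; lra. }
    assert (Hd : 0 < eps / (32 * K + 1)) by (apply Rdiv_lt_0_compat; lra).
    exists (mkposreal _ Hd); simpl; intros h Hh Hlt.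
    specialize (U2 (x + h)); replace (x + h - x) with h in U2 by ring.
    assert (Q := Rle_trans _ _ _ (U1 _) (T (x + h))).
    replace (x + h - x) with h in Q by ring; rewrite U2 in Q.
    replace ((u (G (x + h)) - u (G x)) / h - u L)
      with ((u (G (x + h)) - u (G x) - h * u L) / h) by (field; assumption).
    unfold Rdiv; rewrite Rabs_mult, Rabs_inv.
    pose proof (Rabs_pos_lt h Hh) as Hp.
    apply Rmult_lt_reg_r with (Rabs h); [assumption|].
    rewrite Rmult_assoc, Rinv_l, Rmult_1_r by lra.
    eapply Rle_lt_trans; [apply Q|]; rewrite <- (pow2_abs h).
    assert ((32 * K + 1) * Rabs h < eps).
    { apply Rmult_lt_compat_l with (r := 32 * K + 1) in Hlt; [|lra].
      replace ((32 * K + 1) * (eps / (32 * K + 1))) with eps in Hlt by (field; lra); exact Hlt. }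
    nra. }
  split.
  - apply (R Re); [apply re_le_Cmod|].
    intros y; simpl; unfold Re; ring.
  - apply (R Im); [apply abs_Im_le_Cmod|].
    intros y; simpl; unfold Im; ring.
Qed.

(** * Integrals of complex-valued functions *)

Definition Ccont (f : R -> C) : Prop :=
  forall x, continuous (fun t => Re (f t)) x /\ continuous (fun t => Im (f t)) x.

Lemma Cder_Ccont f f' : (forall x, Cder f x (f' x)) -> Ccont f.
Proof. intros D x; exact (Cder_continuous _ _ _ (D x)). Qed.

Lemma smooth_Ccont f : smooth_torus f -> Ccont f.
Proof. intros Hf; apply (Cder_Ccont f (Cderive f)); now apply smooth_Cder. Qed.

Lemma ex_RInt_cont (u : R -> R) a b : (forall x, continuous u x) -> ex_RInt u a b.
Proof. intros H; apply (ex_RInt_continuous (V := R_CompleteNormedModule)); intros; apply H. Qed.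

Lemma C_RInt_ext (f g : R -> C) a b : (forall x, f x = g x) -> C_RInt f a b = C_RInt g a b.
Proof. intros E; replace g with f; [reflexivity|now apply functional_extensionality]. Qed.

Lemma C_RInt_plus f g a b : Ccont f -> Ccont g ->
  C_RInt (fun x => f x + g x)%C a b = (C_RInt f a b + C_RInt g a b)%C.
Proof.
  intros Hf Hg; apply C_eq; simpl.
  - apply (RInt_plus (V := R_CompleteNormedModule) (fun x => Re (f x)) (fun x => Re (g x))); apply ex_RInt_cont; intros x; [exact (proj1 (Hf x))|exact (proj1 (Hg x))].
  - apply (RInt_plus (V := R_CompleteNormedModule) (fun x => Im (f x)) (fun x => Im (g x))); apply ex_RInt_cont; intros x; [exact (proj2 (Hf x))|exact (proj2 (Hg x))].
Qed.

Lemma C_RInt_scal c f a b : Ccont f ->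
  C_RInt (fun x => c * f x)%C a b = (c * C_RInt f a b)%C.
Proof.
  intros Hf; destruct c as [p q].
  assert (E1 : forall z, ex_RInt (fun x => z * Re (f x)) a b).
  { intros z; apply (ex_RInt_scal (V := R_NormedModule) (fun x => Re (f x))), ex_RInt_cont; intros x; exact (proj1 (Hf x)). }
  assert (E2 : forall z, ex_RInt (fun x => z * Im (f x)) a b).
  { intros z; apply (ex_RInt_scal (V := R_NormedModule) (fun x => Im (f x))), ex_RInt_cont; intros x; exact (proj2 (Hf x)). }
  assert (S1 : forall z, RInt (fun x => z * Re (f x)) a b = z * RInt (fun x => Re (f x)) a b).
  { intros z; apply (RInt_scal (V := R_CompleteNormedModule) (fun x => Re (f x))), ex_RInt_cont; intros x; exact (proj1 (Hf x)). }
  assert (S2 : forall z, RInt (fun x => z * Im (f x)) a b = z * RInt (fun x => Im (f x)) a b).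
  { intros z; apply (RInt_scal (V := R_CompleteNormedModule) (fun x => Im (f x))), ex_RInt_cont; intros x; exact (proj2 (Hf x)). }
  apply C_eq; simpl; rewrite <- !S1, <- !S2.
  - apply (RInt_minus (fun x => p * Re (f x)) (fun x => q * Im (f x))); trivial.
  - apply (RInt_plus (fun x => p * Im (f x)) (fun x => q * Re (f x))); trivial.
Qed.

Lemma C_RInt_bound f a b M : a <= b -> Ccont f -> (forall x, Cmod (f x) <= M) ->
  Cmod (C_RInt f a b) <= 2 * M * (b - a).
Proof.
  intros ab Hf B; eapply Rle_trans; [apply Cmod_le_abs|]; simpl.
  assert (H1 : Rabs (RInt (fun x => Re (f x)) a b) <= (b - a) * M).
  { apply abs_RInt_le_const; [assumption|apply ex_RInt_cont; intros x; exact (proj1 (Hf x))|].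
    intros t _; eapply Rle_trans; [apply re_le_Cmod|apply B]. }
  assert (H2 : Rabs (RInt (fun x => Im (f x)) a b) <= (b - a) * M).
  { apply abs_RInt_le_const; [assumption|apply ex_RInt_cont; intros x; exact (proj2 (Hf x))|].
    intros t _; eapply Rle_trans; [apply abs_Im_le_Cmod|apply B]. }
  simpl in *; lra.
Qed.

Lemma C_RInt_der f f' a b : (forall x, Cder f x (f' x)) -> Ccont f' ->
  C_RInt f' a b = (f b - f a)%C.
Proof.
  intros D Hc; apply C_eq; simpl; apply is_RInt_unique.
  - apply (is_RInt_derive (fun x => Re (f x)) (fun x => Re (f' x))); intros x _; [exact (proj1 (D x))|exact (proj1 (Hc x))].
  - apply (is_RInt_derive (fun x => Im (f x)) (fun x => Im (f' x))); intros x _; [exact (proj2 (D x))|exact (proj2 (Hc x))].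
Qed.

Lemma Cder_C_RInt f x : Ccont f -> Cder (fun t => C_RInt f 0 t) x (f x).
Proof.
  intros Hc; split.
  - apply (is_derive_RInt (fun t => Re (f t)) _ 0); [|exact (proj1 (Hc x))].
    apply filter_forall; intros y; apply (RInt_correct (V := R_CompleteNormedModule)), ex_RInt_cont.
    intros t; exact (proj1 (Hc t)).
  - apply (is_derive_RInt (fun t => Im (f t)) _ 0); [|exact (proj2 (Hc x))].
    apply filter_forall; intros y; apply (RInt_correct (V := R_CompleteNormedModule)), ex_RInt_cont.
    intros t; exact (proj2 (Hc t)).
Qed.

(** The sum of the primitives is differentiable term by term, so the fundamental
    theorem of calculus replaces a uniform convergence argument. *)
Lemma C_RInt_Z_Series (g g' g'' : Z -> R -> C) K b :
  (forall k x, Cder (g k) x (g' k x)) -> (forall k x, Cder (g' k) x (g'' k x)) ->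
  (forall k x, Cmod (g k x) <= K / wt k ^ 2) ->
  (forall k x, Cmod (g' k x) <= K / wt k ^ 2) ->
  (forall k x, Cmod (g'' k x) <= K / wt k ^ 2) ->
  C_RInt (fun x => Z_Series (fun k => g k x)) 0 b = Z_Series (fun k => C_RInt (g k) 0 b).
Proof.
  intros D1 D2 B0 B1 B2.
  assert (Z0 : forall f, C_RInt f 0 0 = RtoC 0).
  { intros f; apply C_eq; simpl; apply (RInt_point (V := R_CompleteNormedModule)). }
  assert (DG : forall k x, Cder (fun t => C_RInt (g k) 0 t) x (g k x)).
  { intros k x; apply Cder_C_RInt, (Cder_Ccont _ _ (D1 k)). }
  assert (ZG : forall x, zdom (fun k => C_RInt (g k) 0 x)).
  { intros x; exists (2 * K * Rabs x); intros k.
    pose proof (Cder_lipschitz _ _ _ (DG k) (B0 k) 0 x) as L.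
    rewrite Z0, Rminus_0_r in L.
    replace (C_RInt (g k) 0 x - 0)%C with (C_RInt (g k) 0 x) in L by ring.
    eapply Rle_trans; [apply L|]; right; field; pose proof (wt_ge_1 k); lra. }
  rewrite (C_RInt_der (fun x => Z_Series (fun k => C_RInt (g k) 0 x))).
  - rewrite (Z_Series_ext (fun k => C_RInt (g k) 0 0) (single 0 0)), Z_Series_single; [ring|].
    intros k; rewrite Z0; unfold single; now destruct Z.eq_dec.
  - apply Cder_Z_Series with (g'' := g') (K := K); trivial; intros x; exists K; intros k; trivial.
  - apply Cder_Ccont with (f' := fun x => Z_Series (fun k => g' k x)).
    apply Cder_Z_Series with (g'' := g'') (K := K); trivial; intros x; exists K; intros k; trivial.
Qed.

(** * Fourier coefficients *)

Definition hat (f : R -> C) (l : Z) : C :=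
  (RtoC (/ (2 * PI)) * C_RInt (fun y => f y * expi (IZR (- l) * y)) 0 (2 * PI))%C.

Lemma smooth_hat_integrand f l : smooth_torus f ->
  smooth_torus (fun y => f y * expi (IZR (- l) * y))%C.
Proof. intros; apply smooth_mult; [assumption|apply smooth_expi]. Qed.

Lemma hat_ext f g l : (forall x, f x = g x) -> hat f l = hat g l.
Proof. intros E; unfold hat; f_equal; apply C_RInt_ext; intros; now rewrite E. Qed.

Lemma hat_plus f g l : smooth_torus f -> smooth_torus g ->
  hat (fun x => f x + g x)%C l = (hat f l + hat g l)%C.
Proof.
  intros Hf Hg; unfold hat.
  rewrite (C_RInt_ext _ (fun y => f y * expi (IZR (- l) * y) + g y * expi (IZR (- l) * y))%C)
    by (intros; ring).
  rewrite C_RInt_plus by (now apply smooth_Ccont, smooth_hat_integrand); ring.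
Qed.

Lemma hat_scal c f l : smooth_torus f -> hat (fun x => c * f x)%C l = (c * hat f l)%C.
Proof.
  intros Hf; unfold hat.
  rewrite (C_RInt_ext _ (fun y => c * (f y * expi (IZR (- l) * y)))%C) by (intros; ring).
  rewrite C_RInt_scal by (now apply smooth_Ccont, smooth_hat_integrand); ring.
Qed.

Lemma hat_minus f g l : smooth_torus f -> smooth_torus g ->
  hat (fun x => f x - g x)%C l = (hat f l - hat g l)%C.
Proof.
  intros Hf Hg; rewrite (hat_ext _ (fun x => f x + (- RtoC 1) * g x)%C) by (intros; ring).
  rewrite hat_plus, hat_scal by (trivial; now apply smooth_scal); ring.
Qed.

Lemma hat_bound_cont f l M : Ccont (fun y => f y * expi (IZR (- l) * y))%C -> (forall x, Cmod (f x) <= M) ->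
  Cmod (hat f l) <= 2 * M.
Proof.
  intros Hf B; unfold hat; pose proof PI_RGT_0.
  rewrite Cmod_RtoC_mult, Rabs_right by (left; apply Rinv_0_lt_compat; lra).
  apply Rmult_le_reg_l with (2 * PI); [lra|].
  rewrite <- Rmult_assoc, Rinv_r, Rmult_1_l by lra.
  eapply Rle_trans; [apply C_RInt_bound with (M := M)|right; ring]; trivial; [lra|].
  intros x; rewrite Cmod_mult, Cmod_expi, Rmult_1_r; apply B.
Qed.

Lemma hat_bound f l M : smooth_torus f -> (forall x, Cmod (f x) <= M) ->
  Cmod (hat f l) <= 2 * M.
Proof. intros Hf; apply hat_bound_cont; now apply smooth_Ccont, smooth_hat_integrand. Qed.

Lemma hat_Cderive f l : smooth_torus f -> hat (Cderive f) l = (Ci * RtoC (IZR l) * hat f l)%C.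
Proof.
  intros Hf; unfold hat.
  assert (D : forall x, Cder (fun y => f y * expi (IZR (- l) * y))%C x
    (Cderive f x * expi (IZR (- l) * x) + (- Ci * RtoC (IZR l)) * (f x * expi (IZR (- l) * x)))%C).
  { intros x; eapply Cder_ext; [reflexivity| |apply Cder_mult; [now apply smooth_Cder|apply Cder_expi]].
    rewrite opp_IZR, RtoC_opp; ring. }
  assert (H1 : smooth_torus (fun x => Cderive f x * expi (IZR (- l) * x))%C)
    by now apply smooth_hat_integrand, smooth_Cderive.
  assert (H2 := smooth_hat_integrand f l Hf).
  assert (I := C_RInt_der _ _ 0 (2 * PI) D).
  rewrite C_RInt_plus, C_RInt_scal in I; try apply smooth_Ccont; trivial.
  2: now apply smooth_scal.
  assert (P := proj1 H2 0); rewrite Rplus_0_l in P; simpl in P; rewrite P in I.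
  specialize (I ltac:(apply smooth_Ccont, smooth_plus; [assumption|now apply smooth_scal])).
  set (u := C_RInt (fun x => Cderive f x * expi (IZR (- l) * x))%C 0 (2 * PI)) in *.
  set (v := C_RInt (fun x => f x * expi (IZR (- l) * x))%C 0 (2 * PI)) in *.
  replace u with (Ci * RtoC (IZR l) * v)%C; [ring|].
  replace u with ((u + - Ci * RtoC (IZR l) * v) + Ci * RtoC (IZR l) * v)%C by ring.
  rewrite I; ring.
Qed.

Lemma hat_modulate f k l : hat (fun x => f x * expi (IZR k * x))%C l = hat f (l - k).
Proof.
  unfold hat; f_equal; apply C_RInt_ext; intros y.
  rewrite <- Cmult_assoc, <- expi_plus; do 2 f_equal.
  rewrite !opp_IZR, minus_IZR; ring.
Qed.

Lemma hat_1 l : hat (fun _ => RtoC 1) l = single 0 (RtoC 1) l.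
Proof.
  unfold single; destruct Z.eq_dec as [->|Hl].
  - unfold hat; rewrite (C_RInt_ext _ (fun _ => RtoC 1)).
    + pose proof PI_RGT_0; apply C_eq; unfold C_RInt; simpl; rewrite !RInt_const;
        unfold scal; simpl; unfold mult; simpl; field; lra.
    + intros x; simpl; rewrite Rmult_0_l, expi_0; ring.
  - assert (E := hat_Cderive _ l (smooth_const (RtoC 1))).
    rewrite (hat_ext _ (fun x => RtoC 0 * RtoC 1)%C), (hat_scal _ (fun _ => RtoC 1)) in E.
    2: apply smooth_const.
    2: intros x; rewrite (Cder_Cderive _ _ _ (Cder_const (RtoC 1) x)); ring.
    rewrite Cmult_0_l in E.
    assert (NZ : (Ci * RtoC (IZR l))%C <> RtoC 0).
    { apply Cmult_neq_0.
      - intros H; apply (f_equal snd) in H; simpl in H; lra.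
      - intros H; apply RtoC_inj in H; apply Hl, eq_IZR; exact H. }
    destruct (Ceq_dec (hat (fun _ => RtoC 1) l) (RtoC 0)) as [H|H]; [exact H|].
    symmetry in E; exfalso; revert E; apply Cmult_neq_0; assumption.
Qed.

Lemma hat_expi k l : hat (fun x => expi (IZR k * x)) l = single k (RtoC 1) l.
Proof.
  rewrite (hat_ext _ (fun x => RtoC 1 * expi (IZR k * x))%C) by (intros; ring).
  rewrite (hat_modulate (fun _ => RtoC 1)), hat_1; unfold single.
  destruct (Z.eq_dec (l - k) 0), (Z.eq_dec l k); trivial; lia.
Qed.

(** Integration by parts, in the form that turns decay of order [N] for [f] and
    its derivative into decay of order [N+1] for [f]. *)
Lemma hat_wt_step f l : smooth_torus f ->
  Cmod (hat f l) * wt l = Cmod (hat f l) + Cmod (hat (Cderive f) l).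
Proof.
  intros Hf; rewrite hat_Cderive, !Cmod_mult, Cmod_R by assumption.
  replace (Cmod Ci) with 1; [unfold wt; ring|].
  unfold Cmod, Ci; simpl; rewrite Rmult_0_l, Rplus_0_l, !Rmult_1_l; now rewrite sqrt_1.
Qed.

Lemma hat_decay f N : smooth_torus f -> exists K, 0 < K /\ forall l, Cmod (hat f l) <= K / wt l ^ N.
Proof.
  revert f; induction N as [|N IH]; intros f Hf.
  - destruct (smooth_bounded f Hf) as (M & HM & B); exists (2 * M); split; [lra|]; intros l.
    simpl; rewrite Rdiv_1_r; now apply hat_bound.
  - destruct (IH f Hf) as (K1 & P1 & H1), (IH (Cderive f) (smooth_Cderive f Hf)) as (K2 & P2 & H2).
    exists (K1 + K2); split; [lra|]; intros l.
    apply Rmult_le_reg_r with (wt l); [pose proof (wt_ge_1 l); lra|].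
    rewrite hat_wt_step by assumption.
    replace ((K1 + K2) / wt l ^ S N * wt l) with (K1 / wt l ^ N + K2 / wt l ^ N).
    + apply Rplus_le_compat; trivial.
    + simpl; field; split; [apply Rgt_not_eq, wt_pow_pos|pose proof (wt_ge_1 l); lra].
Qed.

(** * Fourier inversion *)

Lemma sin_ge_third s : 0 <= s <= 2 -> s / 3 <= sin s.
Proof.
  intros Hs; destruct (pre_sin_bound s 0) as [H _]; [lra|lra|].
  unfold sin_approx, sin_term in H; simpl in H; nra.
Qed.

(** From [1 - cos t = 2 sin^2 (t/2)] and the lower bound for the sine on [0,2],
    which contains [PI/2]. *)
Lemma sqr_le_cos t : Rabs t <= PI -> t ^ 2 <= 18 * (1 - cos t).
Proof.
  intros Ht; pose proof PI_4.
  assert (E : 1 - cos t = 2 * (sin (Rabs t / 2)) ^ 2).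
  { replace (cos t) with (cos (2 * (Rabs t / 2))).
    - rewrite cos_2a_sin; ring.
    - replace (2 * (Rabs t / 2)) with (Rabs t) by field.
      unfold Rabs; destruct Rcase_abs; [apply cos_neg|reflexivity]. }
  rewrite E, <- (pow2_abs t); pose proof (Rabs_pos t).
  pose proof (sin_ge_third (Rabs t / 2) ltac:(lra)); nra.
Qed.

Fixpoint dirichlet (N : nat) (t : R) : R :=
  match N with O => 1 | S n => dirichlet n t + 2 * cos (INR (S n) * t) end.

(** Unnormalised: the usual kernel is [fejer M / M]. *)
Fixpoint fejer (M : nat) (t : R) : R :=
  match M with O => 0 | S m => fejer m t + dirichlet m t end.

Lemma dirichlet_closed N t :
  (1 - cos t) * dirichlet N t = cos (INR N * t) - cos (INR (S N) * t).
Proof.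
  induction N as [|N IH].
  - simpl; rewrite Rmult_0_l, cos_0, !Rmult_1_l; ring.
  - cbn [dirichlet]; rewrite Rmult_plus_distr_l, IH.
    replace (INR (S (S N)) * t) with (INR (S N) * t + t) by (rewrite (S_INR (S N)); ring).
    replace (INR N * t) with (INR (S N) * t - t) by (rewrite (S_INR N); ring).
    rewrite cos_plus, cos_minus; ring.
Qed.

Lemma fejer_closed M t : (1 - cos t) * fejer M t = 1 - cos (INR M * t).
Proof.
  induction M as [|M IH].
  - simpl; rewrite Rmult_0_l, cos_0; ring.
  - cbn [fejer]; rewrite Rmult_plus_distr_l, IH, dirichlet_closed; ring.
Qed.

Lemma smooth_cos_shift (k : Z) (a : R) : smooth_torus (fun y => RtoC (cos (IZR k * (y - a)))).
Proof.
  replace (fun y => RtoC (cos (IZR k * (y - a)))) with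
    (fun y => RtoC (/ 2) * expi (- (IZR k * a)) * expi (IZR k * y) +
              RtoC (/ 2) * expi (IZR k * a) * expi (IZR (- k) * y))%C.
  - apply smooth_plus; apply smooth_scal, smooth_expi.
  - apply functional_extensionality; intros y.
    rewrite <- !Cmult_assoc, <- !expi_plus, opp_IZR.
    replace (- (IZR k * a) + IZR k * y) with (IZR k * (y - a)) by ring.
    replace (IZR k * a + - IZR k * y) with (- (IZR k * (y - a))) by ring.
    unfold expi; rewrite cos_neg, sin_neg; apply C_eq; simpl; field.
Qed.

Lemma smooth_dirichlet N a : smooth_torus (fun y => RtoC (dirichlet N (y - a))).
Proof.
  induction N as [|N IH].
  - apply (smooth_const (RtoC 1)).
  - replace (fun y => RtoC (dirichlet (S N) (y - a))) with
      (fun y => RtoC (dirichlet N (y - a)) + RtoC 2 * RtoC (cos (IZR (Z.of_nat (S N)) * (y - a))))%C.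
    + apply smooth_plus; [exact IH|apply smooth_scal, smooth_cos_shift].
    + apply functional_extensionality; intros y; cbn [dirichlet].
      rewrite <- INR_IZR_INZ, RtoC_plus, RtoC_mult; reflexivity.
Qed.

Lemma smooth_fejer N a : smooth_torus (fun y => RtoC (fejer N (y - a))).
Proof.
  induction N as [|N IH].
  - apply (smooth_const (RtoC 0)).
  - replace (fun y => RtoC (fejer (S N) (y - a))) with
      (fun y => RtoC (fejer N (y - a)) + RtoC (dirichlet N (y - a)))%C.
    + apply smooth_plus; [exact IH|apply smooth_dirichlet].
    + apply functional_extensionality; intros y; cbn [fejer]; now rewrite RtoC_plus.
Qed.

Definition fterm (f : R -> C) (x : R) (k : Z) : C := (hat f k * expi (IZR k * x))%C.

Lemma fterm_hat0 f x k : smooth_torus f ->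
  fterm f x k = hat (fun y => f y * expi (IZR k * (x - y)))%C 0.
Proof.
  intros Hf; unfold fterm.
  rewrite (hat_ext (fun y => f y * expi (IZR k * (x - y)))%C
    (fun y => expi (IZR k * x) * (f y * expi (IZR (- k) * y)))%C).
  - rewrite hat_scal, hat_modulate by (now apply smooth_hat_integrand).
    replace (0 - - k)%Z with k by lia; ring.
  - intros y.
    replace (IZR k * (x - y)) with (IZR k * x + IZR (- k) * y) by (rewrite opp_IZR; ring).
    rewrite expi_plus; ring.
Qed.

Lemma partial_sum_dirichlet f x N : smooth_torus f ->
  Z_Series (cut N (fterm f x)) = hat (fun y => f y * RtoC (dirichlet N (y - x)))%C 0.
Proof.
  intros Hf; induction N as [|N IH].
  - rewrite Z_Series_cut_0, fterm_hat0 by assumption; apply hat_ext; intros y.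
    rewrite Rmult_0_l, expi_0; reflexivity.
  - rewrite Z_Series_cut_S, IH, !fterm_hat0 by assumption.
    assert (S : forall k, smooth_torus (fun y => f y * expi (IZR k * (x - y)))%C).
    { intros k; replace (fun y => f y * expi (IZR k * (x - y)))%C
        with (fun y => expi (IZR k * x) * (f y * expi (IZR (- k) * y)))%C.
      - now apply smooth_scal, smooth_hat_integrand.
      - apply functional_extensionality; intros y.
        replace (IZR k * (x - y)) with (IZR k * x + IZR (- k) * y) by (rewrite opp_IZR; ring).
        rewrite expi_plus; ring. }
    rewrite <- !hat_plus; trivial.
    + apply hat_ext; intros y; cbn [dirichlet].
      rewrite RtoC_plus, RtoC_mult, opp_IZR, <- INR_IZR_INZ.
      replace (cos (INR (Datatypes.S N) * (y - x))) with (cos (INR (Datatypes.S N) * (x - y)))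
        by (rewrite <- cos_neg; f_equal; ring).
      replace (- INR (Datatypes.S N) * (x - y)) with (- (INR (Datatypes.S N) * (x - y))) by ring.
      unfold expi; rewrite cos_neg, sin_neg.
      destruct (f y) as [p q]; apply C_eq; simpl; ring.
    + apply smooth_mult; [assumption|apply smooth_dirichlet].
    + now apply smooth_plus.
Qed.

Fixpoint Csum (u : nat -> C) (M : nat) : C :=
  match M with O => RtoC 0 | S m => (Csum u m + u m)%C end.

Lemma cesaro_fejer f x M : smooth_torus f ->
  Csum (fun N => Z_Series (cut N (fterm f x))) M = hat (fun y => f y * RtoC (fejer M (y - x)))%C 0.
Proof.
  intros Hf; induction M as [|M IH].
  - cbn [Csum fejer]; rewrite (hat_ext _ (fun y => RtoC 0 * RtoC 1)%C) by (intros; ring).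
    rewrite (hat_scal _ (fun _ => RtoC 1)) by apply smooth_const; ring.
  - cbn [Csum]; rewrite IH, partial_sum_dirichlet, <- hat_plus; trivial.
    + apply hat_ext; intros y; cbn [fejer]; rewrite RtoC_plus; ring.
    + apply smooth_mult; [assumption|apply smooth_fejer].
    + apply smooth_mult; [assumption|apply smooth_dirichlet].
Qed.

Lemma fterm_fast f x j : smooth_torus f ->
  exists K, 0 < K /\ forall k, Cmod (fterm f x k) <= K / wt k ^ (2 + j).
Proof.
  intros Hf; destruct (hat_decay f (2 + j) Hf) as (K & HK & H); exists K; split; [assumption|].
  intros k; unfold fterm; rewrite Cmod_mult, Cmod_expi, Rmult_1_r; apply H.
Qed.

Lemma zdom_fterm f x : smooth_torus f -> zdom (fterm f x).
Proof. intros Hf; destruct (fterm_fast f x 0 Hf) as (K & _ & H); exists K; exact H. Qed.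

(** Near [x0] a double zero is dominated by [1 - cos]; periodicity moves every
    point into the period centred at [x0]. *)
Lemma double_zero_bound f x0 : smooth_torus f -> f x0 = RtoC 0 -> Cderive f x0 = RtoC 0 ->
  exists Q, forall y, Cmod (f y) <= Q * (1 - cos (y - x0)).
Proof.
  intros Hf Z0 Z1.
  destruct (smooth_bounded (Cderive (Cderive f))) as (M & HM & B); [now apply smooth_Cderive, smooth_Cderive|].
  exists (72 * M); intros y.
  destruct (reduce_period y (x0 - PI)) as (n & Hn).
  rewrite <- (periodic_Z f (proj1 Hf) n y).
  set (z := y + IZR n * (2 * PI)) in *.
  replace (cos (y - x0)) with (cos (z - x0)).
  2:{ assert (E := expi_period (y - x0) n); apply (f_equal Re) in E; simpl in E.
      rewrite <- E; f_equal; unfold z; ring. }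
  assert (T := Cder_taylor f (Cderive f) (Cderive (Cderive f)) M
    (smooth_Cder f Hf) (smooth_Cder _ (smooth_Cderive _ Hf)) B x0 z).
  rewrite Z0, Z1 in T.
  replace (f z - 0 - RtoC (z - x0) * 0)%C with (f z) in T by ring.
  assert (Rabs (z - x0) <= PI) by (apply Rabs_le; lra).
  pose proof (sqr_le_cos (z - x0) H); nra.
Qed.

(** The kernel [fejer M] has size [O(1)] after multiplication by [1 - cos],
    so the sums of the first [M] partial sums stay bounded as [M] grows. *)
Lemma inversion_double_zero f x0 : smooth_torus f -> f x0 = RtoC 0 -> Cderive f x0 = RtoC 0 ->
  Z_Series (fterm f x0) = RtoC 0.
Proof.
  intros Hf Z0 Z1.
  destruct (double_zero_bound f x0 Hf Z0 Z1) as (Q & HQ).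
  destruct (fterm_fast f x0 2 Hf) as (K & HK & Hdec).
  set (s := Z_Series (fterm f x0)).
  assert (Hc : forall M, Cmod (Csum (fun N => Z_Series (cut N (fterm f x0))) M) <= 4 * Q).
  { intros M; rewrite cesaro_fejer by assumption.
    replace (4 * Q) with (2 * (2 * Q)) by ring.
    apply hat_bound; [apply smooth_mult; [assumption|apply smooth_fejer]|].
    intros y; rewrite Cmod_mult, Cmod_R.
    pose proof (COS_bound (y - x0)) as [_ C1].
    pose proof (COS_bound (INR M * (y - x0))) as [C2 C3].
    assert (HQ0 : 0 <= Q).
    { specialize (HQ (x0 + PI)); replace (x0 + PI - x0) with PI in HQ by ring.
      rewrite cos_PI in HQ; pose proof (Cmod_ge_0 (f (x0 + PI))); lra. }
    apply Rle_trans with (Q * (1 - cos (y - x0)) * Rabs (fejer M (y - x0))).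
    - apply Rmult_le_compat_r; [apply Rabs_pos|apply HQ].
    - rewrite Rmult_assoc, <- (Rabs_right (1 - cos (y - x0))), <- Rabs_mult, fejer_closed by lra.
      rewrite Rabs_right by lra; nra. }
  (* The errors of the partial sums are summable, by comparison with a telescoping series. *)
  assert (Hd : forall M, Cmod (RtoC (INR M) * s - Csum (fun N => Z_Series (cut N (fterm f x0))) M)%C
     <= 8 * K * (1 - / (1 + INR M))).
  { induction M as [|M IH].
    - cbn [Csum]; simpl INR; replace (RtoC 0 * s - RtoC 0)%C with (RtoC 0) by ring.
      rewrite Cmod_0; right; field.
    - cbn [Csum]; rewrite S_INR, RtoC_plus.
      match goal with |- Cmod (_ - (?a + ?b)) <= _ =>
        replace ((RtoC (INR M) + RtoC 1) * s - (a + b))%C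
          with ((RtoC (INR M) * s - a) + (s - b))%C by ring end.
      eapply Rle_trans; [apply Cmod_triangle|].
      eapply Rle_trans; [apply Rplus_le_compat; [apply IH|apply (Z_Series_tail _ K 2), Hdec]|].
      pose proof (pos_INR M).
      assert (E : / (2 + INR M) ^ 2 <= / (1 + INR M) - / (2 + INR M)).
      { apply Rmult_le_reg_r with ((1 + INR M) * (2 + INR M) ^ 2); [apply Rmult_lt_0_compat; nra|].
        replace (/ (2 + INR M) ^ 2 * ((1 + INR M) * (2 + INR M) ^ 2)) with (1 + INR M) by (field; lra).
        replace ((/ (1 + INR M) - / (2 + INR M)) * ((1 + INR M) * (2 + INR M) ^ 2)) with (2 + INR M)
          by (field; lra). lra. }
      replace (1 + (INR M + 1)) with (2 + INR M) by ring; unfold Rdiv; nra. }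
  apply eq_of_small with (2 * (4 * Q + 8 * K)); intros n.
  replace (s - 0)%C with s by ring.
  pose proof (pos_INR n).
  assert (Q0 : 0 <= 4 * Q) by (eapply Rle_trans; [apply Cmod_ge_0|apply (Hc 0%nat)]).
  specialize (Hc (S n)); specialize (Hd (S n)).
  assert (B : INR (S n) * Cmod s <= 4 * Q + 8 * K).
  { rewrite <- (Rabs_right (INR (S n))) by (apply Rle_ge, pos_INR).
    rewrite <- Cmod_RtoC_mult.
    match type of Hc with Cmod ?a <= _ =>
      replace (RtoC (INR (S n)) * s)%C with ((RtoC (INR (S n)) * s - a) + a)%C by ring end.
    eapply Rle_trans; [apply Cmod_triangle|].
    assert (0 < / (1 + INR (S n))) by (apply Rinv_0_lt_compat; pose proof (pos_INR (S n)); lra).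
    nra. }
  rewrite S_INR in B.
  apply Rmult_le_reg_r with (2 + INR n); [lra|].
  replace (2 * (4 * Q + 8 * K) / (2 + INR n) * (2 + INR n)) with (2 * (4 * Q + 8 * K)) by (field; lra).
  pose proof (Cmod_ge_0 s); nra.
Qed.

Lemma inversion_plus f g x : smooth_torus f -> smooth_torus g ->
  Z_Series (fterm (fun y => f y + g y)%C x) = (Z_Series (fterm f x) + Z_Series (fterm g x))%C.
Proof.
  intros Hf Hg; rewrite <- Z_Series_plus by now apply zdom_fterm.
  apply Z_Series_ext; intros k; unfold fterm; rewrite hat_plus by assumption; ring.
Qed.

Lemma inversion_expi c k x :
  Z_Series (fterm (fun y => c * expi (IZR k * y))%C x) = (c * expi (IZR k * x))%C.
Proof.
  rewrite (Z_Series_ext _ (single k (c * expi (IZR k * x))%C)); [apply Z_Series_single|].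
  intros l; unfold fterm; rewrite hat_scal, hat_expi by apply smooth_expi.
  unfold single; destruct Z.eq_dec as [->|]; ring.
Qed.

(** A trigonometric polynomial, for which inversion is orthogonality, removes the
    value and the derivative of [f] at [x]. *)
Theorem fourier_inversion f x : smooth_torus f ->
  Z_Series (fun k => hat f k * expi (IZR k * x))%C = f x.
Proof.
  intros Hf; change (Z_Series (fterm f x) = f x).
  set (a0 := (- f x)%C).
  (* a1 e_1 + a2 e_(-1) is the function - Cderive f x * sin (y - x). *)
  set (a1 := (Ci * Cderive f x * RtoC (/ 2) * expi (IZR (-1) * x))%C).
  set (a2 := (- Ci * Cderive f x * RtoC (/ 2) * expi (IZR 1 * x))%C).
  set (t := fun y => (a0 * expi (IZR 0 * y) + (a1 * expi (IZR 1 * y) + a2 * expi (IZR (-1) * y)))%C).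
  assert (S : forall c k, smooth_torus (fun y => c * expi (IZR k * y))%C)
    by (intros; apply smooth_scal, smooth_expi).
  assert (St : smooth_torus t) by (apply smooth_plus; [|apply smooth_plus]; apply S).
  assert (E : (expi (IZR 1 * x) * expi (IZR (-1) * x))%C = RtoC 1).
  { rewrite <- expi_plus, <- expi_0; f_equal; ring. }
  assert (It : Z_Series (fterm t x) = t x).
  { unfold t; rewrite (inversion_plus (fun y => a0 * expi (IZR 0 * y))%C), inversion_plus, !inversion_expi;
      trivial; now apply smooth_plus. }
  assert (Tx : t x = (- f x)%C).
  { unfold t, a0, a1, a2; rewrite Rmult_0_l, expi_0.
    transitivity (- f x + Ci * Cderive f x * RtoC (/ 2) * (expi (IZR 1 * x) * expi (IZR (-1) * x))
      - Ci * Cderive f x * RtoC (/ 2) * (expi (IZR 1 * x) * expi (IZR (-1) * x)))%C; ring. }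
  assert (Dt : Cder t x (- Cderive f x)%C).
  { eapply Cder_ext; [reflexivity| |
      apply (Cder_plus _ _ _ _ _ (Cder_scal a0 _ _ _ (Cder_expi (IZR 0) x))
        (Cder_plus _ _ _ _ _ (Cder_scal a1 _ _ _ (Cder_expi (IZR 1) x))
                              (Cder_scal a2 _ _ _ (Cder_expi (IZR (-1)) x))))].
    unfold a1, a2.
    transitivity (RtoC (/ 2) * (Ci * Ci * Cderive f x) * RtoC (1 - -1) * (expi (IZR 1 * x) * expi (IZR (-1) * x)))%C.
    - rewrite RtoC_minus; ring.
    - rewrite E; destruct (Cderive f x) as [p q]; apply C_eq; simpl; field. }
  assert (G : Z_Series (fterm (fun y => f y + t y)%C x) = RtoC 0).
  { apply inversion_double_zero.
    - now apply smooth_plus.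
    - rewrite Tx; ring.
    - rewrite (Cder_Cderive _ _ _ (Cder_plus _ _ _ _ _ (smooth_Cder f Hf x) Dt)); ring. }
  rewrite inversion_plus, It, Tx in G by assumption.
  replace (Z_Series (fterm f x)) with (Z_Series (fterm f x) + - f x + f x)%C by ring.
  rewrite G; ring.
Qed.

Lemma Z_Series_real_scal (r : R) a : Z_Series (fun k => RtoC r * a k)%C = (RtoC r * Z_Series a)%C.
Proof.
  assert (E : forall u, C_Series (fun n => RtoC r * u n)%C = (RtoC r * C_Series u)%C).
  { intros u; apply C_eq; simpl; rewrite Rmult_0_l.
    - rewrite Rminus_0_r, <- Series_scal_l; apply Series_ext; intros n; unfold Re, Im; ring.
    - rewrite Rplus_0_r, <- Series_scal_l; apply Series_ext; intros n; unfold Re, Im; ring. }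
  unfold Z_Series; rewrite !E; ring.
Qed.

Lemma pdo_hat sigma f x : smooth_torus f ->
  pdo sigma f x = Z_Series (fun k => expi (IZR k * x) * sigma x k * hat f k)%C.
Proof.
  intros Hf; unfold pdo; rewrite <- Z_Series_real_scal; apply Z_Series_ext; intros k.
  rewrite (C_RInt_ext _ (fun y => (expi (IZR k * x) * sigma x k) * (f y * expi (IZR (- k) * y)))%C).
  - rewrite C_RInt_scal by now apply smooth_Ccont, smooth_hat_integrand.
    unfold hat; ring.
  - intros y; replace ((x - y) * IZR k) with (IZR k * x + IZR (- k) * y) by (rewrite opp_IZR; ring).
    rewrite expi_plus; ring.
Qed.

Lemma pdo_expi sigma k x : pdo sigma (fun y => expi (IZR k * y)) x = (sigma x k * expi (IZR k * x))%C.
Proof.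
  rewrite pdo_hat by apply smooth_expi.
  rewrite (Z_Series_ext _ (single k (sigma x k * expi (IZR k * x))%C)); [apply Z_Series_single|].
  intros l; rewrite hat_expi; unfold single; destruct Z.eq_dec as [->|]; ring.
Qed.

(** * Weights *)

Lemma nat_above (x : R) : exists n : nat, x <= INR n.
Proof.
  exists (Z.to_nat (up (Rabs x))).
  destruct (archimed (Rabs x)) as [H _]; pose proof (Rabs_pos x); pose proof (Rle_abs x).
  rewrite INR_IZR_INZ, Z2Nat.id; [lra|].
  apply le_IZR; lra.
Qed.

Lemma Rpower_le_pow w s n : 1 <= w -> s <= INR n -> Rpower w s <= w ^ n.
Proof. intros Hw Hs; rewrite <- Rpower_pow by lra; now apply Rle_Rpower. Qed.

Lemma Rpower_pos x s : 0 < Rpower x s.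
Proof. apply exp_pos. Qed.

(** The consequences of the weight axioms on which all estimates rest. *)
Record tame (Lam : Z -> R) : Prop := {
  tame_pos : forall k, 0 < Lam k;
  tame_below : exists c, 0 < c /\ forall k, c <= Lam k;
  tame_wt : exists A s, 0 < A /\ 0 < s /\ forall k, wt k <= A * Rpower (Lam k) s;
  tame_peetre : forall s, exists A (N : nat), 0 < A /\
    forall k l, Rpower (Lam (k + l)%Z) s <= A * Rpower (Lam k) s * wt l ^ N }.

Lemma wt_shift_half k l : 2 * wt l <= wt k -> wt k / 2 <= wt (k + l).
Proof.
  unfold wt; rewrite plus_IZR; intros H.
  pose proof (Rabs_triang (IZR k + IZR l) (- IZR l)) as T.
  rewrite Rabs_Ropp in T; replace (IZR k + IZR l + - IZR l) with (IZR k) in T by ring; lra.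
Qed.

(** One step from [j] changes [Lam] by a factor [1 + O(1/wt j)], and
    [wt j >= wt k / 2] on the whole way from [k] to [k+l]; there are fewer than
    [wt k / 2] steps. *)
Lemma slow_variation (Lam : Z -> R) (D : R) (k : Z) (l : Z) :
  (forall j, 0 < Lam j) -> 0 < D ->
  (forall j, j <> 0%Z -> wt j * Rabs (Lam (j + 1)%Z - Lam j) <= D * Lam j) ->
  2 * wt l < wt k -> 4 * D < wt k ->
  Lam (k + l)%Z <= exp (2 * D) * Lam k.
Proof.
  intros pos HD var Hl Hk.
  assert (near : forall j, (Z.abs j <= Z.abs l)%Z -> wt k / 2 <= wt (k + j) /\ (k + j <> 0)%Z).
  { intros j Hj.
    assert (Hjl : wt j <= wt l) by (unfold wt; rewrite <- !abs_IZR; apply Rplus_le_compat_l, IZR_le, Hj).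
    assert (H : wt k / 2 <= wt (k + j)) by (apply wt_shift_half; lra).
    split; [exact H|]; intros E; rewrite E in H; unfold wt at 2 in H; rewrite Rabs_R0 in H.
    pose proof (wt_ge_1 l); lra. }
  set (q := 4 * D / wt k).
  assert (Hq : 0 < q) by (apply Rdiv_lt_0_compat; lra).
  assert (Hq' : q * wt k = 4 * D) by (unfold q; field; lra).
  assert (Hq1 : q < 1) by nra.
  assert (step : forall j, wt k / 2 <= wt j -> j <> 0%Z ->
     Lam (j + 1)%Z <= (1 + q) * Lam j /\ Lam j <= (1 + q) * Lam (j + 1)%Z).
  { intros j Hj Hj0; specialize (var j Hj0); pose proof (pos j); pose proof (pos (j + 1)%Z).
    assert (V : Rabs (Lam (j + 1)%Z - Lam j) <= q / 2 * Lam j).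
    { apply Rmult_le_reg_l with (wt k / 2); [lra|].
      replace (wt k / 2 * (q / 2 * Lam j)) with (D * Lam j) by (unfold q; field; lra).
      eapply Rle_trans; [|exact var].
      apply Rmult_le_compat_r; [apply Rabs_pos|exact Hj]. }
    apply Rabs_le_between in V; split; nra. }
  assert (Nq : forall n : nat, (Z.of_nat n <= Z.abs l)%Z ->
    (Lam (k + Z.of_nat n)%Z <= (1 + q) ^ n * Lam k) /\ (Lam (k - Z.of_nat n)%Z <= (1 + q) ^ n * Lam k)).
  { induction n as [|n IH]; intros Hn.
    - replace (k + Z.of_nat 0)%Z with k by lia; replace (k - Z.of_nat 0)%Z with k by lia; simpl; lra.
    - destruct (IH ltac:(lia)) as [I1 I2].
      destruct (near (Z.of_nat n) ltac:(lia)) as [N1 N2].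
      destruct (near (- Z.of_nat (S n))%Z ltac:(lia)) as [N3 N4].
      destruct (step _ N1 N2) as [S1 _]; destruct (step _ N3 N4) as [_ S2].
      replace (k + Z.of_nat n + 1)%Z with (k + Z.of_nat (S n))%Z in S1 by lia.
      replace (k + - Z.of_nat (S n) + 1)%Z with (k - Z.of_nat n)%Z in S2 by lia.
      replace (k + - Z.of_nat (S n))%Z with (k - Z.of_nat (S n))%Z in S2 by lia.
      cbn [pow]; split; nra. }
  assert (G : Lam (k + l)%Z <= (1 + q) ^ (Z.to_nat (Z.abs l)) * Lam k).
  { destruct (Nq (Z.to_nat (Z.abs l)) ltac:(lia)) as [I1 I2].
    destruct (Z_le_gt_dec 0 l).
    - replace (k + l)%Z with (k + Z.of_nat (Z.to_nat (Z.abs l)))%Z by lia; exact I1.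
    - replace (k + l)%Z with (k - Z.of_nat (Z.to_nat (Z.abs l)))%Z by lia; exact I2. }
  eapply Rle_trans; [exact G|]; apply Rmult_le_compat_r; [left; apply pos|].
  set (n := Z.to_nat (Z.abs l)).
  apply Rle_trans with (exp q ^ n).
  { apply pow_incr; split; [lra|]; apply exp_ineq1_le. }
  rewrite <- Rpower_pow by apply exp_pos; unfold Rpower; rewrite ln_exp.
  apply Rlt_le, exp_increasing.
  assert (INR n <= wt l).
  { unfold n, wt; rewrite INR_IZR_INZ, Z2Nat.id, abs_IZR by lia; lra. }
  nra.
Qed.

(** For Peetre's inequality: when [wt l] is small against [wt k] the weight varies
    slowly, and otherwise the polynomial bounds on [Lam] lose only powers of
    [wt l].  Negative exponents follow by exchanging [k] and [k+l]. *)
Lemma weight_tame (Lam : Z -> R) (mu : R) : weight_function Lam mu -> tame Lam.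
Proof.
  intros [pos (mu0 & mu1 & Hmu0 & Hmu01 & Hmu1 & (C0 & C1 & HC0 & HC1 & B) & V)].
  assert (below : forall k, C0 <= Lam k).
  { intros k; eapply Rle_trans; [|apply B].
    rewrite <- (Rmult_1_r C0) at 1; apply Rmult_le_compat_l; [lra|].
    apply Rle_trans with (Rpower (1 + Rabs (IZR k)) 0).
    - rewrite Rpower_O; [lra|]; pose proof (Rabs_pos (IZR k)); lra.
    - apply Rle_Rpower; [apply wt_ge_1|lra]. }
  split.
  - exact pos.
  - exists C0; split; assumption.
  - exists (Rpower (/ C0) (/ mu0)), (/ mu0); split; [apply Rpower_pos|split; [now apply Rinv_0_lt_compat|]].
    intros k; pose proof (wt_ge_1 k); pose proof (pos k).
    rewrite Rpower_mult_distr; [|now apply Rinv_0_lt_compat|assumption].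
    replace (wt k) with (Rpower (Rpower (wt k) mu0) (/ mu0)).
    2:{ rewrite Rpower_mult, Rinv_r, Rpower_1; lra. }
    apply Rle_Rpower_l; [left; now apply Rinv_0_lt_compat|split; [apply Rpower_pos|]].
    apply Rmult_le_reg_l with C0; [assumption|].
    rewrite <- Rmult_assoc, Rinv_r, Rmult_1_l by lra; apply B.
  - destruct (V 0%nat 1%nat (le_n 1)) as (C & HC & HV).
    destruct (nat_above mu1) as [N HN].
    set (D := 2 * C).
    assert (var : forall j, j <> 0%Z -> wt j * Rabs (Lam (j + 1)%Z - Lam j) <= D * Lam j).
    { intros j Hj; specialize (HV j).
      replace (1 - INR 0 / mu) with 1 in HV by (simpl; unfold Rdiv; ring).
      rewrite Rpower_1, pow_1, Rabs_mult in HV by apply pos.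
      change (Delta_iter (0 + 1) Lam j) with (Lam (j + 1)%Z - Lam j) in HV.
      assert (1 <= Rabs (IZR j)) by (rewrite <- abs_IZR; apply IZR_le; lia).
      pose proof (Rabs_pos (Lam (j + 1)%Z - Lam j)); unfold wt, D; nra. }
    (* When wt k exceeds wt l by this factor, the slow variation estimate applies. *)
    set (E := 2 + 4 * D).
    set (A := exp (2 * D) + C1 * E ^ N / C0).
    assert (HD : 0 < D) by (unfold D; lra).
    assert (HA : 0 < A).
    { unfold A; pose proof (exp_pos (2 * D)).
      assert (0 <= C1 * E ^ N / C0); [|lra].
      apply Rdiv_le_0_compat; [|assumption]; apply Rmult_le_pos; [lra|]; apply pow_le; unfold E; lra. }
    assert (grow : forall k l, Lam (k + l)%Z <= A * Lam k * wt l ^ (2 * N)).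
    { intros k l; pose proof (wt_ge_1 l); pose proof (wt_ge_1 k); pose proof (pos k).
      assert (W1 : 1 <= wt l ^ (2 * N)) by now apply pow_R1_Rle.
      assert (HEN : 0 < E ^ N) by (apply pow_lt; unfold E; lra).
      destruct (Rlt_dec (E * wt l) (wt k)) as [L|L].
      - apply Rle_trans with (exp (2 * D) * Lam k).
        + apply slow_variation; trivial; unfold E in L; nra.
        + assert (exp (2 * D) <= A).
          { unfold A; assert (0 <= C1 * E ^ N / C0); [|lra].
            apply Rdiv_le_0_compat; [|assumption]; nra. }
          assert (exp (2 * D) * Lam k <= A * Lam k) by nra.
          assert (0 < A * Lam k) by nra. nra.
      - assert (HE : wt k <= E * wt l) by lra.
        apply Rle_trans with (C1 * E ^ N * wt l ^ (2 * N)).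
        + eapply Rle_trans; [apply B|].
          rewrite Rmult_assoc; apply Rmult_le_compat_l; [lra|].
          eapply Rle_trans; [apply Rpower_le_pow; [apply wt_ge_1|exact HN]|].
          rewrite pow_mult, <- Rpow_mult_distr.
          apply pow_incr; split; [pose proof (wt_ge_1 (k + l)); unfold wt in *; lra|].
          eapply Rle_trans; [apply wt_plus|]; nra.
        + apply Rmult_le_compat_r; [lra|].
          apply Rle_trans with (C1 * E ^ N / C0 * Lam k).
          * apply Rle_trans with (C1 * E ^ N / C0 * C0); [right; field; lra|].
            apply Rmult_le_compat_l; [|apply below].
            apply Rdiv_le_0_compat; [|assumption]; nra.
          * apply Rmult_le_compat_r; [lra|]; unfold A; pose proof (exp_pos (2 * D)); lra. }
    assert (nonneg : forall s, 0 <= s -> exists A' N', 0 < A' /\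
      forall k l, Rpower (Lam (k + l)%Z) s <= A' * Rpower (Lam k) s * wt l ^ N').
    { intros s Hs; destruct (nat_above (INR (2 * N) * s)) as [N' HN'].
      exists (Rpower A s), N'; split; [apply Rpower_pos|]; intros k l.
      eapply Rle_trans; [apply Rle_Rpower_l; [assumption|split; [apply pos|apply grow]]|].
      pose proof (pos k); pose proof (wt_ge_1 l).
      rewrite <- !Rpower_mult_distr; trivial; try now apply Rmult_lt_0_compat.
      2: apply wt_pow_pos.
      apply Rmult_le_compat_l; [left; apply Rmult_lt_0_compat; apply Rpower_pos|].
      rewrite <- Rpower_pow, Rpower_mult by lra; now apply Rpower_le_pow. }
    intros s; destruct (Rle_dec 0 s) as [Hs|Hs]; [now apply nonneg|].
    destruct (nonneg (- s) ltac:(lra)) as (A' & N' & HA' & H).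
    exists A', N'; split; [assumption|]; intros k l.
    specialize (H (k + l)%Z (- l)%Z); rewrite wt_opp in H.
    replace (k + l + - l)%Z with k in H by ring.
    rewrite !Rpower_Ropp in H.
    pose proof (Rpower_pos (Lam k) s); pose proof (Rpower_pos (Lam (k + l)%Z) s).
    apply Rmult_le_reg_r with (/ Rpower (Lam k) s * / Rpower (Lam (k + l)%Z) s);
      [apply Rmult_lt_0_compat; now apply Rinv_0_lt_compat|].
    replace (Rpower (Lam (k + l)%Z) s * (/ Rpower (Lam k) s * / Rpower (Lam (k + l)%Z) s))
      with (/ Rpower (Lam k) s) by (field; lra).
    eapply Rle_trans; [exact H|right; field; lra].
Qed.

Lemma tame_mono Lam : tame Lam -> forall s t, s <= t ->
  exists A, 0 < A /\ forall k, Rpower (Lam k) s <= A * Rpower (Lam k) t.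
Proof.
  intros T s t Hst; destruct (tame_below _ T) as (c & Hc & B).
  exists (/ Rpower c (t - s)); split; [apply Rinv_0_lt_compat, Rpower_pos|]; intros k.
  replace t with (s + (t - s)) at 2 by ring; rewrite Rpower_plus.
  pose proof (Rpower_pos c (t - s)); pose proof (Rpower_pos (Lam k) s).
  apply Rmult_le_reg_l with (Rpower c (t - s)); [assumption|].
  rewrite <- Rmult_assoc, Rinv_r, Rmult_1_l, (Rmult_comm (Rpower c (t - s))) by lra.
  apply Rmult_le_compat_l; [lra|]; apply Rle_Rpower_l; [lra|split; trivial].
Qed.

Lemma tame_poly Lam : tame Lam -> forall s,
  exists A N, 0 < A /\ forall k, Rpower (Lam k) s <= A * wt k ^ N.
Proof.
  intros T s; destruct (tame_peetre _ T s) as (A & N & HA & H).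
  exists (A * Rpower (Lam 0%Z) s), N; split; [apply Rmult_lt_0_compat; [assumption|apply Rpower_pos]|].
  intros k; apply (H 0%Z k).
Qed.

Lemma tame_unbounded Lam : tame Lam -> forall rho B, 0 < rho ->
  exists R0, 0 < R0 /\ forall k, R0 <= Rabs (IZR k) -> B <= Rpower (Lam k) rho.
Proof.
  intros T rho B Hr; destruct (tame_wt _ T) as (A & s & HA & Hs & H).
  set (B' := Rmax B 1).
  assert (HB : B <= B') by apply Rmax_l. assert (HB1 : 1 <= B') by apply Rmax_r.
  exists (A * Rpower B' (s / rho)); split; [apply Rmult_lt_0_compat; [assumption|apply Rpower_pos]|].
  intros k Hk; apply Rle_trans with B'; [assumption|].
  destruct (Rle_dec B' (Rpower (Lam k) rho)) as [|L]; [assumption|exfalso].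
  assert (L' : Rpower (Lam k) s <= Rpower B' (s / rho)).
  { replace (Rpower (Lam k) s) with (Rpower (Rpower (Lam k) rho) (s / rho)).
    - apply Rle_Rpower_l; [left; now apply Rdiv_lt_0_compat|split; [apply Rpower_pos|lra]].
    - rewrite Rpower_mult; f_equal; field; lra. }
  specialize (H k); unfold wt in H.
  assert (A * Rpower (Lam k) s <= A * Rpower B' (s / rho)) by (apply Rmult_le_compat_l; lra).
  lra.
Qed.

(** * Symbol classes *)

Definition sym := R -> Z -> C.
Definition dx (a : sym) : sym := fun x k => Cderive (fun y => a y k) x.
Definition dk (a : sym) : sym := fun x k => (a x (k + 1)%Z - a x k)%C.
Definition sh (n : Z) (a : sym) : sym := fun x k => a x (k + n)%Z.
Definition kdk (a : sym) : sym := fun x k => (RtoC (IZR k) * dk a x k)%C.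
Definition smooth_sym (a : sym) : Prop := forall k, smooth_torus (fun x => a x k).
Definition sym1 : sym := fun _ _ => RtoC 1.
Definition sadd (a b : sym) : sym := fun x k => (a x k + b x k)%C.
Definition ssub (a b : sym) : sym := fun x k => (a x k - b x k)%C.
Definition smul (a b : sym) : sym := fun x k => (a x k * b x k)%C.
Definition sscal (c : C) (a : sym) : sym := fun x k => (c * a x k)%C.

Lemma sym_ext (a b : sym) : (forall x k, a x k = b x k) -> a = b.
Proof. intros E; do 2 (apply functional_extensionality; intros); apply E. Qed.

Lemma Cderive_plus f g : smooth_torus f -> smooth_torus g ->
  Cderive (fun x => f x + g x)%C = (fun x => Cderive f x + Cderive g x)%C.
Proof.
  intros Hf Hg; apply functional_extensionality; intros x; apply Cder_Cderive.
  apply Cder_plus; now apply smooth_Cder.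
Qed.

Lemma C_Derive_n_plus f g n x : smooth_torus f -> smooth_torus g ->
  C_Derive_n (fun x => f x + g x)%C n x = (C_Derive_n f n x + C_Derive_n g n x)%C.
Proof.
  revert f g; induction n as [|n IH]; intros f g Hf Hg.
  - apply C_eq; reflexivity.
  - rewrite <- !C_Derive_n_Cderive, Cderive_plus, IH by (trivial; now apply smooth_Cderive); reflexivity.
Qed.

Lemma Cderive_scal c f : smooth_torus f -> Cderive (fun x => c * f x)%C = (fun x => c * Cderive f x)%C.
Proof.
  intros Hf; apply functional_extensionality; intros x; apply Cder_Cderive.
  apply Cder_scal; now apply smooth_Cder.
Qed.

Lemma C_Derive_n_scal c f n x : smooth_torus f ->
  C_Derive_n (fun x => c * f x)%C n x = (c * C_Derive_n f n x)%C.
Proof.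
  revert f; induction n as [|n IH]; intros f Hf.
  - apply C_eq; reflexivity.
  - rewrite <- !C_Derive_n_Cderive, Cderive_scal, IH by (trivial; now apply smooth_Cderive); reflexivity.
Qed.

Lemma C_Derive_n_0 f x : C_Derive_n f 0 x = f x.
Proof. apply C_eq; reflexivity. Qed.

Lemma smooth_minus f g : smooth_torus f -> smooth_torus g -> smooth_torus (fun x => f x - g x)%C.
Proof.
  intros Hf Hg; replace (fun x => f x - g x)%C with (fun x => f x + - RtoC 1 * g x)%C.
  - apply smooth_plus; [assumption|now apply smooth_scal].
  - apply functional_extensionality; intros; ring.
Qed.

Lemma C_Derive_n_minus f g n x : smooth_torus f -> smooth_torus g ->
  C_Derive_n (fun x => f x - g x)%C n x = (C_Derive_n f n x - C_Derive_n g n x)%C.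
Proof.
  intros Hf Hg; replace (fun x => f x - g x)%C with (fun x => f x + - RtoC 1 * g x)%C.
  - rewrite C_Derive_n_plus, C_Derive_n_scal by (trivial; now apply smooth_scal); ring.
  - apply functional_extensionality; intros; ring.
Qed.

Lemma C_Derive_n_smooth f n : smooth_torus f -> smooth_torus (C_Derive_n f n).
Proof.
  revert f; induction n as [|n IH]; intros f Hf.
  - replace (C_Derive_n f 0) with f; [assumption|].
    apply functional_extensionality; intros; now rewrite C_Derive_n_0.
  - replace (C_Derive_n f (S n)) with (C_Derive_n (Cderive f) n); [now apply IH, smooth_Cderive|].
    apply functional_extensionality; intros; apply C_Derive_n_Cderive.
Qed.

Lemma Delta_iter_S (u : Z -> C) n : Delta_iter (S n) u = Delta_iter n (fun k => u (k + 1)%Z - u k)%C.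
Proof. unfold Delta_iter; now rewrite Nat.iter_succ_r. Qed.

Lemma Delta_iter_plus n (u v : Z -> C) k :
  Delta_iter n (fun k => u k + v k)%C k = (Delta_iter n u k + Delta_iter n v k)%C.
Proof.
  revert u v; induction n as [|n IH]; intros u v; [reflexivity|].
  rewrite !Delta_iter_S, <- IH; f_equal; apply functional_extensionality; intros; ring.
Qed.

Lemma smooth_dx a : smooth_sym a -> smooth_sym (dx a).
Proof. intros H k; exact (smooth_Cderive _ (H k)). Qed.

(** ** Coinduction for symbol classes *)

(** A graded family of bounded symbols stable under [d/dx] (keeping the order)
    and under [Delta] (lowering it by [rho]) consists of symbols: every mixed
    derivative is again a member, hence bounded. *)
Lemma S_coind (Lam : Z -> R) (rho : R) (Y : R -> sym -> Prop) :
  (forall m g, Y m g ->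
     (forall x k, g (x + 2 * PI) k = g x k) /\
     (exists A, 0 < A /\ forall x k, Cmod (g x k) <= A * Rpower (Lam k) m) /\
     (exists g', Y m g' /\ forall x k, Cder (fun y => g y k) x (g' x k)) /\
     Y (m - rho) (dk g)) ->
  forall m g, Y m g -> symbol_S Lam rho m g.
Proof.
  intros HY m g Hg; split.
  - intros k; apply (smooth_coind (fun f => exists g, Y m g /\ f = fun x => g x k)); [|now exists g].
    clear g Hg; intros f (g & Hg & ->).
    destruct (HY m g Hg) as (P & _ & (g' & Hg' & D) & _).
    split; [intros x; apply P|].
    exists (fun x => g' x k); split; [now exists g'|]; intros x; apply D.
  - intros alpha beta; revert g Hg; induction beta as [|beta IH]; intros g Hg.
    + revert m g Hg; induction alpha as [|alpha IH]; intros m g Hg.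
      * destruct (HY m g Hg) as (_ & (A & HA & B) & _).
        exists A; split; [assumption|]; intros x k.
        replace (m - rho * INR 0) with m by (simpl; ring).
        unfold Delta_iter; simpl; rewrite C_Derive_n_0; apply B.
      * destruct (HY m g Hg) as (_ & _ & _ & H).
        destruct (IH _ _ H) as (A & HA & B).
        exists A; split; [assumption|]; intros x k.
        specialize (B x k).
        replace (m - rho * INR (S alpha)) with (m - rho - rho * INR alpha) by (rewrite S_INR; ring).
        rewrite Delta_iter_S; exact B.
    + destruct (HY m g Hg) as (_ & _ & (g' & Hg' & D) & _).
      destruct (IH g' Hg') as (A & HA & B); exists A; split; [assumption|]; intros x k.
      specialize (B x k).
      replace (fun j => C_Derive_n (fun y => g y j) (S beta) x)
        with (fun j => C_Derive_n (fun y => g' y j) beta x); [exact B|].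
      apply functional_extensionality; intros j; rewrite <- C_Derive_n_Cderive; f_equal.
      apply functional_extensionality; intros y; symmetry; apply Cder_Cderive, D.
Qed.

Section Classes.
Variable Lam : Z -> R.
Hypothesis T : tame Lam.

Lemma S_bound rho m a : symbol_S Lam rho m a ->
  exists A, 0 < A /\ forall x k, Cmod (a x k) <= A * Rpower (Lam k) m.
Proof.
  intros [_ H]; destruct (H 0%nat 0%nat) as (A & HA & B); exists A; split; [assumption|].
  intros x k; specialize (B x k); unfold Delta_iter in B; simpl in B.
  rewrite C_Derive_n_0 in B; now replace (m - rho * 0) with m in B by ring.
Qed.

Lemma S_smooth rho m a : symbol_S Lam rho m a -> smooth_sym a.
Proof. intros H; exact (proj1 H). Qed.

Lemma S_dx rho m a : symbol_S Lam rho m a -> symbol_S Lam rho m (dx a).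
Proof.
  intros [Hs H]; split; [exact (smooth_dx a Hs)|].
  intros alpha beta; destruct (H alpha (S beta)) as (A & HA & B); exists A; split; [assumption|].
  intros x k; specialize (B x k).
  replace (fun j => C_Derive_n (fun y => dx a y j) beta x)
    with (fun j => C_Derive_n (fun y => a y j) (S beta) x); [exact B|].
  apply functional_extensionality; intros j; now rewrite <- C_Derive_n_Cderive.
Qed.

Lemma S_dk rho m a : symbol_S Lam rho m a -> symbol_S Lam rho (m - rho) (dk a).
Proof.
  intros [Hs H]; split; [intros k; apply smooth_minus; apply Hs|].
  intros alpha beta; destruct (H (S alpha) beta) as (A & HA & B); exists A; split; [assumption|].
  intros x k; specialize (B x k); rewrite Delta_iter_S in B.
  replace (m - rho - rho * INR alpha) with (m - rho * INR (S alpha)) by (rewrite S_INR; ring).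
  replace (fun j => C_Derive_n (fun y => dk a y j) beta x)
    with (fun j => C_Derive_n (fun y => a y (j + 1)%Z) beta x - C_Derive_n (fun y => a y j) beta x)%C;
    [exact B|].
  apply functional_extensionality; intros j; symmetry; apply C_Derive_n_minus; apply Hs.
Qed.

Lemma S_Cder rho m a : symbol_S Lam rho m a -> forall x k, Cder (fun y => a y k) x (dx a x k).
Proof. intros H x k; apply (smooth_Cder _ (S_smooth _ _ _ H k)). Qed.

Lemma S_periodic rho m a : symbol_S Lam rho m a -> forall x k, a (x + 2 * PI) k = a x k.
Proof. intros H x k; apply (S_smooth _ _ _ H k). Qed.

Lemma bound_shift m (a : sym) n :
  (exists A, 0 < A /\ forall x k, Cmod (a x k) <= A * Rpower (Lam k) m) ->
  exists A, 0 < A /\ forall x k, Cmod (sh n a x k) <= A * Rpower (Lam k) m.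
Proof.
  intros (A & HA & B); destruct (tame_peetre _ T m) as (K & N & HK & P).
  exists (A * (K * wt n ^ N)); split.
  { apply Rmult_lt_0_compat; [assumption|apply Rmult_lt_0_compat; [assumption|apply wt_pow_pos]]. }
  intros x k; unfold sh; eapply Rle_trans; [apply B|].
  rewrite Rmult_assoc; apply Rmult_le_compat_l; [lra|].
  eapply Rle_trans; [apply P|right; ring].
Qed.

Lemma bound_mono m m' (a : sym) : m <= m' ->
  (exists A, 0 < A /\ forall x k, Cmod (a x k) <= A * Rpower (Lam k) m) ->
  exists A, 0 < A /\ forall x k, Cmod (a x k) <= A * Rpower (Lam k) m'.
Proof.
  intros Hm (A & HA & B); destruct (tame_mono _ T m m' Hm) as (K & HK & P).
  exists (A * K); split; [now apply Rmult_lt_0_compat|]; intros x k.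
  eapply Rle_trans; [apply B|]; rewrite Rmult_assoc; apply Rmult_le_compat_l; [lra|apply P].
Qed.

Lemma S_sh rho m n a : symbol_S Lam rho m a -> symbol_S Lam rho m (sh n a).
Proof.
  intros Ha; apply (S_coind Lam rho (fun m g => exists a, symbol_S Lam rho m a /\ g = sh n a));
    [|now exists a].
  clear - T; intros m g (a & Ha & ->); split; [|split; [|split]].
  - intros x k; apply (S_periodic _ _ _ Ha).
  - apply bound_shift, (S_bound _ _ _ Ha).
  - exists (sh n (dx a)); split; [exists (dx a); split; [now apply S_dx|reflexivity]|].
    intros x k; apply (S_Cder _ _ _ Ha).
  - exists (dk a); split; [now apply S_dk|].
    apply sym_ext; intros x k; unfold dk, sh; now replace (k + 1 + n)%Z with (k + n + 1)%Z by ring.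
Qed.

Lemma S_mono rho m m' a : m <= m' -> symbol_S Lam rho m a -> symbol_S Lam rho m' a.
Proof.
  intros Hm Ha; apply (S_coind Lam rho (fun m' g => exists m, m <= m' /\ symbol_S Lam rho m g));
    [|now exists m].
  clear m m' Hm a Ha; intros m' a (m & Hm & Ha); split; [|split; [|split]].
  - apply (S_periodic _ _ _ Ha).
  - apply (bound_mono m); [assumption|]; apply (S_bound _ _ _ Ha).
  - exists (dx a); split; [exists m; split; [assumption|now apply S_dx]|apply (S_Cder _ _ _ Ha)].
  - exists (m - rho); split; [lra|now apply S_dk].
Qed.

(** Generators need not be known to be symbols: this is how the inverse of an
    elliptic symbol is adjoined in [S_inverse]. *)
Inductive alg (B : R -> sym -> Prop) : R -> sym -> Prop :=
| alg_base m a : B m a -> alg B m a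
| alg_plus m a b : alg B m a -> alg B m b -> alg B m (sadd a b)
| alg_mult m1 m2 m a b : m = m1 + m2 -> alg B m1 a -> alg B m2 b -> alg B m (smul a b).

Lemma alg_S rho (B : R -> sym -> Prop) :
  (forall m g, B m g ->
     (forall x k, g (x + 2 * PI) k = g x k) /\
     (exists A, 0 < A /\ forall x k, Cmod (g x k) <= A * Rpower (Lam k) m) /\
     (exists g', alg B m g' /\ forall x k, Cder (fun y => g y k) x (g' x k)) /\
     alg B (m - rho) (dk g) /\ alg B m (sh 1 g)) ->
  forall m g, alg B m g -> symbol_S Lam rho m g.
Proof.
  intros HB.
  assert (SH : forall m g, alg B m g -> alg B m (sh 1 g)).
  { induction 1 as [m a Ha|m a b Ha Ia Hb Ib|m1 m2 m a b E Ha Ia Hb Ib].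
    - now apply HB.
    - exact (alg_plus B m (sh 1 a) (sh 1 b) Ia Ib).
    - exact (alg_mult B m1 m2 m (sh 1 a) (sh 1 b) E Ia Ib). }
  apply S_coind.
  induction 1 as [m a Ha|m a b Ha Ia Hb Ib|m1 m2 m a b E Ha Ia Hb Ib].
  - destruct (HB m a Ha) as (H1 & H2 & H3 & H4 & _); auto.
  - destruct Ia as (Pa & (A1 & HA1 & B1) & (a' & Ya & Da) & Ka).
    destruct Ib as (Pb & (A2 & HA2 & B2) & (b' & Yb & Db) & Kb).
    split; [|split; [|split]].
    + intros x k; unfold sadd; now rewrite Pa, Pb.
    + exists (A1 + A2); split; [lra|]; intros x k; unfold sadd.
      eapply Rle_trans; [apply Cmod_triangle|]; specialize (B1 x k); specialize (B2 x k); nra.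
    + exists (sadd a' b'); split; [now apply alg_plus|].
      intros x k; now apply Cder_plus.
    + replace (dk (sadd a b)) with (sadd (dk a) (dk b)); [now apply alg_plus|].
      apply sym_ext; intros x k; unfold dk, sadd; ring.
  - destruct Ia as (Pa & (A1 & HA1 & B1) & (a' & Ya & Da) & Ka).
    destruct Ib as (Pb & (A2 & HA2 & B2) & (b' & Yb & Db) & Kb).
    subst m; split; [|split; [|split]].
    + intros x k; unfold smul; now rewrite Pa, Pb.
    + exists (A1 * A2); split; [now apply Rmult_lt_0_compat|]; intros x k; unfold smul.
      rewrite Cmod_mult, Rpower_plus.
      replace (A1 * A2 * (Rpower (Lam k) m1 * Rpower (Lam k) m2))
        with ((A1 * Rpower (Lam k) m1) * (A2 * Rpower (Lam k) m2)) by ring.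
      apply Rmult_le_compat; trivial; apply Cmod_ge_0.
    + exists (sadd (smul a' b) (smul a b')); split.
      * apply alg_plus; now apply alg_mult with m1 m2.
      * intros x k; now apply Cder_mult.
    + replace (dk (smul a b)) with (sadd (smul (dk a) (sh 1 b)) (smul a (dk b))).
      * apply alg_plus; [apply alg_mult with (m1 - rho) m2|apply alg_mult with m1 (m2 - rho)];
          auto; ring.
      * apply sym_ext; intros x k; unfold dk, sadd, smul, sh; ring.
Qed.

Lemma alg_S_S rho m g : alg (symbol_S Lam rho) m g -> symbol_S Lam rho m g.
Proof.
  apply alg_S; clear - T; intros m a Ha; split; [|split; [|split; [|split]]].
  - apply (S_periodic _ _ _ Ha).
  - apply (S_bound _ _ _ Ha).
  - exists (dx a); split; [now apply alg_base, S_dx|apply (S_Cder _ _ _ Ha)].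
  - now apply alg_base, S_dk.
  - now apply alg_base, S_sh.
Qed.

Lemma S_plus rho m a b : symbol_S Lam rho m a -> symbol_S Lam rho m b -> symbol_S Lam rho m (sadd a b).
Proof. intros; apply alg_S_S, alg_plus; now apply alg_base. Qed.

Lemma S_mult rho m1 m2 a b : symbol_S Lam rho m1 a -> symbol_S Lam rho m2 b ->
  symbol_S Lam rho (m1 + m2) (smul a b).
Proof. intros; apply alg_S_S; apply alg_mult with m1 m2; trivial; now apply alg_base. Qed.

Lemma S_of_torus rho f : smooth_torus f -> symbol_S Lam rho 0 (fun x _ => f x).
Proof.
  intros Hf; apply (S_coind Lam rho (fun m g => (m = 0 /\ exists f, smooth_torus f /\ g = fun x _ => f x)
     \/ g = fun _ _ => RtoC 0)); [|left; eauto].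
  clear - T; intros m g [[-> (f & Hf & ->)]| ->]; (split; [|split; [|split]]).
  - intros x _; apply Hf.
  - destruct (smooth_bounded f Hf) as (M & HM & B); exists M; split; [assumption|]; intros x k.
    rewrite Rpower_O by apply (tame_pos _ T); rewrite Rmult_1_r; apply B.
  - exists (fun x _ => Cderive f x); split; [left; split; [reflexivity|exists (Cderive f); split; [now apply smooth_Cderive|reflexivity]]|].
    intros x _; now apply smooth_Cder.
  - right; apply sym_ext; intros x k; unfold dk; ring.
  - reflexivity.
  - exists 1; split; [lra|]; intros x k; rewrite Cmod_0, Rmult_1_l; left; apply Rpower_pos.
  - exists (fun _ _ => RtoC 0); split; [now right|]; intros; apply Cder_const.
  - right; apply sym_ext; intros x k; unfold dk; ring.
Qed.

Lemma S_scal rho m c a : symbol_S Lam rho m a -> symbol_S Lam rho m (sscal c a).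
Proof.
  intros Ha; replace m with (0 + m) by ring.
  exact (S_mult rho 0 m _ _ (S_of_torus rho _ (smooth_const c)) Ha).
Qed.

Lemma S_minus rho m a b : symbol_S Lam rho m a -> symbol_S Lam rho m b -> symbol_S Lam rho m (ssub a b).
Proof.
  intros Ha Hb; replace (ssub a b) with (sadd a (sscal (- RtoC 1) b)).
  - apply S_plus; [assumption|now apply S_scal].
  - apply sym_ext; intros; unfold sadd, sscal, ssub; ring.
Qed.

Lemma S_sym1 rho : symbol_S Lam rho 0 sym1.
Proof. exact (S_of_torus rho _ (smooth_const (RtoC 1))). Qed.

(** With [p = 1/q], both [dp/dx = - (dq/dx) p^2] and
    [Delta p = - (Delta q) p (shift p)] stay in the algebra generated by the
    symbols and the shifts of [p]. *)
Lemma S_inverse rho m q c : symbol_S Lam rho m q -> 0 < c ->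
  (forall x k, c * Rpower (Lam k) m <= Cmod (q x k)) ->
  symbol_S Lam rho (- m) (fun x k => / q x k)%C.
Proof.
  intros Hq Hc Hell.
  assert (NZ : forall x k, q x k <> RtoC 0).
  { intros x k E; specialize (Hell x k); rewrite E, Cmod_0 in Hell.
    pose proof (Rpower_pos (Lam k) m); nra. }
  set (p := (fun x k => / q x k)%C : sym).
  set (B := fun m' g => symbol_S Lam rho m' g \/ (m' = - m /\ exists n, g = sh n p)).
  assert (Hp : B (- m) p).
  { right; split; [reflexivity|]; exists 0%Z; apply sym_ext; intros; unfold sh; f_equal; ring. }
  apply (alg_S rho B); [|now apply alg_base].
  assert (bp : exists A, 0 < A /\ forall x k, Cmod (p x k) <= A * Rpower (Lam k) (- m)).
  { exists (/ c); split; [now apply Rinv_0_lt_compat|]; intros x k; unfold p.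
    rewrite Cmod_inv by apply NZ; rewrite Rpower_Ropp, <- Rinv_mult.
    apply Rinv_le_contravar; [|apply Hell].
    apply Rmult_lt_0_compat; [assumption|apply Rpower_pos]. }
  intros m' g [Ha|[-> [n ->]]]; (split; [|split; [|split; [|split]]]).
  - apply (S_periodic _ _ _ Ha).
  - apply (S_bound _ _ _ Ha).
  - exists (dx g); split; [now apply alg_base; left; apply S_dx|apply (S_Cder _ _ _ Ha)].
  - apply alg_base; left; now apply S_dk.
  - apply alg_base; left; now apply S_sh.
  - intros x k; unfold sh, p; now rewrite (S_periodic _ _ _ Hq).
  - now apply bound_shift.
  - exists (smul (sscal (- RtoC 1) (sh n (dx q))) (smul (sh n p) (sh n p))); split.
    + apply alg_mult with m (- m + - m); [ring| |].
      * apply alg_base; left; now apply S_scal, S_sh, S_dx.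
      * apply alg_mult with (- m) (- m); trivial; apply alg_base; right; eauto.
    + intros x k; unfold smul, sscal, sh, p.
      refine (Cder_ext _ _ x _ _ (fun _ => eq_refl) _
        (Cder_inv (fun y => q y (k + n)%Z) x (dx q x (k + n)%Z) (NZ _ _) (S_Cder _ _ _ Hq _ _))).
      cbv beta; ring.
  - replace (dk (sh n p)) with (smul (sscal (- RtoC 1) (sh n (dk q))) (smul (sh n p) (sh (n + 1) p))).
    + apply alg_mult with (m - rho) (- m + - m); [ring| |].
      * apply alg_base; left; now apply S_scal, S_sh, S_dk.
      * apply alg_mult with (- m) (- m); trivial; apply alg_base; right; eauto.
    + apply sym_ext; intros x k; unfold dk, smul, sscal, sh, p.
      replace (k + (n + 1))%Z with (k + n + 1)%Z by ring.
      replace (k + 1 + n)%Z with (k + n + 1)%Z by ring.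
      field; split; apply NZ.
  - apply alg_base; right; split; [reflexivity|]; exists (n + 1)%Z.
    apply sym_ext; intros; unfold sh; f_equal; ring.
Qed.

(** ** Crude symbols *)

(** The class with [rho = 0] asks for bounds of [x]-derivatives only, since
    differences in [k] of a bounded symbol are bounded of the same order.  It
    measures remainders. *)
Lemma S_crude rho m a : 0 <= rho -> symbol_S Lam rho m a -> symbol_S Lam 0 m a.
Proof.
  intros Hr Ha; apply (S_coind Lam 0 (symbol_S Lam rho)); [|assumption].
  clear a m Ha; intros m a Ha; split; [|split; [|split]].
  - apply (S_periodic _ _ _ Ha).
  - apply (S_bound _ _ _ Ha).
  - exists (dx a); split; [now apply S_dx|apply (S_Cder _ _ _ Ha)].
  - apply S_mono with (m - rho); [lra|now apply S_dk].
Qed.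

Lemma finite_bound (u : R -> Z -> C) (v : Z -> R) : (forall k, 0 < v k) ->
  (forall k, exists A, 0 < A /\ forall x, Cmod (u x k) <= A) ->
  forall R0, exists A, 0 < A /\ forall x k, Rabs (IZR k) <= R0 -> Cmod (u x k) <= A * v k.
Proof.
  intros Hv H.
  assert (F : forall N : nat, exists A, 0 < A /\ forall x k, (Z.abs k <= Z.of_nat N)%Z -> Cmod (u x k) <= A * v k).
  { assert (one : forall k, exists A, 0 < A /\ forall x, Cmod (u x k) <= A * v k).
    { intros k; destruct (H k) as (A & HA & B); exists (A / v k); split; [now apply Rdiv_lt_0_compat|].
      intros x; eapply Rle_trans; [apply B|right; field]; apply Rgt_not_eq, Hv. }
    induction N as [|N (A & HA & B)].
    - destruct (one 0%Z) as (A & HA & B); exists A; split; [assumption|].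
      intros x k Hk; replace k with 0%Z by lia; apply B.
    - destruct (one (Z.of_nat (S N))) as (A1 & HA1 & B1), (one (- Z.of_nat (S N))%Z) as (A2 & HA2 & B2).
      exists (A + A1 + A2); split; [lra|]; intros x k Hk; pose proof (Hv k).
      destruct (Z_le_dec (Z.abs k) (Z.of_nat N)) as [L|L].
      + specialize (B x k L); nra.
      + destruct (Z.eq_dec k (Z.of_nat (S N))) as [->|].
        * specialize (B1 x); nra.
        * replace k with (- Z.of_nat (S N))%Z in * by lia; specialize (B2 x); nra. }
  intros R0; destruct (nat_above R0) as [N HN]; destruct (F N) as (A & HA & B).
  exists A; split; [assumption|]; intros x k Hk; apply B.
  apply le_IZR; rewrite abs_IZR, <- INR_IZR_INZ; lra.
Qed.

(** Only large [|k|] matters: on a finite set of [k] all quantities are bounded. *)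
Lemma crude_intro m a : smooth_sym a ->
  (forall beta, exists A R0, 0 < A /\ forall x k, R0 <= Rabs (IZR k) ->
     Cmod (C_Derive_n (fun y => a y k) beta x) <= A * Rpower (Lam k) m) ->
  symbol_S Lam 0 m a.
Proof.
  intros Hs H.
  set (Y := fun m' (g : sym) => m' = m /\ smooth_sym g /\
    forall beta, exists A, 0 < A /\ forall x k, Cmod (C_Derive_n (fun y => g y k) beta x) <= A * Rpower (Lam k) m).
  apply (S_coind Lam 0 Y).
  - intros m' g (-> & Sg & Hg); split; [|split; [|split]].
    + intros x k; apply (Sg k).
    + destruct (Hg 0%nat) as (A & HA & B); exists A; split; [assumption|].
      intros x k; specialize (B x k); now rewrite C_Derive_n_0 in B.
    + exists (dx g); split; [split; [reflexivity|split; [now apply smooth_dx|]]|].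
      * intros beta; destruct (Hg (S beta)) as (A & HA & B); exists A; split; [assumption|].
        intros x k; specialize (B x k); rewrite <- C_Derive_n_Cderive in B; exact B.
      * intros x k; apply smooth_Cder, Sg.
    + split; [ring|split; [intros k; apply smooth_minus; apply Sg|]].
      intros beta; pose proof (Hg beta) as Hb.
      pose proof (bound_shift m (fun x k => C_Derive_n (fun y => g y k) beta x) 1 Hb) as (A1 & HA1 & B1).
      destruct Hb as (A & HA & B).
      exists (A1 + A); split; [lra|]; intros x k; unfold dk.
      rewrite C_Derive_n_minus by apply Sg.
      eapply Rle_trans; [apply Cmod_minus_le|].
      specialize (B1 x k); specialize (B x k); unfold sh in B1; lra.
  - split; [reflexivity|split; [assumption|]]; intros beta.
    destruct (H beta) as (A & R0 & HA & B).
    destruct (finite_bound (fun x k => C_Derive_n (fun y => a y k) beta x) (fun k => Rpower (Lam k) m))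
      with (R0 := R0) as (A' & HA' & B').
    + intros k; apply Rpower_pos.
    + intros k; apply smooth_bounded, C_Derive_n_smooth, Hs.
    + exists (A + A'); split; [lra|]; intros x k; pose proof (Rpower_pos (Lam k) m).
      destruct (Rle_dec R0 (Rabs (IZR k))) as [L|L].
      * specialize (B x k L); nra.
      * specialize (B' x k ltac:(lra)); simpl in B'; nra.
Qed.

Lemma crude_derive m a beta : symbol_S Lam 0 m a ->
  exists A, 0 < A /\ forall x k, Cmod (C_Derive_n (fun y => a y k) beta x) <= A * Rpower (Lam k) m.
Proof.
  intros [_ H]; destruct (H 0%nat beta) as (A & HA & B); exists A; split; [assumption|].
  intros x k; specialize (B x k); now replace (m - 0 * INR 0) with m in B by ring.
Qed.

Lemma crude_kmul m a (e : R) A : 0 < A -> (forall k, wt k <= A * Rpower (Lam k) e) ->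
  symbol_S Lam 0 m a -> symbol_S Lam 0 (m + e) (fun x k => RtoC (IZR k) * a x k)%C.
Proof.
  intros HA Hw Ha; apply crude_intro.
  - intros k; apply smooth_scal, (S_smooth _ _ _ Ha).
  - intros beta; destruct (crude_derive _ _ beta Ha) as (K & HK & B).
    exists (A * K), 0; split; [now apply Rmult_lt_0_compat|]; intros x k _.
    rewrite C_Derive_n_scal by apply (S_smooth _ _ _ Ha).
    rewrite Cmod_mult, Cmod_R, Rpower_plus.
    replace (A * K * (Rpower (Lam k) m * Rpower (Lam k) e))
      with ((A * Rpower (Lam k) e) * (K * Rpower (Lam k) m)) by ring.
    apply Rmult_le_compat; trivial; [apply Rabs_pos|apply Cmod_ge_0|].
    eapply Rle_trans; [|apply Hw]; unfold wt; lra.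
Qed.

(** A remainder of order [m - n] that is controlled crudely satisfies the
    estimates of order [m] for all differences of order at most [n / rho]. *)
Lemma S_approx rho m a :
  (forall n : nat, exists b, symbol_S Lam rho m b /\ symbol_S Lam 0 (m - INR n) (ssub a b)) ->
  symbol_S Lam rho m a.
Proof.
  intros H.
  assert (Sa : smooth_sym a).
  { destruct (H 0%nat) as (b & Hb & Hab).
    intros k; replace (fun x => a x k) with (fun x => b x k + ssub a b x k)%C.
    - apply smooth_plus; [apply (S_smooth _ _ _ Hb)|apply (S_smooth _ _ _ Hab)].
    - apply functional_extensionality; intros x; unfold ssub; ring. }
  split; [exact Sa|]; intros alpha beta.
  destruct (nat_above (rho * INR alpha)) as [n Hn].
  destruct (H n) as (b & Hb & Hab).
  destruct (proj2 Hb alpha beta) as (A1 & HA1 & B1).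
  destruct (proj2 Hab alpha beta) as (A2 & HA2 & B2).
  destruct (tame_mono _ T (m - INR n - 0 * INR alpha) (m - rho * INR alpha)) as (K & HK & P); [lra|].
  exists (A1 + A2 * K); split; [apply Rplus_lt_0_compat; [assumption|now apply Rmult_lt_0_compat]|].
  intros x k.
  replace (fun j => C_Derive_n (fun y => a y j) beta x) with
    (fun j => C_Derive_n (fun y => b y j) beta x + C_Derive_n (fun y => ssub a b y j) beta x)%C.
  - rewrite Delta_iter_plus; eapply Rle_trans; [apply Cmod_triangle|].
    rewrite Rmult_plus_distr_r; apply Rplus_le_compat; [apply B1|].
    eapply Rle_trans; [apply B2|]; rewrite Rmult_assoc; apply Rmult_le_compat_l; [lra|apply P].
  - apply functional_extensionality; intros j.
    rewrite <- C_Derive_n_plus by (apply (S_smooth _ _ _ Hb) || apply (S_smooth _ _ _ Hab)).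
    f_equal; apply functional_extensionality; intros y; unfold ssub; ring.
Qed.

(** ** The classes M *)

Lemma M_iff rho m a : symbol_M Lam rho m a <-> symbol_S Lam rho m a /\ symbol_S Lam rho m (kdk a).
Proof.
  assert (E0 : (fun x k => (RtoC (IZR k) ^ 0 * Delta_iter 0 (a x) k)%C) = a).
  { apply sym_ext; intros x k; unfold Delta_iter; simpl; ring. }
  assert (E1 : (fun x k => (RtoC (IZR k) ^ 1 * Delta_iter 1 (a x) k)%C) = kdk a).
  { apply sym_ext; intros x k; unfold Delta_iter, kdk, dk; simpl.
    rewrite Cmult_1_r; reflexivity. }
  split.
  - intros [_ H]; split; [rewrite <- E0|rewrite <- E1]; apply H; auto.
  - intros [H0 H1]; split; [exact (S_smooth _ _ _ H0)|].
    intros [|[|gamma]] Hg; [rewrite E0; exact H0|rewrite E1; exact H1|exfalso; lia].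
Qed.

Lemma M_S rho m a : symbol_M Lam rho m a -> symbol_S Lam rho m a.
Proof. intros H; now apply M_iff in H. Qed.

Lemma M_kdk rho m a : symbol_M Lam rho m a -> symbol_S Lam rho m (kdk a).
Proof. intros H; now apply M_iff in H. Qed.

Lemma M_crude rho m a : 0 <= rho -> symbol_M Lam rho m a -> symbol_S Lam 0 m a.
Proof. intros Hr H; apply (S_crude rho); [assumption|now apply M_S]. Qed.

Lemma M_mono rho m m' a : m <= m' -> symbol_M Lam rho m a -> symbol_M Lam rho m' a.
Proof. rewrite !M_iff; intros Hm [H1 H2]; split; now apply S_mono with m. Qed.

Lemma M_minus rho m a b : symbol_M Lam rho m a -> symbol_M Lam rho m b -> symbol_M Lam rho m (ssub a b).
Proof.
  rewrite !M_iff; intros [H1 H2] [H3 H4]; split; [now apply S_minus|].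
  replace (kdk (ssub a b)) with (ssub (kdk a) (kdk b)); [now apply S_minus|].
  apply sym_ext; intros x k; unfold kdk, dk, ssub; ring.
Qed.

Lemma M_scal rho m c a : symbol_M Lam rho m a -> symbol_M Lam rho m (sscal c a).
Proof.
  rewrite !M_iff; intros [H1 H2]; split; [now apply S_scal|].
  replace (kdk (sscal c a)) with (sscal c (kdk a)); [now apply S_scal|].
  apply sym_ext; intros x k; unfold kdk, dk, sscal; ring.
Qed.

Lemma M_mult rho m1 m2 a b : symbol_M Lam rho m1 a -> symbol_M Lam rho m2 b ->
  symbol_M Lam rho (m1 + m2) (smul a b).
Proof.
  rewrite !M_iff; intros [H1 H2] [H3 H4]; split; [now apply S_mult|].
  replace (kdk (smul a b)) with (sadd (smul (kdk a) (sh 1 b)) (smul a (kdk b))).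
  - apply S_plus; apply S_mult; trivial; now apply S_sh.
  - apply sym_ext; intros x k; unfold kdk, dk, sadd, smul, sh; ring.
Qed.

Lemma M_inverse rho m q c : symbol_M Lam rho m q -> 0 < c ->
  (forall x k, c * Rpower (Lam k) m <= Cmod (q x k)) ->
  symbol_M Lam rho (- m) (fun x k => / q x k)%C.
Proof.
  rewrite !M_iff; intros [H1 H2] Hc Hell.
  assert (Hp := S_inverse _ _ _ _ H1 Hc Hell).
  split; [assumption|].
  assert (NZ : forall x k, q x k <> RtoC 0).
  { intros x k E; specialize (Hell x k); rewrite E, Cmod_0 in Hell.
    pose proof (Rpower_pos (Lam k) m); nra. }
  set (p := (fun x k => / q x k)%C : sym) in *.
  replace (kdk p) with (smul (sscal (- RtoC 1) (kdk q)) (smul p (sh 1 p))).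
  - replace (- m) with (m + (- m + - m)) by ring.
    apply S_mult; [now apply S_scal|]; apply S_mult; [assumption|now apply S_sh].
  - apply sym_ext; intros x k; unfold kdk, dk, smul, sscal, sh, p; field; split; apply NZ.
Qed.

(** These are the symbols of order minus infinity, for every [rho]
    (see [smoothing_M] and [M_infty_smoothing]). *)
Definition smoothing (a : sym) : Prop := forall s, symbol_S Lam 0 s a.

Lemma smoothing_S rho m a : smoothing a -> symbol_S Lam rho m a.
Proof.
  intros H; split; [exact (S_smooth _ _ _ (H 0))|]; intros alpha beta.
  destruct (proj2 (H (m - rho * INR alpha)) alpha beta) as (A & HA & B).
  exists A; split; [assumption|]; intros x k; specialize (B x k).
  now replace (m - rho * INR alpha - 0 * INR alpha) with (m - rho * INR alpha) in B by ring.
Qed.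

(** The factor [k] costs a fixed order because [Lam] grows at least like a power. *)
Lemma crude_kdk : exists e, forall m a, symbol_S Lam 0 m a -> symbol_S Lam 0 (m + e) (kdk a).
Proof.
  destruct (tame_wt _ T) as (A & e & HA & _ & Hw); exists e; intros m a Ha.
  apply (crude_kmul m (dk a) e A HA Hw).
  replace m with (m - 0) by ring; now apply S_dk.
Qed.

Lemma smoothing_M rho m a : smoothing a -> symbol_M Lam rho m a.
Proof.
  intros H; apply M_iff; split; [now apply smoothing_S|]; apply smoothing_S; intros s.
  destruct crude_kdk as [e He]; replace s with (s - e + e) by ring; apply He, H.
Qed.

Lemma smoothing_M_infty rho a : smoothing a -> symbol_M_infty Lam rho a.
Proof. intros H m; now apply smoothing_M. Qed.

Lemma M_infty_smoothing rho a : 0 <= rho -> symbol_M_infty Lam rho a -> smoothing a.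
Proof. intros Hr H s; exact (M_crude rho s a Hr (H s)). Qed.

Lemma M_approx rho m a :
  (forall n : nat, exists b, symbol_M Lam rho m b /\ symbol_S Lam 0 (m - INR n) (ssub a b)) ->
  symbol_M Lam rho m a.
Proof.
  intros H; apply M_iff; split; apply S_approx; intros n.
  - destruct (H n) as (b & Hb & Hab); exists b; split; [now apply M_S|assumption].
  - destruct crude_kdk as [e He]; destruct (nat_above e) as [n' Hn'].
    destruct (H (n + n')%nat) as (b & Hb & Hab); exists (kdk b); split; [now apply M_kdk|].
    replace (ssub (kdk a) (kdk b)) with (kdk (ssub a b)).
    + apply S_mono with (m - INR (n + n') + e); [rewrite plus_INR; lra|now apply He].
    + apply sym_ext; intros x k; unfold kdk, dk, ssub; ring.
Qed.

Lemma smoothing_finite a (R0 : R) : smooth_sym a ->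
  (forall x k, R0 <= Rabs (IZR k) -> a x k = RtoC 0) -> smoothing a.
Proof.
  intros Sa H s; apply crude_intro; [assumption|]; intros beta.
  exists 1, R0; split; [lra|]; intros x k Hk.
  replace (fun y => a y k) with (fun y : R => RtoC 0 * RtoC 1)%C.
  - rewrite (C_Derive_n_scal _ (fun _ => RtoC 1)) by apply smooth_const.
    rewrite Cmult_0_l, Cmod_0, Rmult_1_l; left; apply Rpower_pos.
  - apply functional_extensionality; intros y; rewrite H by assumption; ring.
Qed.

Lemma smoothing_minus a b : smoothing a -> smoothing b -> smoothing (ssub a b).
Proof. intros Ha Hb s; now apply S_minus. Qed.

Lemma smoothing_plus a b : smoothing a -> smoothing b -> smoothing (sadd a b).
Proof. intros Ha Hb s; now apply S_plus. Qed.

End Classes.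

(** * Composition of symbols *)

Definition cterm (a b : sym) (k l : Z) (x : R) : C :=
  (expi (IZR l * x) * a x (k + l)%Z * hat (fun y => b y k) l)%C.

Definition comp (a b : sym) : sym := fun x k => Z_Series (fun l => cterm a b k l x).

Definition rem (a b : sym) : sym := ssub (comp a b) (smul a b).

Section Composition.
Variable Lam : Z -> R.
Hypothesis T : tame Lam.

Lemma S_hat_decay rho m b N : symbol_S Lam rho m b ->
  exists A, 0 < A /\ forall k l, Cmod (hat (fun y => b y k) l) <= A * Rpower (Lam k) m / wt l ^ N.
Proof.
  revert b; induction N as [|N IH]; intros b Hb.
  - destruct (S_bound _ _ _ _ Hb) as (A & HA & B); exists (2 * A); split; [lra|]; intros k l.
    simpl; rewrite Rdiv_1_r, Rmult_assoc; apply hat_bound; [apply (S_smooth _ _ _ _ Hb)|].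
    intros x; apply B.
  - destruct (IH b Hb) as (A1 & P1 & H1), (IH (dx b) (S_dx _ _ _ _ Hb)) as (A2 & P2 & H2).
    exists (A1 + A2); split; [lra|]; intros k l.
    apply Rmult_le_reg_r with (wt l); [pose proof (wt_ge_1 l); lra|].
    rewrite hat_wt_step by apply (S_smooth _ _ _ _ Hb).
    replace ((A1 + A2) * Rpower (Lam k) m / wt l ^ S N * wt l)
      with (A1 * Rpower (Lam k) m / wt l ^ N + A2 * Rpower (Lam k) m / wt l ^ N).
    + apply Rplus_le_compat; [apply H1|apply H2].
    + simpl; field; split; [apply Rgt_not_eq, wt_pow_pos|pose proof (wt_ge_1 l); lra].
Qed.

(** Growth in [l] of the kernel [u] is absorbed by the decay of the Fourier
    coefficients of [b]. *)
Lemma kernel_bound rho s m b (u : R -> Z -> Z -> C) A N : symbol_S Lam rho m b -> 0 < A ->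
  (forall x k l, Cmod (u x k l) <= A * Rpower (Lam k) s * wt l ^ N) ->
  exists K, 0 < K /\ forall x k l,
    Cmod (expi (IZR l * x) * u x k l * hat (fun y => b y k) l)%C <= K * Rpower (Lam k) (s + m) / wt l ^ 2.
Proof.
  intros Hb HA Hu; destruct (S_hat_decay rho m b (2 + N) Hb) as (K & HK & H).
  exists (A * K); split; [now apply Rmult_lt_0_compat|]; intros x k l.
  rewrite !Cmod_mult, Cmod_expi, Rmult_1_l, Rpower_plus.
  apply Rle_trans with ((A * Rpower (Lam k) s * wt l ^ N) * (K * Rpower (Lam k) m / wt l ^ (2 + N))).
  - apply Rmult_le_compat; trivial; apply Cmod_ge_0.
  - right; rewrite pow_add; field; split; [|apply Rgt_not_eq, wt_pow_pos].
    pose proof (wt_ge_1 l); lra.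
Qed.

Lemma cterm_bound rho m1 m2 a b : symbol_S Lam rho m1 a -> symbol_S Lam rho m2 b ->
  exists K, 0 < K /\ forall x k l, Cmod (cterm a b k l x) <= K * Rpower (Lam k) (m1 + m2) / wt l ^ 2.
Proof.
  intros Ha Hb; destruct (S_bound _ _ _ _ Ha) as (A & HA & B).
  destruct (tame_peetre _ T m1) as (P & N & HP & Peetre).
  apply (kernel_bound rho m1 m2 b (fun x k l => a x (k + l)%Z) (A * P) N Hb).
  - now apply Rmult_lt_0_compat.
  - intros x k l; eapply Rle_trans; [apply B|]; rewrite !Rmult_assoc.
    apply Rmult_le_compat_l; [lra|]; eapply Rle_trans; [apply Peetre|right; ring].
Qed.

Lemma zdom_cterm rho m1 m2 a b k x : symbol_S Lam rho m1 a -> symbol_S Lam rho m2 b ->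
  zdom (fun l => cterm a b k l x).
Proof.
  intros Ha Hb; destruct (cterm_bound _ _ _ _ _ Ha Hb) as (K & _ & B).
  eexists; intros l; apply B.
Qed.

Lemma comp_bound rho m1 m2 a b : symbol_S Lam rho m1 a -> symbol_S Lam rho m2 b ->
  exists K, 0 < K /\ forall x k, Cmod (comp a b x k) <= K * Rpower (Lam k) (m1 + m2).
Proof.
  intros Ha Hb; destruct (cterm_bound _ _ _ _ _ Ha Hb) as (K & HK & B).
  exists (8 * K); split; [lra|]; intros x k.
  rewrite Rmult_assoc; apply Z_Series_bound; intros l; apply B.
Qed.

Lemma cterm_Cder rho m1 m2 a b k l x : symbol_S Lam rho m1 a -> symbol_S Lam rho m2 b ->
  Cder (cterm a b k l) x (cterm (dx a) b k l x + cterm a (dx b) k l x)%C.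
Proof.
  intros Ha Hb; unfold cterm.
  change (fun y => dx b y k) with (Cderive (fun y => b y k)).
  rewrite hat_Cderive by apply (S_smooth _ _ _ _ Hb).
  refine (Cder_ext (fun t => hat (fun y => b y k) l * (expi (IZR l * t) * a t (k + l)%Z))%C _ x _ _ _ _
    (Cder_scal _ _ _ _ (Cder_mult _ _ _ _ _ (Cder_expi _ _) (S_Cder _ _ _ _ Ha _ _)))).
  - intros t; ring.
  - ring.
Qed.

(** Since [hat (d_x b) l = i l hat b l], differentiation is a derivation of
    [comp]. *)
Lemma comp_Cder rho m1 m2 a b k x : symbol_S Lam rho m1 a -> symbol_S Lam rho m2 b ->
  Cder (fun y => comp a b y k) x (sadd (comp (dx a) b) (comp a (dx b)) x k).
Proof.
  intros Ha Hb.
  assert (Ha' := S_dx _ _ _ _ Ha). assert (Hb' := S_dx _ _ _ _ Hb).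
  assert (Ha'' := S_dx _ _ _ _ Ha'). assert (Hb'' := S_dx _ _ _ _ Hb').
  unfold sadd, comp; rewrite <- Z_Series_plus by (eapply zdom_cterm; eassumption).
  destruct (cterm_bound _ _ _ _ _ Ha'' Hb) as (K1 & HK1 & B1).
  destruct (cterm_bound _ _ _ _ _ Ha' Hb') as (K2 & HK2 & B2).
  destruct (cterm_bound _ _ _ _ _ Ha Hb'') as (K3 & HK3 & B3).
  apply (Cder_Z_Series (fun l => cterm a b k l)
    (fun l x => cterm (dx a) b k l x + cterm a (dx b) k l x)%C
    (fun l x => (cterm (dx (dx a)) b k l x + cterm (dx a) (dx b) k l x) +
       (cterm (dx a) (dx b) k l x + cterm a (dx (dx b)) k l x))%C
    ((K1 + 2 * K2 + K3) * Rpower (Lam k) (m1 + m2))).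
  - intros l y; eapply cterm_Cder; eassumption.
  - intros l y; apply Cder_plus; eapply cterm_Cder; eassumption.
  - intros y; eapply zdom_cterm; eassumption.
  - intros y; apply zdom_plus; eapply zdom_cterm; eassumption.
  - intros l y; eapply Rle_trans; [apply Cmod_triangle|].
    eapply Rle_trans; [apply Rplus_le_compat; apply Cmod_triangle|].
    specialize (B1 y k l); specialize (B2 y k l); specialize (B3 y k l).
    apply Rle_trans with (K1 * Rpower (Lam k) (m1 + m2) / wt l ^ 2 + K2 * Rpower (Lam k) (m1 + m2) / wt l ^ 2
      + (K2 * Rpower (Lam k) (m1 + m2) / wt l ^ 2 + K3 * Rpower (Lam k) (m1 + m2) / wt l ^ 2)); [lra|].
    right; field; pose proof (wt_ge_1 l); lra.
Qed.

Lemma comp_sadd_l rho m1 m2 a a' b : symbol_S Lam rho m1 a -> symbol_S Lam rho m1 a' ->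
  symbol_S Lam rho m2 b -> comp (sadd a a') b = sadd (comp a b) (comp a' b).
Proof.
  intros Ha Ha' Hb; apply sym_ext; intros x k; unfold sadd at 2, comp.
  rewrite <- Z_Series_plus by (eapply zdom_cterm; eassumption).
  apply Z_Series_ext; intros l; unfold cterm, sadd; ring.
Qed.

Lemma comp_ssub_l rho m1 m2 a a' b : symbol_S Lam rho m1 a -> symbol_S Lam rho m1 a' ->
  symbol_S Lam rho m2 b -> comp (ssub a a') b = ssub (comp a b) (comp a' b).
Proof.
  intros Ha Ha' Hb; apply sym_ext; intros x k; unfold ssub at 2, comp.
  rewrite <- Z_Series_minus by (eapply zdom_cterm; eassumption).
  apply Z_Series_ext; intros l; unfold cterm, ssub; ring.
Qed.

Lemma comp_sadd_r rho m1 m2 a b b' : symbol_S Lam rho m1 a -> symbol_S Lam rho m2 b ->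
  symbol_S Lam rho m2 b' -> comp a (sadd b b') = sadd (comp a b) (comp a b').
Proof.
  intros Ha Hb Hb'; apply sym_ext; intros x k; unfold sadd at 2, comp.
  rewrite <- Z_Series_plus by (eapply zdom_cterm; eassumption).
  apply Z_Series_ext; intros l; unfold cterm, sadd.
  rewrite hat_plus by (apply (S_smooth _ _ _ _ Hb) || apply (S_smooth _ _ _ _ Hb')); ring.
Qed.

Lemma comp_ssub_r rho m1 m2 a b b' : symbol_S Lam rho m1 a -> symbol_S Lam rho m2 b ->
  symbol_S Lam rho m2 b' -> comp a (ssub b b') = ssub (comp a b) (comp a b').
Proof.
  intros Ha Hb Hb'; apply sym_ext; intros x k; unfold ssub at 2, comp.
  rewrite <- Z_Series_minus by (eapply zdom_cterm; eassumption).
  apply Z_Series_ext; intros l; unfold cterm, ssub.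
  rewrite hat_minus by (apply (S_smooth _ _ _ _ Hb) || apply (S_smooth _ _ _ _ Hb')); ring.
Qed.

(** [a(k+1+l) b(k+1) - a(k+l) b(k)] is split as for a product. *)
Lemma dk_comp rho m1 m2 a b : symbol_S Lam rho m1 a -> symbol_S Lam rho m2 b ->
  dk (comp a b) = sadd (comp (dk a) (sh 1 b)) (comp a (dk b)).
Proof.
  intros Ha Hb; apply sym_ext; intros x k; unfold sadd, dk at 1, comp.
  rewrite <- Z_Series_minus by (eapply zdom_cterm; eassumption).
  rewrite <- Z_Series_plus.
  - apply Z_Series_ext; intros l; unfold cterm.
    change (fun y => dk b y k) with (fun y => b y (k + 1)%Z - b y k)%C.
    rewrite hat_minus by apply (S_smooth _ _ _ _ Hb).
    unfold dk, sh; replace (k + l + 1)%Z with (k + 1 + l)%Z by ring; ring.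
  - eapply zdom_cterm; [apply S_dk; eassumption|apply S_sh; eassumption].
  - eapply zdom_cterm; [eassumption|apply S_dk; eassumption].
Qed.

Lemma comp_periodic a b x k : (forall x k, a (x + 2 * PI) k = a x k) ->
  comp a b (x + 2 * PI) k = comp a b x k.
Proof.
  intros P; apply Z_Series_ext; intros l; unfold cterm; rewrite P.
  replace (IZR l * (x + 2 * PI)) with (IZR l * x + IZR l * (2 * PI)) by ring.
  now rewrite expi_period.
Qed.

(** The family is closed under sums because [d_x] and [Delta] of one composition
    are sums of two. *)
Inductive comp_sums rho : R -> sym -> Prop :=
| cs_comp m1 m2 m a b : m = m1 + m2 -> symbol_S Lam rho m1 a -> symbol_S Lam rho m2 b ->
    comp_sums rho m (comp a b)
| cs_plus m f g : comp_sums rho m f -> comp_sums rho m g -> comp_sums rho m (sadd f g).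

Lemma comp_S rho m1 m2 a b : symbol_S Lam rho m1 a -> symbol_S Lam rho m2 b ->
  symbol_S Lam rho (m1 + m2) (comp a b).
Proof.
  intros Ha Hb; apply (S_coind Lam rho (comp_sums rho)); [|now apply cs_comp with m1 m2].
  clear a b Ha Hb m1 m2; induction 1 as [m1 m2 m a b E Ha Hb|m f g Hf If Hg Ig].
  - subst m; split; [|split; [|split]].
    + intros x k; apply comp_periodic, (S_periodic _ _ _ _ Ha).
    + eapply comp_bound; eassumption.
    + exists (sadd (comp (dx a) b) (comp a (dx b))); split.
      * apply cs_plus; apply cs_comp with m1 m2; trivial; now apply S_dx.
      * intros x k; eapply comp_Cder; eassumption.
    + erewrite dk_comp by eassumption; apply cs_plus.
      * apply cs_comp with (m1 - rho) m2; [ring|now apply S_dk|now apply S_sh].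
      * apply cs_comp with m1 (m2 - rho); [ring|assumption|now apply S_dk].
  - destruct If as (Pa & (A1 & HA1 & B1) & (a' & Ya & Da) & Ka).
    destruct Ig as (Pb & (A2 & HA2 & B2) & (b' & Yb & Db) & Kb).
    split; [|split; [|split]].
    + intros x k; unfold sadd; now rewrite Pa, Pb.
    + exists (A1 + A2); split; [lra|]; intros x k; unfold sadd.
      eapply Rle_trans; [apply Cmod_triangle|]; specialize (B1 x k); specialize (B2 x k); lra.
    + exists (sadd a' b'); split; [now apply cs_plus|]; intros x k; now apply Cder_plus.
    + replace (dk (sadd f g)) with (sadd (dk f) (dk g)); [now apply cs_plus|].
      apply sym_ext; intros x k; unfold dk, sadd; ring.
Qed.

Lemma dx_rem_Cder rho m1 m2 a b k x : symbol_S Lam rho m1 a -> symbol_S Lam rho m2 b ->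
  Cder (fun y => rem a b y k) x (sadd (rem (dx a) b) (rem a (dx b)) x k).
Proof.
  intros Ha Hb.
  refine (Cder_ext _ _ x _ _ (fun _ => eq_refl) _ (Cder_minus _ _ _ _ _ (comp_Cder _ _ _ _ _ k x Ha Hb)
    (Cder_mult _ _ _ _ _ (S_Cder _ _ _ _ Ha x k) (S_Cder _ _ _ _ Hb x k)))).
  unfold rem, sadd, ssub, smul; ring.
Qed.

Lemma dk_rem rho m1 m2 a b : symbol_S Lam rho m1 a -> symbol_S Lam rho m2 b ->
  dk (rem a b) = sadd (rem (dk a) (sh 1 b)) (rem a (dk b)).
Proof.
  intros Ha Hb; assert (E := dk_comp _ _ _ _ _ Ha Hb).
  apply sym_ext; intros x k; apply (f_equal (fun g => g x k)) in E.
  unfold rem, dk, sadd, ssub, smul, sh in *.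
  match goal with |- (?p - ?q - (?r - ?s))%C = _ => transitivity ((p - r) - (q - s))%C; [ring|] end.
  rewrite E; ring.
Qed.

(** Telescoping from [k] to [k+l]; each of the [|l|] steps is compared with the
    weight at [k]. *)
Lemma difference_bound s a : (exists A, 0 < A /\ forall x k, Cmod (dk a x k) <= A * Rpower (Lam k) s) ->
  exists A N, 0 < A /\ forall x k l, Cmod (a x (k + l)%Z - a x k)%C <= A * Rpower (Lam k) s * wt l ^ N.
Proof.
  intros (A & HA & B); destruct (tame_peetre _ T s) as (P & N & HP & Peetre).
  exists (A * P), (S N); split; [now apply Rmult_lt_0_compat|]; intros x k l.
  set (M := A * (P * Rpower (Lam k) s * wt l ^ N)).
  assert (step : forall j, (Z.abs j <= Z.abs l)%Z -> Cmod (a x (k + j + 1)%Z - a x (k + j)%Z)%C <= M).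
  { intros j Hj; eapply Rle_trans; [apply B|]; apply Rmult_le_compat_l; [lra|].
    eapply Rle_trans; [apply Peetre|]; apply Rmult_le_compat_l.
    - apply Rmult_le_pos; [lra|left; apply Rpower_pos].
    - apply pow_incr; split; [pose proof (wt_ge_1 j); lra|].
      unfold wt; rewrite <- !abs_IZR; apply Rplus_le_compat_l, IZR_le, Hj. }
  assert (Nq : forall n : nat, (Z.of_nat n <= Z.abs l)%Z ->
     Cmod (a x (k + Z.of_nat n)%Z - a x k)%C <= INR n * M /\
     Cmod (a x (k - Z.of_nat n)%Z - a x k)%C <= INR n * M).
  { induction n as [|n IH]; intros Hn.
    - replace (k + Z.of_nat 0)%Z with k by lia; replace (k - Z.of_nat 0)%Z with k by lia.
      replace (a x k - a x k)%C with (RtoC 0) by ring; rewrite Cmod_0; simpl; lra.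
    - destruct (IH ltac:(lia)) as [I1 I2]; rewrite S_INR; split.
      + specialize (step (Z.of_nat n) ltac:(lia)).
        replace (k + Z.of_nat (S n))%Z with (k + Z.of_nat n + 1)%Z by lia.
        replace (a x (k + Z.of_nat n + 1)%Z - a x k)%C with
          ((a x (k + Z.of_nat n + 1)%Z - a x (k + Z.of_nat n)%Z) + (a x (k + Z.of_nat n)%Z - a x k))%C by ring.
        eapply Rle_trans; [apply Cmod_triangle|]; lra.
      + specialize (step (- Z.of_nat (S n))%Z ltac:(lia)).
        replace (k + - Z.of_nat (S n) + 1)%Z with (k - Z.of_nat n)%Z in step by lia.
        replace (k + - Z.of_nat (S n))%Z with (k - Z.of_nat (S n))%Z in step by lia.
        replace (a x (k - Z.of_nat (S n))%Z - a x k)%C with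
          ((a x (k - Z.of_nat n)%Z - a x k) - (a x (k - Z.of_nat n)%Z - a x (k - Z.of_nat (S n))%Z))%C by ring.
        eapply Rle_trans; [apply Cmod_minus_le|]; lra. }
  assert (G : Cmod (a x (k + l)%Z - a x k)%C <= INR (Z.to_nat (Z.abs l)) * M).
  { destruct (Nq (Z.to_nat (Z.abs l)) ltac:(lia)) as [I1 I2].
    destruct (Z_le_gt_dec 0 l).
    - replace (k + l)%Z with (k + Z.of_nat (Z.to_nat (Z.abs l)))%Z by lia; exact I1.
    - replace (k + l)%Z with (k - Z.of_nat (Z.to_nat (Z.abs l)))%Z by lia; exact I2. }
  eapply Rle_trans; [exact G|].
  apply Rle_trans with (wt l * M); [|right; unfold M; simpl; ring].
  apply Rmult_le_compat_r.
  - unfold M; apply Rmult_le_pos; [lra|]; apply Rmult_le_pos; [|left; apply wt_pow_pos].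
    apply Rmult_le_pos; [lra|left; apply Rpower_pos].
  - unfold wt; rewrite INR_IZR_INZ, Z2Nat.id, abs_IZR by lia; lra.
Qed.

(** By Fourier inversion [a(x,k) b(x,k)] is the sum over [l] of
    [e^{ilx} a(x,k) hat b l], so only [a(x,k+l) - a(x,k)] is left. *)
Lemma rem_bound rho m1 m2 a b : symbol_S Lam rho m1 a -> symbol_S Lam rho m2 b ->
  exists K, 0 < K /\ forall x k, Cmod (rem a b x k) <= K * Rpower (Lam k) (m1 - rho + m2).
Proof.
  intros Ha Hb.
  destruct (difference_bound _ _ (S_bound _ _ _ _ (S_dk _ _ _ _ Ha))) as (A & N & HA & B).
  destruct (kernel_bound _ _ _ _ (fun x k l => a x (k + l)%Z - a x k)%C A N Hb HA B) as (K & HK & H).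
  exists (8 * K); split; [lra|]; intros x k.
  assert (Sb := S_smooth _ _ _ _ Hb k).
  replace (rem a b x k) with
    (Z_Series (fun l => expi (IZR l * x) * (a x (k + l)%Z - a x k) * hat (fun y => b y k) l)%C).
  - rewrite Rmult_assoc; apply Z_Series_bound; intros l; apply H.
  - unfold rem, ssub, smul, comp; rewrite <- (fourier_inversion _ x Sb), <- Z_Series_scal
      by exact (zdom_fterm _ x Sb).
    rewrite <- Z_Series_minus.
    + apply Z_Series_ext; intros l; unfold cterm; ring.
    + eapply zdom_cterm; eassumption.
    + apply zdom_scal; exact (zdom_fterm _ x Sb).
Qed.

Inductive rem_sums rho : R -> sym -> Prop :=
| rs_rem m1 m2 m a b : m = m1 - rho + m2 -> symbol_S Lam rho m1 a -> symbol_S Lam rho m2 b ->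
    rem_sums rho m (rem a b)
| rs_plus m f g : rem_sums rho m f -> rem_sums rho m g -> rem_sums rho m (sadd f g).

(** [rem] inherits both derivation rules from [comp] and the product, so the
    gain of [rho] in size propagates to all derivatives and differences. *)
Lemma rem_S rho m1 m2 a b : symbol_S Lam rho m1 a -> symbol_S Lam rho m2 b ->
  symbol_S Lam rho (m1 + m2 - rho) (rem a b).
Proof.
  intros Ha Hb; apply (S_coind Lam rho (rem_sums rho)).
  2:{ apply rs_rem with m1 m2; trivial; ring. }
  clear a b Ha Hb m1 m2; induction 1 as [m1 m2 m a b E Ha Hb|m f g Hf If Hg Ig].
  - subst m; split; [|split; [|split]].
    + intros x k; unfold rem, ssub, smul.
      rewrite comp_periodic, (S_periodic _ _ _ _ Ha), (S_periodic _ _ _ _ Hb); [reflexivity|].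
      apply (S_periodic _ _ _ _ Ha).
    + eapply rem_bound; eassumption.
    + exists (sadd (rem (dx a) b) (rem a (dx b))); split.
      * apply rs_plus; apply rs_rem with m1 m2; trivial; now apply S_dx.
      * intros x k; eapply dx_rem_Cder; eassumption.
    + erewrite dk_rem by eassumption; apply rs_plus.
      * apply rs_rem with (m1 - rho) m2; [ring|now apply S_dk|now apply S_sh].
      * apply rs_rem with m1 (m2 - rho); [ring|assumption|now apply S_dk].
  - destruct If as (Pa & (A1 & HA1 & B1) & (a' & Ya & Da) & Ka).
    destruct Ig as (Pb & (A2 & HA2 & B2) & (b' & Yb & Db) & Kb).
    split; [|split; [|split]].
    + intros x k; unfold sadd; now rewrite Pa, Pb.
    + exists (A1 + A2); split; [lra|]; intros x k; unfold sadd.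
      eapply Rle_trans; [apply Cmod_triangle|]; specialize (B1 x k); specialize (B2 x k); lra.
    + exists (sadd a' b'); split; [now apply rs_plus|]; intros x k; now apply Cder_plus.
    + replace (dk (sadd f g)) with (sadd (dk f) (dk g)); [now apply rs_plus|].
      apply sym_ext; intros x k; unfold dk, sadd; ring.
Qed.

(** Writing [k = (k+l) - l], the first part multiplies [Delta a] at [k+l] by its
    own index and the second differentiates [b]. *)
Lemma k_comp_dk rho m1 m2 a b : symbol_S Lam rho m1 a -> symbol_S Lam rho m1 (kdk a) ->
  symbol_S Lam rho m2 b ->
  (fun x k => RtoC (IZR k) * comp (dk a) b x k)%C =
  sadd (comp (kdk a) b) (sscal Ci (comp (dk a) (dx b))).
Proof.
  intros Ha Ka Hb; apply sym_ext; intros x k; unfold sadd, sscal, comp.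
  assert (Z1 : zdom (fun l => cterm (kdk a) b k l x)) by (eapply zdom_cterm; eassumption).
  assert (Z2 : zdom (fun l => cterm (dk a) (dx b) k l x))
    by (eapply zdom_cterm; [apply S_dk; eassumption|apply S_dx; eassumption]).
  assert (Z3 : zdom (fun l => cterm (dk a) b k l x))
    by (eapply zdom_cterm; [apply S_dk; eassumption|eassumption]).
  rewrite <- !Z_Series_scal, <- Z_Series_plus by (trivial; now apply zdom_scal).
  apply Z_Series_ext; intros l; unfold cterm.
  change (fun y => dx b y k) with (Cderive (fun y => b y k)).
  rewrite hat_Cderive by apply (S_smooth _ _ _ _ Hb).
  unfold kdk; rewrite plus_IZR, RtoC_plus.
  replace (Ci * (expi (IZR l * x) * dk a x (k + l)%Z * (Ci * RtoC (IZR l) * hat (fun y => b y k) l)))%C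
    with ((Ci * Ci) * (expi (IZR l * x) * dk a x (k + l)%Z * (RtoC (IZR l) * hat (fun y => b y k) l)))%C by ring.
  replace (Ci * Ci)%C with (- RtoC 1)%C by (apply C_eq; simpl; ring).
  ring.
Qed.

Lemma rem_M rho m1 m2 a b : symbol_M Lam rho m1 a -> symbol_M Lam rho m2 b ->
  symbol_M Lam rho (m1 + m2 - rho) (rem a b).
Proof.
  intros Ma Mb; apply (M_iff _) in Ma as [Ha Ka]; apply (M_iff _) in Mb as [Hb Kb].
  apply (M_iff _); split; [now apply rem_S|].
  assert (Hb1 := S_sh _ T _ _ 1 _ Hb).
  replace (kdk (rem a b)) with
    (sadd (rem (kdk a) (sh 1 b)) (sadd (sscal Ci (comp (dk a) (dx (sh 1 b)))) (rem a (kdk b)))).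
  - apply S_plus; [assumption|now apply rem_S|apply S_plus; [assumption| |now apply rem_S]].
    apply S_scal; [assumption|]; replace (m1 + m2 - rho) with (m1 - rho + m2) by ring.
    apply comp_S; [now apply S_dk|now apply S_dx].
  - apply sym_ext; intros x k.
    assert (E1 := k_comp_dk _ _ _ _ _ Ha Ka Hb1); apply (f_equal (fun g => g x k)) in E1.
    unfold kdk at 3; erewrite dk_rem by eassumption.
    assert (E2 : rem a (kdk b) x k = (RtoC (IZR k) * rem a (dk b) x k)%C).
    { unfold rem, ssub, smul, comp.
      assert (Zd : zdom (fun l => cterm a (dk b) k l x))
        by (eapply zdom_cterm; [eassumption|apply S_dk; eassumption]).
      transitivity (Z_Series (fun l => RtoC (IZR k) * cterm a (dk b) k l x) - RtoC (IZR k) * (a x k * dk b x k))%C.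
      - f_equal; [|unfold kdk; ring].
        apply Z_Series_ext; intros l; unfold cterm.
        change (fun y => kdk b y k) with (fun y => RtoC (IZR k) * dk b y k)%C.
        rewrite hat_scal by apply (S_smooth _ _ _ _ (S_dk _ _ _ _ Hb)); ring.
      - rewrite Z_Series_scal by assumption; ring. }
    unfold sadd at 1 2; rewrite E2; unfold sadd, rem, ssub, smul, sscal in *.
    transitivity ((RtoC (IZR k) * comp (dk a) (sh 1 b) x k) - kdk a x k * sh 1 b x k
      + RtoC (IZR k) * (comp a (dk b) x k - a x k * dk b x k))%C.
    + rewrite E1; ring.
    + unfold kdk; ring.
Qed.

(** * Operators *)

Definition pterm (b : sym) (f : R -> C) (k : Z) (x : R) : C :=
  (expi (IZR k * x) * b x k * hat f k)%C.

Definition op (b : sym) (f : R -> C) (x : R) : C := Z_Series (fun k => pterm b f k x).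

Lemma pdo_op b f x : smooth_torus f -> pdo b f x = op b f x.
Proof. intros; now apply pdo_hat. Qed.

Lemma pterm_bound rho m b f j : symbol_S Lam rho m b -> smooth_torus f ->
  exists K, 0 < K /\ forall k x, Cmod (pterm b f k x) <= K / wt k ^ (2 + j).
Proof.
  intros Hb Hf; destruct (S_bound _ _ _ _ Hb) as (A & HA & B).
  destruct (tame_poly _ T m) as (P & N & HP & Poly).
  destruct (hat_decay f (2 + j + N) Hf) as (K & HK & H).
  exists (A * P * K); split; [now repeat apply Rmult_lt_0_compat|]; intros k x; unfold pterm.
  rewrite !Cmod_mult, Cmod_expi, Rmult_1_l.
  apply Rle_trans with ((A * (P * wt k ^ N)) * (K / wt k ^ (2 + j + N))).
  - apply Rmult_le_compat; trivial; try apply Cmod_ge_0.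
    eapply Rle_trans; [apply B|]; apply Rmult_le_compat_l; [lra|apply Poly].
  - right; rewrite (pow_add _ (2 + j) N); field; split; apply Rgt_not_eq, wt_pow_pos.
Qed.

Lemma zdom_pterm rho m b f x : symbol_S Lam rho m b -> smooth_torus f -> zdom (fun k => pterm b f k x).
Proof.
  intros Hb Hf; destruct (pterm_bound _ _ _ _ 0 Hb Hf) as (K & _ & H).
  exists K; intros k; apply H.
Qed.

Lemma pterm_Cder rho m b f k x : symbol_S Lam rho m b -> smooth_torus f ->
  Cder (pterm b f k) x (pterm (dx b) f k x + pterm b (Cderive f) k x)%C.
Proof.
  intros Hb Hf; unfold pterm; rewrite hat_Cderive by assumption.
  refine (Cder_ext (fun t => hat f k * (expi (IZR k * t) * b t k))%C _ x _ _ _ _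
    (Cder_scal _ _ _ _ (Cder_mult _ _ _ _ _ (Cder_expi _ _) (S_Cder _ _ _ _ Hb _ _)))).
  - intros t; ring.
  - ring.
Qed.

Lemma pterm_Cder2 rho m b f k x : symbol_S Lam rho m b -> smooth_torus f ->
  Cder (fun x => pterm (dx b) f k x + pterm b (Cderive f) k x)%C x
    ((pterm (dx (dx b)) f k x + pterm (dx b) (Cderive f) k x) +
     (pterm (dx b) (Cderive f) k x + pterm b (Cderive (Cderive f)) k x))%C.
Proof.
  intros Hb Hf; apply Cder_plus; eapply pterm_Cder; eauto using smooth_Cderive, S_dx.
Qed.

Lemma pterm_bounds rho m b f : symbol_S Lam rho m b -> smooth_torus f ->
  exists K, (forall k x, Cmod (pterm b f k x) <= K / wt k ^ 2) /\
   (forall k x, Cmod (pterm (dx b) f k x + pterm b (Cderive f) k x)%C <= K / wt k ^ 2) /\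
   (forall k x, Cmod ((pterm (dx (dx b)) f k x + pterm (dx b) (Cderive f) k x) +
     (pterm (dx b) (Cderive f) k x + pterm b (Cderive (Cderive f)) k x))%C <= K / wt k ^ 2).
Proof.
  intros Hb Hf.
  assert (Hb' := S_dx _ _ _ _ Hb). assert (Hb'' := S_dx _ _ _ _ Hb').
  assert (Hf' := smooth_Cderive _ Hf). assert (Hf'' := smooth_Cderive _ Hf').
  destruct (pterm_bound _ _ _ _ 0 Hb Hf) as (K1 & P1 & H1).
  destruct (pterm_bound _ _ _ _ 0 Hb' Hf) as (K2 & P2 & H2).
  destruct (pterm_bound _ _ _ _ 0 Hb Hf') as (K3 & P3 & H3).
  destruct (pterm_bound _ _ _ _ 0 Hb'' Hf) as (K4 & P4 & H4).
  destruct (pterm_bound _ _ _ _ 0 Hb' Hf') as (K5 & P5 & H5).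
  destruct (pterm_bound _ _ _ _ 0 Hb Hf'') as (K6 & P6 & H6).
  simpl Nat.add in *.
  exists (K1 + K2 + K3 + K4 + 2 * K5 + K6); repeat split; intros k x;
    (assert (I : 0 < / wt k ^ 2) by (apply Rinv_0_lt_compat, wt_pow_pos));
    specialize (H1 k x); specialize (H2 k x); specialize (H3 k x);
    specialize (H4 k x); specialize (H5 k x); specialize (H6 k x); unfold Rdiv in *.
  - nra.
  - eapply Rle_trans; [apply Cmod_triangle|]; nra.
  - eapply Rle_trans; [apply Cmod_triangle|].
    eapply Rle_trans; [apply Rplus_le_compat; apply Cmod_triangle|]; nra.
Qed.

Lemma op_Cder rho m b f x : symbol_S Lam rho m b -> smooth_torus f ->
  Cder (op b f) x (op (dx b) f x + op b (Cderive f) x)%C.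
Proof.
  intros Hb Hf; destruct (pterm_bounds _ _ _ _ Hb Hf) as (K & B0 & B1 & B2).
  unfold op; rewrite <- Z_Series_plus by (eapply zdom_pterm; eauto using smooth_Cderive, S_dx).
  apply (Cder_Z_Series (fun k => pterm b f k) (fun k x => pterm (dx b) f k x + pterm b (Cderive f) k x)%C _ K)
    with (5 := B2); intros.
  - eapply pterm_Cder; eassumption.
  - eapply pterm_Cder2; eassumption.
  - exists K; intros k; apply B0.
  - exists K; intros k; apply B1.
Qed.

Inductive op_sums rho : (R -> C) -> Prop :=
| os_op m b f : symbol_S Lam rho m b -> smooth_torus f -> op_sums rho (op b f)
| os_plus f g : op_sums rho f -> op_sums rho g -> op_sums rho (fun x => f x + g x)%C.

Lemma op_smooth rho m b f : symbol_S Lam rho m b -> smooth_torus f -> smooth_torus (op b f).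
Proof.
  intros Hb Hf; apply (smooth_coind (op_sums rho)); [|now apply os_op with m].
  clear m b f Hb Hf; induction 1 as [m b f Hb Hf|f g Hf (Pf & f' & Yf & Df) Hg (Pg & g' & Yg & Dg)].
  - split.
    + intros x; apply Z_Series_ext; intros k; unfold pterm.
      rewrite (S_periodic _ _ _ _ Hb).
      replace (IZR k * (x + 2 * PI)) with (IZR k * x + IZR k * (2 * PI)) by ring.
      now rewrite expi_period.
    + exists (fun x => op (dx b) f x + op b (Cderive f) x)%C; split.
      * apply os_plus; eapply os_op; eauto using smooth_Cderive, S_dx.
      * intros x; eapply op_Cder; eassumption.
  - split; [intros x; now rewrite Pf, Pg|].
    exists (fun x => f' x + g' x)%C; split; [now apply os_plus|].
    intros x; now apply Cder_plus.
Qed.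

Lemma pdo_smooth rho m b f : symbol_S Lam rho m b -> smooth_torus f -> smooth_torus (pdo b f).
Proof.
  intros Hb Hf; replace (pdo b f) with (op b f); [eapply op_smooth; eassumption|].
  apply functional_extensionality; intros x; symmetry; now apply pdo_op.
Qed.

(** Absorbing [e^{-ipy}] into the symbol leaves an integral of a series to be
    taken term by term. *)
Lemma hat_op rho m b f p : symbol_S Lam rho m b -> smooth_torus f ->
  hat (op b f) p = Z_Series (fun k => hat f k * hat (fun y => b y k) (p - k))%C.
Proof.
  intros Hb Hf.
  set (b' := smul (fun x _ => expi (IZR (- p) * x)) b).
  assert (Hb' : symbol_S Lam rho (0 + m) b').
  { apply S_mult; [assumption| |assumption]; apply (S_of_torus Lam T rho (fun x => expi (IZR (- p) * x))), smooth_expi. }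
  destruct (pterm_bounds _ _ _ _ Hb' Hf) as (K & B0 & B1 & B2).
  unfold hat at 1.
  rewrite (C_RInt_ext _ (fun y => Z_Series (fun k => pterm b' f k y))).
  - rewrite (C_RInt_Z_Series _ _ _ K _ (fun k x => pterm_Cder _ _ _ _ k x Hb' Hf)
      (fun k x => pterm_Cder2 _ _ _ _ k x Hb' Hf) B0 B1 B2).
    rewrite <- Z_Series_real_scal; apply Z_Series_ext; intros k.
    rewrite (C_RInt_ext _ (fun y => hat f k * (b y k * expi (IZR (- (p - k)) * y)))%C).
    + rewrite C_RInt_scal by (apply smooth_Ccont, smooth_hat_integrand, (S_smooth _ _ _ _ Hb)).
      unfold hat; ring.
    + intros y; unfold pterm, b', smul.
      replace (IZR (- (p - k)) * y) with (IZR k * y + IZR (- p) * y)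
        by (rewrite !opp_IZR, minus_IZR; ring).
      rewrite expi_plus; ring.
  - intros y; unfold op; rewrite Cmult_comm, <- Z_Series_scal by (eapply zdom_pterm; eassumption).
    apply Z_Series_ext; intros k; unfold pterm, b', smul; ring.
Qed.

Lemma shift_comp rho m1 m2 a b k x : symbol_S Lam rho m1 a -> symbol_S Lam rho m2 b ->
  Z_Series (fun p => expi (IZR p * x) * a x p * hat (fun y => b y k) (p - k))%C =
  (expi (IZR k * x) * comp a b x k)%C.
Proof.
  intros Ha Hb.
  assert (Zc : zdom (fun l => expi (IZR k * x) * cterm a b k l x)%C)
    by (apply zdom_scal; eapply zdom_cterm; eassumption).
  assert (E : forall p, (expi (IZR (p + k) * x) * a x (p + k)%Z * hat (fun y => b y k) (p + k - k))%C
    = (expi (IZR k * x) * cterm a b k p x)%C).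
  { intros p; unfold cterm; rewrite plus_IZR, Rmult_plus_distr_r, expi_plus.
    replace (p + k - k)%Z with p by ring; replace (p + k)%Z with (k + p)%Z by ring; ring. }
  unfold comp; rewrite <- Z_Series_scal by (eapply zdom_cterm; eassumption).
  rewrite <- (Z_Series_shift (fun p => expi (IZR p * x) * a x p * hat (fun y => b y k) (p - k))%C k).
  - apply Z_Series_ext; intros l; apply E.
  - eapply zdom_ext; [|exact (zdom_shift _ (- k) Zc)]; intros p; cbv beta.
    rewrite <- E; replace (p + - k + k)%Z with p by ring; reflexivity.
Qed.

(** Insert the Fourier coefficients of [op b f] and exchange the two sums.  The
    exponents are chosen so that [wt p <= wt (p-k) wt k] trades the growth of
    [a] in [p] and the two powers needed for summation against the decay of
    [hat b] and [hat f]. *)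
Theorem op_comp rho m1 m2 a b f x : symbol_S Lam rho m1 a -> symbol_S Lam rho m2 b ->
  smooth_torus f -> op a (op b f) x = op (comp a b) f x.
Proof.
  intros Ha Hb Hf.
  destruct (S_bound _ _ _ _ Ha) as (A1 & HA1 & B1).
  destruct (tame_poly _ T m1) as (P1 & N1 & HP1 & Poly1).
  destruct (tame_poly _ T m2) as (P2 & N2 & HP2 & Poly2).
  destruct (S_hat_decay _ _ _ (2 + N1) Hb) as (A2 & HA2 & B2).
  destruct (hat_decay f (N2 + (2 + N1) + 3) Hf) as (A3 & HA3 & B3).
  set (F := fun k p => (expi (IZR p * x) * a x p * (hat f k * hat (fun y => b y k) (p - k)))%C).
  assert (HF : forall k p, Cmod (F k p) <= A1 * P1 * A2 * P2 * A3 / (wt k ^ 3 * wt p ^ 2)).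
  { intros k p; unfold F; rewrite !Cmod_mult, Cmod_expi, Rmult_1_l.
    pose proof (wt_pow_pos p N1); pose proof (wt_pow_pos p 2); pose proof (wt_pow_pos k N2).
    pose proof (wt_pow_pos k 3); pose proof (wt_pow_pos (p - k) (2 + N1)) as W.
    pose proof (wt_pow_pos k (2 + N1)) as W'.
    assert (Q1 : Cmod (a x p) <= A1 * P1 * wt p ^ N1).
    { eapply Rle_trans; [apply B1|]; rewrite Rmult_assoc; apply Rmult_le_compat_l; [lra|apply Poly1]. }
    assert (Q2 : Cmod (hat (fun y => b y k) (p - k)) <= A2 * P2 * wt k ^ N2 / wt (p - k) ^ (2 + N1)).
    { eapply Rle_trans; [apply B2|]; apply Rmult_le_compat_r; [left; now apply Rinv_0_lt_compat|].
      rewrite Rmult_assoc; apply Rmult_le_compat_l; [lra|apply Poly2]. }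
    assert (Q3 := B3 k).
    assert (Q4 : wt p ^ (2 + N1) <= wt (p - k) ^ (2 + N1) * wt k ^ (2 + N1)).
    { rewrite <- Rpow_mult_distr; apply pow_incr; split; [pose proof (wt_ge_1 p); lra|].
      replace p with (p - k + k)%Z at 1 by ring; apply wt_plus. }
    eapply Rle_trans.
    { apply Rmult_le_compat; [apply Cmod_ge_0| |exact Q1|].
      - apply Rmult_le_pos; apply Cmod_ge_0.
      - apply Rmult_le_compat; [apply Cmod_ge_0|apply Cmod_ge_0|exact Q3|exact Q2]. }
    apply Rle_trans with (A1 * P1 * A2 * P2 * A3 / (wt k ^ 3 * wt p ^ 2) *
      (wt p ^ (2 + N1) / (wt (p - k) ^ (2 + N1) * wt k ^ (2 + N1)))).
    - right; rewrite (pow_add (wt k) (N2 + (2 + N1)) 3), (pow_add (wt k) N2 (2 + N1)).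
      rewrite (pow_add (wt p) 2 N1).
      field; pose proof (wt_ge_1 k); pose proof (wt_ge_1 p); repeat split;
        try (apply Rgt_not_eq; assumption); lra.
    - rewrite <- (Rmult_1_r (A1 * P1 * A2 * P2 * A3 / (wt k ^ 3 * wt p ^ 2))) at 2.
      apply Rmult_le_compat_l.
      + apply Rdiv_le_0_compat; [|now apply Rmult_lt_0_compat].
        left; now repeat apply Rmult_lt_0_compat.
      + apply Rmult_le_reg_r with (wt (p - k) ^ (2 + N1) * wt k ^ (2 + N1)); [now apply Rmult_lt_0_compat|].
        unfold Rdiv; rewrite Rmult_assoc, Rinv_l, Rmult_1_r, Rmult_1_l; [exact Q4|].
        apply Rgt_not_eq; now apply Rmult_lt_0_compat. }
  assert (Zf : forall p, zdom (fun k => hat f k * hat (fun y => b y k) (p - k))%C).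
  { intros p; exists (A2 * P2 * A3); intros k; rewrite Cmod_mult.
    pose proof (wt_pow_pos (p - k) (2 + N1)) as W; pose proof (wt_pow_pos k N2).
    assert (Q2 : Cmod (hat (fun y => b y k) (p - k)) <= A2 * P2 * wt k ^ N2).
    { eapply Rle_trans; [apply B2|].
      apply Rle_trans with (A2 * Rpower (Lam k) m2); [|rewrite Rmult_assoc; apply Rmult_le_compat_l; [lra|apply Poly2]].
      rewrite <- (Rmult_1_r (A2 * Rpower (Lam k) m2)) at 2; apply Rmult_le_compat_l.
      - apply Rmult_le_pos; [lra|left; apply Rpower_pos].
      - rewrite <- Rinv_1; apply Rinv_le_contravar; [lra|]; apply pow_R1_Rle, wt_ge_1. }
    eapply Rle_trans; [apply Rmult_le_compat; [apply Cmod_ge_0|apply Cmod_ge_0|apply B3|exact Q2]|].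
    apply Rle_trans with (A2 * P2 * A3 / wt k ^ (2 + (N1 + 3))).
    - right; replace (N2 + (2 + N1) + 3)%nat with (N2 + (2 + (N1 + 3)))%nat by lia.
      rewrite pow_add; field; split; apply Rgt_not_eq; [apply wt_pow_pos|assumption].
    - apply Rmult_le_compat_l; [left; now repeat apply Rmult_lt_0_compat|].
      apply Rinv_le_contravar; [apply wt_pow_pos|]; apply Rle_pow; [apply wt_ge_1|lia]. }
  transitivity (Z_Series (fun p => Z_Series (fun k => F k p))).
  - unfold op at 1; apply Z_Series_ext; intros p; unfold pterm.
    rewrite (hat_op _ _ _ _ _ Hb Hf), <- Z_Series_scal by apply Zf; reflexivity.
  - rewrite <- (Z_Series_swap _ _ HF); unfold op; apply Z_Series_ext; intros k.
    unfold pterm; rewrite <- (shift_comp _ _ _ _ _ _ _ Ha Hb), Cmult_comm, <- Z_Series_scal.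
    + apply Z_Series_ext; intros p; unfold F; ring.
    + apply zdom_ext with (fun p => expi (IZR k * x) * cterm a b k (p - k) x)%C.
      * intros p; unfold cterm.
        replace (expi (IZR p * x)) with (expi (IZR k * x) * expi (IZR (p - k) * x))%C.
        -- replace (k + (p - k))%Z with p by ring; ring.
        -- rewrite <- expi_plus; f_equal; rewrite minus_IZR; ring.
      * apply zdom_scal; apply (zdom_shift (fun l => cterm a b k l x) (- k)).
        eapply zdom_cterm; eassumption.
Qed.

(** Modulation by [e^{iky}] shifts Fourier coefficients by [k]. *)
Lemma comp_op rho m1 m2 a b k x : symbol_S Lam rho m1 a -> symbol_S Lam rho m2 b ->
  op a (fun y => b y k * expi (IZR k * y))%C x = (expi (IZR k * x) * comp a b x k)%C.
Proof.
  intros Ha Hb; rewrite <- (shift_comp _ _ _ _ _ _ _ Ha Hb).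
  apply Z_Series_ext; intros p; unfold pterm; now rewrite hat_modulate.
Qed.

Lemma expi_cancel t (z w : C) : (expi t * z)%C = (expi t * w)%C -> z = w.
Proof.
  intros E; replace z with (expi t * expi (- t) * z)%C by (rewrite expi_neg; ring).
  replace (expi t * expi (- t) * z)%C with (expi (- t) * (expi t * z))%C by ring.
  rewrite E.
  replace (expi (- t) * (expi t * w))%C with (expi t * expi (- t) * w)%C by ring.
  rewrite expi_neg; ring.
Qed.

(** Associativity of operators, tested on the exponential [e^{ikx}]. *)
Lemma comp_assoc rho m1 m2 m3 a b c : symbol_S Lam rho m1 a -> symbol_S Lam rho m2 b ->
  symbol_S Lam rho m3 c -> comp a (comp b c) = comp (comp a b) c.
Proof.
  intros Ha Hb Hc; apply sym_ext; intros x k; apply (expi_cancel (IZR k * x)).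
  assert (Sc : smooth_torus (fun y => c y k * expi (IZR k * y))%C)
    by (apply smooth_mult; [apply (S_smooth _ _ _ _ Hc)|apply smooth_expi]).
  rewrite <- (comp_op _ _ _ _ _ _ _ Ha (comp_S _ _ _ _ _ Hb Hc)).
  rewrite <- (comp_op _ _ _ _ _ _ _ (comp_S _ _ _ _ _ Ha Hb) Hc).
  rewrite <- (op_comp _ _ _ _ _ _ _ Ha Hb Sc).
  f_equal; apply functional_extensionality; intros y.
  rewrite (comp_op _ _ _ _ _ _ _ Hb Hc); ring.
Qed.

Lemma comp_1_l rho m b : symbol_S Lam rho m b -> comp sym1 b = b.
Proof.
  intros Hb; apply sym_ext; intros x k.
  rewrite <- (fourier_inversion _ x (S_smooth _ _ _ _ Hb k)).
  apply Z_Series_ext; intros l; unfold cterm, sym1; ring.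
Qed.

Lemma comp_1_r a : comp a sym1 = a.
Proof.
  apply sym_ext; intros x k; unfold comp.
  rewrite (Z_Series_ext _ (single 0 (a x k))); [apply Z_Series_single|].
  intros l; unfold cterm, sym1; rewrite hat_1; unfold single; destruct Z.eq_dec as [->|]; [|ring].
  rewrite Rmult_0_l, expi_0, Z.add_0_r; ring.
Qed.

Lemma op_1 f x : smooth_torus f -> op sym1 f x = f x.
Proof.
  intros Hf; rewrite <- (fourier_inversion f x Hf).
  apply Z_Series_ext; intros k; unfold pterm, sym1; ring.
Qed.

Lemma op_sadd rho m m' a b f x : symbol_S Lam rho m a -> symbol_S Lam rho m' b -> smooth_torus f ->
  op (sadd a b) f x = (op a f x + op b f x)%C.
Proof.
  intros Ha Hb Hf; unfold op; rewrite <- Z_Series_plus by (eapply zdom_pterm; eassumption).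
  apply Z_Series_ext; intros k; unfold pterm, sadd; ring.
Qed.

Lemma pdo_comp rho m1 m2 a b f x : symbol_S Lam rho m1 a -> symbol_S Lam rho m2 b ->
  smooth_torus f -> pdo a (pdo b f) x = pdo (comp a b) f x.
Proof.
  intros Ha Hb Hf.
  rewrite pdo_op by (eapply pdo_smooth; eassumption).
  rewrite pdo_op by assumption; rewrite <- (op_comp _ _ _ _ _ _ _ Ha Hb Hf).
  f_equal; apply functional_extensionality; intros y; now apply pdo_op.
Qed.

End Composition.

(** * Asymptotic summation *)

Fixpoint largest (P : nat -> Prop) (dec : forall n, {P n} + {~ P n}) (N : nat) : nat :=
  match N with
  | O => O
  | S n => if dec (S n) then S n else largest P dec n
  end.

Lemma largest_sat P dec N : largest P dec N = 0%nat \/ P (largest P dec N).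
Proof.
  induction N as [|N IH]; [now left|].
  simpl; destruct (dec (S N)); [now right|assumption].
Qed.

Lemma largest_ge P dec N n : (n <= N)%nat -> P n -> (n <= largest P dec N)%nat.
Proof.
  induction N as [|N IH]; intros Hn Pn; simpl; [assumption|].
  destruct (dec (S N)); [assumption|].
  apply IH; [|assumption].
  destruct (Nat.eq_dec n (S N)) as [->|]; [contradiction|lia].
Qed.

Lemma sum_f_R0_ge (u : nat -> R) n i : (forall j, 0 < u j) -> (i <= n)%nat -> u i <= sum_f_R0 u n.
Proof.
  intros Hu; induction n as [|n IH]; intros Hi.
  - replace i with 0%nat by lia; simpl; lra.
  - simpl; pose proof (Hu (S n)).
    destruct (Nat.eq_dec i (S n)) as [->|].
    + assert (0 <= sum_f_R0 u n) by (apply cond_pos_sum; intros; left; apply Hu); lra.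
    + specialize (IH ltac:(lia)); lra.
Qed.

Section Parametrix.
Variable Lam : Z -> R.
Hypothesis T : tame Lam.
Variable rho : R.
Hypothesis rho_pos : 0 < rho.

(** A diagonal choice: at [k] take [t (nu k)] with [nu k] the largest index at
    most [|k|] whose accumulated constants [K] are dominated by [Lam(k)^rho].
    The constants then cost one factor [Lam^rho], and [nu] tends to infinity. *)
Lemma asymptotic_sum (s : R) (t : nat -> sym) :
  (forall n, smooth_sym (t n)) ->
  (forall J n, (J <= n)%nat -> symbol_S Lam 0 (s - rho * INR J) (ssub (t n) (t J))) ->
  exists a, forall J, symbol_S Lam 0 (s - rho * INR J + rho) (ssub a (t J)).
Proof.
  intros St Ht.
  assert (HC : forall i : nat * nat * nat, exists A, 0 < A /\ let '(J, n, beta) := i in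
     (J <= n)%nat -> forall x k,
     Cmod (C_Derive_n (fun y => ssub (t n) (t J) y k) beta x) <= A * Rpower (Lam k) (s - rho * INR J)).
  { intros [[J n] beta]; destruct (le_dec J n) as [L|L].
    - destruct (crude_derive Lam _ _ beta (Ht J n L)) as (A & HA & B); exists A; auto.
    - exists 1; split; [lra|]; intros; contradiction. }
  destruct (functional_choice _ HC) as [A HA].
  set (K := fun n => sum_f_R0 (fun J => sum_f_R0 (fun beta => A (J, n, beta)) n) n).
  assert (HK : forall J n beta, (J <= n)%nat -> (beta <= n)%nat -> A (J, n, beta) <= K n).
  { intros J n beta HJ Hb; unfold K.
    eapply Rle_trans; [apply (sum_f_R0_ge (fun beta => A (J, n, beta)) n beta)|
      apply (sum_f_R0_ge (fun J => sum_f_R0 (fun beta => A (J, n, beta)) n) n J)]; trivial.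
    - intros j; apply (HA (J, n, j)).
    - intros j; eapply Rlt_le_trans; [apply (proj1 (HA (j, n, 0%nat)))|].
      apply (sum_f_R0_ge (fun beta => A (j, n, beta)) n 0); [intros i; apply (HA (j, n, i))|lia]. }
  set (nu := fun k => largest (fun n => K n <= Rpower (Lam k) rho) (fun n => Rle_dec _ _) (Z.to_nat (Z.abs k))).
  exists (fun x k => t (nu k) x k); intros J.
  assert (Sd : smooth_sym (ssub (fun x k => t (nu k) x k) (t J)))
    by (intros k; apply smooth_minus; apply St).
  apply crude_intro; [assumption..|]; intros beta.
  (* Beyond L, the constant for t (nu k) - t J and the derivative of order beta enters K (nu k); L > 0 excludes the default value of largest. *)
  set (L := S (J + beta)).
  destruct (tame_unbounded _ T rho (K L) rho_pos) as (R0 & HR0 & HR).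
  exists 1, (R0 + INR L); split; [lra|]; intros x k Hk.
  pose proof (pos_INR L).
  assert (Ln : (L <= nu k)%nat).
  { apply largest_ge; [|apply HR; lra].
    apply INR_le; rewrite (INR_IZR_INZ (Z.to_nat _)), Z2Nat.id, abs_IZR by lia; lra. }
  assert (Kn : K (nu k) <= Rpower (Lam k) rho).
  { destruct (largest_sat (fun n => K n <= Rpower (Lam k) rho) (fun n => Rle_dec _ _) (Z.to_nat (Z.abs k)))
      as [E|E]; [|exact E].
    change (nu k = 0%nat) in E; unfold L in Ln; lia. }
  assert (B := proj2 (HA (J, nu k, beta)) ltac:(unfold L in Ln; lia) x k).
  change (fun y => ssub (fun x k => t (nu k) x k) (t J) y k) with (fun y => ssub (t (nu k)) (t J) y k).
  eapply Rle_trans; [exact B|]; rewrite Rmult_1_l, Rpower_plus, Rmult_comm.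
  apply Rmult_le_compat_l; [left; apply Rpower_pos|].
  eapply Rle_trans; [apply HK|exact Kn]; unfold L in Ln; lia.
Qed.

(** * One-sided parametrices *)

Section Iteration.
Variables (m : R) (q p : sym) (L : sym -> sym).
Hypothesis Hp : symbol_M Lam rho (- m) p.
Hypothesis qp : forall x k, (q x k * p x k)%C = RtoC 1.
Hypothesis L_sub : forall s t u, symbol_S Lam 0 s t -> symbol_S Lam 0 s u -> L (ssub t u) = ssub (L t) (L u).
Hypothesis L_crude : forall s t, symbol_S Lam 0 s t -> symbol_S Lam 0 (s + m) (L t).
Hypothesis L_lead : forall s t, symbol_M Lam rho s t -> symbol_M Lam rho (s + m - rho) (ssub (L t) (smul q t)).

(** Here [L] is composition with [q] on one fixed side, and [p = 1/q]. *)
Fixpoint approx (n : nat) : sym :=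
  match n with
  | O => p
  | S n => ssub (approx n) (smul (ssub (L (approx n)) sym1) p)
  end.

Definition defect (n : nat) : sym := ssub (L (approx n)) sym1.

(** As [q p = 1], the new defect is [e - L (e p) = - (L (e p) - q e p)] with [e]
    the old one; only the remainder of the leading term survives. *)
Lemma approx_spec n : symbol_M Lam rho (- m) (approx n) /\
  symbol_M Lam rho (- (rho * INR (S n))) (defect n).
Proof.
  induction n as [|n [I1 I2]].
  - split; [exact Hp|]; unfold defect; simpl approx.
    replace sym1 with (smul q p) by (apply sym_ext; intros; apply qp).
    replace (- (rho * INR 1)) with (- m + m - rho) by (simpl; ring); now apply L_lead.
  - assert (Hc : symbol_M Lam rho (- (rho * INR (S n)) + - m) (smul (defect n) p)) by now apply M_mult.
    assert (Hc' : symbol_M Lam rho (- m) (smul (defect n) p)).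
    { apply (M_mono Lam T rho (- (rho * INR (S n)) + - m)); [|assumption].
      pose proof (pos_INR (S n)); nra. }
    split; [now apply M_minus|].
    replace (defect (S n)) with (sscal (- RtoC 1) (ssub (L (smul (defect n) p)) (smul q (smul (defect n) p)))).
    + apply M_scal; [assumption|].
      replace (- (rho * INR (S (S n)))) with (- (rho * INR (S n)) + - m + m - rho)
        by (rewrite (S_INR (S n)); ring).
      now apply L_lead.
    + unfold defect at 3; change (approx (S n)) with (ssub (approx n) (smul (defect n) p)).
      rewrite (L_sub (- m)) by (apply (M_crude Lam T rho); [lra|assumption]).
      apply sym_ext; intros x k.
      replace (smul q (smul (defect n) p)) with (defect n).
      * unfold sscal, ssub, defect, ssub; ring.
      * apply sym_ext; intros y j; unfold smul.
        transitivity ((q y j * p y j) * defect n y j)%C; [rewrite qp|]; ring.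
Qed.

Lemma approx_step n : symbol_M Lam rho (- m - rho * INR (S n)) (ssub (approx (S n)) (approx n)).
Proof.
  destruct (approx_spec n) as [_ I2].
  replace (ssub (approx (S n)) (approx n)) with (sscal (- RtoC 1) (smul (defect n) p)).
  - apply M_scal; [assumption|].
    replace (- m - rho * INR (S n)) with (- (rho * INR (S n)) + - m) by ring; now apply M_mult.
  - apply sym_ext; intros x k; cbn [approx]; unfold sscal, ssub, smul, defect, ssub; ring.
Qed.

Lemma approx_cauchy J n : (J <= n)%nat ->
  symbol_M Lam rho (- m - rho * INR J) (ssub (approx n) (approx J)).
Proof.
  induction 1 as [|n Hn IH].
  - replace (ssub (approx J) (approx J)) with (sscal (RtoC 0) (approx (S J) : sym)).
    2:{ apply sym_ext; intros; unfold sscal, ssub; ring. }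
    apply smoothing_M; [assumption|]; intros s.
    replace (sscal (RtoC 0) (approx (S J))) with (fun (_ : R) (_ : Z) => RtoC 0)
      by (apply sym_ext; intros; unfold sscal; ring).
    revert s; apply (smoothing_finite Lam T _ 0); [intros k; apply (smooth_const (RtoC 0))|reflexivity].
  - replace (ssub (approx (S n)) (approx J)) with
      (sadd (ssub (approx (S n)) (approx n)) (ssub (approx n) (approx J)))
      by (apply sym_ext; intros; unfold sadd, ssub; ring).
    replace (sadd (ssub (approx (S n)) (approx n)) (ssub (approx n) (approx J))) with
      (ssub (ssub (approx (S n)) (approx n)) (sscal (- RtoC 1) (ssub (approx n) (approx J))))
      by (apply sym_ext; intros; unfold sadd, ssub, sscal; ring).
    apply M_minus; [assumption| |now apply M_scal].
    apply (M_mono Lam T rho (- m - rho * INR (S n))); [|apply approx_step].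
    apply le_INR in Hn; rewrite S_INR; nra.
Qed.

Lemma one_sided_parametrix : exists tau, symbol_M Lam rho (- m) tau /\ smoothing Lam (ssub (L tau) sym1).
Proof.
  assert (r0 : 0 <= rho) by lra.
  destruct (asymptotic_sum (- m) approx) as [tau Htau].
  - intros n; apply (S_smooth Lam rho (- m)), M_S, approx_spec.
  - intros J n HJn; apply (M_crude Lam T rho); [assumption|]; now apply approx_cauchy.
  - assert (far : forall B, exists J, B <= rho * INR J - rho).
    { intros B; destruct (nat_above (B / rho + 1)) as [J HJ]; exists J.
      apply Rmult_le_compat_l with (r := rho) in HJ; [|lra].
      replace (rho * (B / rho + 1)) with (B + rho) in HJ by (field; lra); lra. }
    assert (Mtau : symbol_M Lam rho (- m) tau).
    { apply M_approx; [assumption|]; intros n; destruct (far (INR n)) as [J HJ].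
      exists (approx J); split; [apply approx_spec|].
      apply (S_mono Lam T 0 (- m - rho * INR J + rho)); [lra|apply Htau]. }
    exists tau; split; [assumption|]; intros s.
    destruct (far (- s)) as [J HJ].
    replace (ssub (L tau) sym1) with (sadd (L (ssub tau (approx J))) (defect J)).
    + apply S_plus; [assumption| |].
      * apply (S_mono Lam T 0 (- m - rho * INR J + rho + m)); [lra|]; apply L_crude, Htau.
      * apply (S_mono Lam T 0 (- (rho * INR (S J)))).
        -- rewrite S_INR; nra.
        -- apply (M_crude Lam T rho); [assumption|apply approx_spec].
    + rewrite (L_sub (- m)) by (apply (M_crude Lam T rho); [assumption|]; trivial; apply approx_spec).
      apply sym_ext; intros x k; unfold sadd, ssub, defect, ssub; ring.
Qed.

End Iteration.

Lemma smoothing_comp_l a b m : smoothing Lam a -> symbol_S Lam 0 m b -> smoothing Lam (comp a b).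
Proof.
  intros Ha Hb s; replace s with (s - m + m) by ring.
  apply comp_S; [assumption|apply Ha|assumption].
Qed.

Lemma smoothing_comp_r a b m : symbol_S Lam 0 m a -> smoothing Lam b -> smoothing Lam (comp a b).
Proof.
  intros Ha Hb s; replace s with (m + (s - m)) by ring.
  apply comp_S; [assumption|assumption|apply Hb].
Qed.

Lemma nonvanishing_modification m sigma : symbol_M Lam rho m sigma -> M_elliptic Lam m sigma ->
  exists q c, symbol_M Lam rho m q /\ 0 < c /\
    (forall x k, c * Rpower (Lam k) m <= Cmod (q x k)) /\ smoothing Lam (ssub sigma q).
Proof.
  intros Hs (c & R0 & Hc & HR0 & Hell).
  set (q := fun x k => if Rle_dec R0 (Rabs (IZR k)) then sigma x k else RtoC 1).
  assert (Sd : smoothing Lam (ssub sigma q)).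
  { apply (smoothing_finite Lam T _ R0).
    - intros k; apply smooth_minus; [apply (S_smooth Lam rho m), M_S, Hs|].
      unfold q; destruct Rle_dec; [apply (S_smooth Lam rho m), M_S, Hs|apply smooth_const].
    - intros x k Hk; unfold ssub, q; destruct Rle_dec; [ring|contradiction]. }
  destruct (finite_bound (fun _ k => RtoC (Rpower (Lam k) m)) (fun _ => 1)) with (R0 := R0) as (A & HA & B).
  { intros; lra. }
  { intros k; exists (Rpower (Lam k) m); split; [apply Rpower_pos|]; intros _.
    rewrite Cmod_R, Rabs_right; [lra|]; apply Rle_ge; left; apply Rpower_pos. }
  exists q, (Rmin c (/ A)); split; [|split; [|split; [|assumption]]].
  - replace q with (ssub sigma (ssub sigma q)) by (apply sym_ext; intros; unfold ssub; ring).
    apply M_minus; [assumption|assumption|now apply smoothing_M].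
  - apply Rmin_pos; [assumption|now apply Rinv_0_lt_compat].
  - intros x k; pose proof (Rpower_pos (Lam k) m) as HP; unfold q; destruct Rle_dec as [L|L].
    + eapply Rle_trans; [|now apply Hell]; apply Rmult_le_compat_r; [lra|apply Rmin_l].
    + specialize (B 0 k ltac:(lra)); simpl in B; rewrite Cmod_R, Rabs_right in B by lra.
      rewrite Cmod_1; apply Rle_trans with (/ A * Rpower (Lam k) m).
      * apply Rmult_le_compat_r; [lra|apply Rmin_r].
      * apply Rmult_le_reg_l with A; [assumption|].
        rewrite <- Rmult_assoc, Rinv_r; lra.
Qed.

(** With a left parametrix [tl] and a right one [tr], evaluating
    [comp tl (comp sigma tr)] in two ways shows that [tl - tr] is smoothing, so [tl]
    serves on both sides. *)
Theorem parametrix m sigma : symbol_M Lam rho m sigma -> M_elliptic Lam m sigma ->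
  exists tau, symbol_M Lam rho (- m) tau /\
    smoothing Lam (ssub (comp tau sigma) sym1) /\ smoothing Lam (ssub (comp sigma tau) sym1).
Proof.
  intros Hs Hell; assert (r0 : 0 <= rho) by lra.
  destruct (nonvanishing_modification m sigma Hs Hell) as (q & c & Hq & Hc & Hqc & Hd).
  set (d := ssub sigma q) in *.
  set (p := (fun x k => / q x k)%C : sym).
  assert (Hp : symbol_M Lam rho (- m) p) by (apply (M_inverse Lam T rho m q c); assumption).
  assert (qp : forall x k, (q x k * p x k)%C = RtoC 1).
  { intros x k; unfold p; apply Cinv_r; intros E; specialize (Hqc x k); rewrite E, Cmod_0 in Hqc.
    pose proof (Rpower_pos (Lam k) m); nra. }
  assert (Cq := M_crude Lam T rho m q r0 Hq). assert (Cs := M_crude Lam T rho m sigma r0 Hs).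
  destruct (one_sided_parametrix m q p (fun t => comp t q) Hp qp) as (tl & Mtl & Rl).
  { intros s t u Ht Hu; exact (comp_ssub_l Lam T 0 s m t u q Ht Hu Cq). }
  { intros s t Ht; exact (comp_S Lam T 0 s m t q Ht Cq). }
  { intros s t Ht; replace (smul q t) with (smul t q) by (apply sym_ext; intros; unfold smul; ring).
    exact (rem_M Lam T rho s m t q Ht Hq). }
  destruct (one_sided_parametrix m q p (fun t => comp q t) Hp qp) as (tr & Mtr & Rr).
  { intros s t u Ht Hu; exact (comp_ssub_r Lam T 0 m s q t u Cq Ht Hu). }
  { intros s t Ht; rewrite Rplus_comm; exact (comp_S Lam T 0 m s q t Cq Ht). }
  { intros s t Ht; rewrite (Rplus_comm s); exact (rem_M Lam T rho m s q t Hq Ht). }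
  assert (Cl := M_crude Lam T rho _ _ r0 Mtl). assert (Cr := M_crude Lam T rho _ _ r0 Mtr).
  assert (Es : sigma = sadd q d) by (apply sym_ext; intros; unfold d, sadd, ssub; ring).
  assert (rl : smoothing Lam (ssub (comp tl sigma) sym1)).
  { rewrite Es, (comp_sadd_r Lam T 0 (- m) m) by (trivial; apply Hd).
    replace (ssub (sadd (comp tl q) (comp tl d)) sym1) with (sadd (ssub (comp tl q) sym1) (comp tl d))
      by (apply sym_ext; intros; unfold sadd, ssub; ring).
    apply smoothing_plus; [assumption|assumption|]; exact (smoothing_comp_r tl d (- m) Cl Hd). }
  assert (rr : smoothing Lam (ssub (comp sigma tr) sym1)).
  { rewrite Es, (comp_sadd_l Lam T 0 m (- m)) by (trivial; apply Hd).
    replace (ssub (sadd (comp q tr) (comp d tr)) sym1) with (sadd (ssub (comp q tr) sym1) (comp d tr))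
      by (apply sym_ext; intros; unfold sadd, ssub; ring).
    apply smoothing_plus; [assumption|assumption|]; exact (smoothing_comp_l d tr (- m) Hd Cr). }
  set (r := ssub (comp tl sigma) sym1) in *. set (s := ssub (comp sigma tr) sym1) in *.
  assert (diff : ssub tl tr = ssub (comp r tr) (comp tl s)).
  { assert (E1 : comp tl sigma = sadd sym1 r) by (apply sym_ext; intros; unfold r, sadd, ssub; ring).
    assert (E2 : comp sigma tr = sadd sym1 s) by (apply sym_ext; intros; unfold s, sadd, ssub; ring).
    assert (A := comp_assoc Lam T 0 (- m) m (- m) tl sigma tr Cl Cs Cr).
    rewrite E1, E2 in A.
    rewrite (comp_sadd_r Lam T 0 (- m) 0), (comp_sadd_l Lam T 0 0 (- m)) in A
      by (trivial; try apply rr; try apply rl; apply (S_sym1 Lam T)).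
    rewrite (comp_1_r tl), (comp_1_l Lam 0 (- m) tr Cr) in A.
    apply sym_ext; intros x k; apply (f_equal (fun g => g x k)) in A; unfold sadd, ssub in *.
    match type of A with (?u + ?v)%C = _ => transitivity (u + v - v - tr x k)%C; [ring|] end.
    rewrite A; ring. }
  assert (Sdiff : smoothing Lam (ssub tl tr)).
  { rewrite diff; apply smoothing_minus; [assumption| |].
    - exact (smoothing_comp_l r tr (- m) rl Cr).
    - exact (smoothing_comp_r tl s (- m) Cl rr). }
  exists tl; split; [exact Mtl|split; [exact rl|]].
  replace (ssub (comp sigma tl) sym1) with (sadd s (comp sigma (ssub tl tr))).
  - apply smoothing_plus; [assumption|assumption|]; exact (smoothing_comp_r sigma _ m Cs Sdiff).
  - rewrite (comp_ssub_r Lam T 0 m (- m)) by assumption.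
    apply sym_ext; intros; unfold s, sadd, ssub; ring.
Qed.

Lemma pdo_identity_plus a b m1 m2 f x : symbol_S Lam 0 m1 a -> symbol_S Lam 0 m2 b ->
  smoothing Lam (ssub (comp a b) sym1) -> smooth_torus f ->
  pdo a (pdo b f) x = (f x + pdo (ssub (comp a b) sym1) f x)%C.
Proof.
  intros Ha Hb Hr Hf.
  rewrite (pdo_comp Lam T 0 m1 m2) by assumption.
  rewrite !pdo_op by assumption.
  rewrite <- (op_1 f x Hf) at 1; rewrite <- (op_sadd Lam T 0 0 0) by (trivial; try apply Hr; apply (S_sym1 Lam T)).
  f_equal; apply sym_ext; intros; unfold sadd, ssub; ring.
Qed.

(** Here [sigma tau = 1 + s - rem sigma tau], and the last two terms are
    [O(Lam^(-rho))], hence together at most 1/2 for large [|k|]. *)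
Lemma elliptic_of_right_inverse m sigma tau s :
  symbol_S Lam rho m sigma -> symbol_S Lam rho (- m) tau -> smoothing Lam s ->
  comp sigma tau = sadd sym1 s -> M_elliptic Lam m sigma.
Proof.
  intros Hs Ht Hsm E.
  destruct (rem_bound Lam T rho m (- m) sigma tau Hs Ht) as (K1 & HK1 & B1).
  destruct (S_bound Lam 0 (- rho) s (Hsm (- rho))) as (K2 & HK2 & B2).
  destruct (S_bound Lam rho (- m) tau Ht) as (K3 & HK3 & B3).
  destruct (tame_unbounded Lam T rho (2 * (K1 + K2)) rho_pos) as (R0 & HR0 & HR).
  exists (/ (2 * K3)), R0; split; [apply Rinv_0_lt_compat; lra|split; [assumption|]].
  intros x k Hk; specialize (B1 x k); specialize (B2 x k); specialize (B3 x k); specialize (HR k Hk).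
  replace (m - rho + - m) with (- rho) in B1 by ring.
  rewrite Rpower_Ropp in B1, B2, B3.
  pose proof (Rpower_pos (Lam k) rho) as Pr; pose proof (Rpower_pos (Lam k) m) as Pm.
  assert (small : (K1 + K2) * / Rpower (Lam k) rho <= / 2).
  { apply Rmult_le_reg_r with (Rpower (Lam k) rho); [assumption|].
    rewrite Rmult_assoc, Rinv_l by lra; lra. }
  assert (prod : (sigma x k * tau x k)%C = (RtoC 1 + (s x k - rem sigma tau x k))%C).
  { unfold rem; rewrite E; unfold ssub, sadd, smul, sym1; ring. }
  assert (low : / 2 <= Cmod (sigma x k) * Cmod (tau x k)).
  { rewrite <- Cmod_mult, prod.
    assert (1 <= Cmod (RtoC 1 + (s x k - rem sigma tau x k))%C + Cmod (s x k - rem sigma tau x k)%C).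
    { rewrite <- Cmod_1 at 1.
      replace (RtoC 1) with ((RtoC 1 + (s x k - rem sigma tau x k)) - (s x k - rem sigma tau x k))%C at 1 by ring.
      apply Cmod_minus_le. }
    assert (Cmod (s x k - rem sigma tau x k)%C <= / 2); [|lra].
    eapply Rle_trans; [apply Cmod_minus_le|]; lra. }
  assert (Cmod (sigma x k) * Cmod (tau x k) <= Cmod (sigma x k) * (K3 * / Rpower (Lam k) m))
    by (apply Rmult_le_compat_l; [apply Cmod_ge_0|assumption]).
  apply Rmult_le_reg_r with (K3 * / Rpower (Lam k) m);
    [apply Rmult_lt_0_compat; [assumption|now apply Rinv_0_lt_compat]|].
  apply Rle_trans with (/ 2); [right; field; lra|lra].
Qed.

End Parametrix.

Theorem theorem3p5 :
  forall (Lam : Z -> R) (mu rho : R),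
    weight_function Lam mu ->
    0 < rho <= 1 / mu ->
  forall (m : R) (sigma : R -> Z -> C),
    symbol_M Lam rho m sigma ->
    (M_elliptic Lam m sigma <->
     exists tau : R -> Z -> C,
       symbol_M Lam rho (- m) tau /\
       (exists r : R -> Z -> C,
          symbol_M_infty Lam rho r /\
          forall f : R -> C, smooth_torus f ->
          forall x : R,
            pdo tau (pdo sigma f) x = (f x + pdo r f x)%C) /\
       (exists s : R -> Z -> C,
          symbol_M_infty Lam rho s /\
          forall f : R -> C, smooth_torus f ->
          forall x : R,
            pdo sigma (pdo tau f) x = (f x + pdo s f x)%C)).
Proof.
  intros Lam mu rho HL [rho_pos _] m sigma Hs.
  assert (T := weight_tame Lam mu HL). assert (r0 : 0 <= rho) by lra.
  assert (Cs := M_crude Lam T rho m sigma r0 Hs).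
  split.
  - intros Hell; destruct (parametrix Lam T rho rho_pos m sigma Hs Hell) as (tau & Ht & Hl & Hr).
    assert (Ct := M_crude Lam T rho (- m) tau r0 Ht).
    exists tau; split; [assumption|split].
    + exists (ssub (comp tau sigma) sym1); split; [now apply smoothing_M_infty|].
      intros f Hf x; exact (pdo_identity_plus Lam T tau sigma (- m) m f x Ct Cs Hl Hf).
    + exists (ssub (comp sigma tau) sym1); split; [now apply smoothing_M_infty|].
      intros f Hf x; exact (pdo_identity_plus Lam T sigma tau m (- m) f x Cs Ct Hr Hf).
  - intros (tau & Ht & _ & s & Hsm & E).
    assert (Ct := M_crude Lam T rho (- m) tau r0 Ht).
    apply (elliptic_of_right_inverse Lam T rho rho_pos m sigma tau s);
      [now apply M_S|now apply M_S|now apply (M_infty_smoothing Lam T rho)|].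
    apply sym_ext; intros x k; apply (expi_cancel (IZR k * x)).
    specialize (E _ (smooth_expi k) x).
    rewrite (pdo_comp Lam T 0 m (- m)), !pdo_expi in E by (trivial; apply smooth_expi).
    unfold sadd, sym1; rewrite Cmult_comm, E; ring.
Qed.
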